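(* There is a ($\mathbb{Q}$-linear) map $\Phi\colon\Omega_1\to\Omega_2$ such that $$\Phi\circ\mathrm{Tr}_1^{\mathrm{C}}=3\,\mathrm{Tr}_2^{\mathrm{C}}\colon\mathfrak{h}\to\Omega_2.$$
   Context: All vector spaces are over $\mathbb{Q}$. $H$ is a symplectic vector space of dimension $2g$ with nondegenerate skew-symmetric form $(\ \cdot\ )$. Hairy Lie graphs with one tree. Here a hairy Lie graph is a unitrivalent tree (with at least one trivalent vertex) such that: each trivalent vertex carries a cyclic ordering of its three half-edges; some disjoint pairs of univalent vertices are each joined by an additional directed edge, called a dotted edge (not part of the tree); the remaining univalent vertices, called leaves, are colored with elements of $H$. The Lie degree is the number of trivalent vertices. $C_{1,r}\mathcal{H}(n)$ is the vector space spanned by such graphs with $r$ dotted edges and Lie degree $n$, modulo: the AS relation (reversing the cyclic order at one trivalent vertex gives a minus sign); the IHX relation $I(A,B;C,D)+I(B,C;A,D)+I(C,A;B,D)=0$, where $I(A,B;C,D)$ denotes a graph having a tree edge $e$ whose two trivalent end vertices have cyclic orders $(e,A,B)$ and $(e,C,D)$, and the three graphs are identical elsewhere; multilinearity in the $H$-colorings; reversing the direction of a dotted edge gives a minus sign. $\mathfrak{h}(n):=C_{1,0}\mathcal{H}(n)$ and $\mathfrak{h}=\bigoplus_{n\ge1}\mathfrak{h}(n)$. The spaces $\Omega_r$. For $r\ge1$, $\Omega_r(n)$ is the quotient of $C_{1,r}\mathcal{H}(n)$ by the following relations, and $\Omega_r=\bigoplus_n\Omega_r(n)$. (C1) A graph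 in which a dotted edge joins two univalent vertices adjacent to the same trivalent vertex is $0$. (C2) A hair can be slid across a dotted edge: suppose a dotted edge is directed from a univalent vertex $X$ to a univalent vertex $Y$, and the tree edge at $X$ ends at a trivalent vertex $h$ carrying a hair colored $v\in H$, with cyclic order (third edge, hair, edge to $X$). Then the graph equals the one obtained by deleting $h$ and its hair (so the third edge now ends at $X$) and inserting in the tree edge ending at $Y$ a new trivalent vertex $h'$ with a hair colored $v$ and cyclic order (edge to $Y$, hair, other edge); the dotted edge is still directed from $X$ to $Y$. (C3) Given a disjoint union of a tripod (tree with one trivalent vertex) and another tree, with dotted edges, such that the three legs of the tripod are joined by three dotted edges, directed from the tripod, to three univalent vertices of the other tree: the sum of the three one-tree graphs obtained by turning exactly one of these three dotted edges into a solid edge is $0$. The traces. $\mathrm{Tr}_r\colon\mathfrak{h}(n)\to C_{1,r}\mathcal{H}(n)$ sends a tree to the sum, over all unordered collections of $r$ pairwise disjoint unordered pairs of its leaves, of the graph obtained by adding, for each chosen pair $\{l_1,l_2\}$ with colors $x_1,x_2$, a dotted edge directed from $l_1$ to $l_2$ (forgetting the colors) and multiplying by $(x_1\cdot x_2)$. $\mathrm{Tr}^{\mathrm{C}}_r\colon\mathfrak{h}\to\Omega_r$ is the composition of $\mathrm{Tr}_r$ with the projection to $\Omega_r$. *)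

(* Defs.v *)
From HB Require Import structures.
From mathcomp Require Import all_boot all_order all_algebra ring_quotient.
From mathcomp Require Import boolp.
From mathcomp.multinomials Require Import freeg.

Set Implicit Arguments.
Unset Strict Implicit.
Unset Printing Implicit Defensive.

Import GRing.Theory.
Local Open Scope ring_scope.

Section LinearQuotient.
Variables (K : nzRingType) (V : lmodType K) (rels : V -> Prop).

Inductive lspan : V -> Prop :=
| lspan0 : lspan 0
| lspanS (a : K) (x y : V) : rels x -> lspan y -> lspan (a *: x + y).

Lemma lspanD x y : lspan x -> lspan y -> lspan (x + y).
Proof.
by move=> Sx Sy; elim: Sx => [|a u v Ru _ IH]; rewrite ?add0r // -addrA;
  apply: lspanS.
Qed.

Lemma lspanZ a x : lspan x -> lspan (a *: x).
Proof.
elim=> [|b u v Ru _ IH]; first by rewrite scaler0; apply: lspan0.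
by rewrite scalerDr scalerA; apply: lspanS.
Qed.

Lemma lspan_gen x : rels x -> lspan x.
Proof. by move=> Rx; rewrite -[x]scale1r -[_ *: x]addr0; apply/lspanS/lspan0. Qed.

Definition in_lspan : {pred V} := fun x => `[< lspan x >].

Lemma in_lspan_zmod_closed : zmod_closed in_lspan.
Proof.
split=> [|x y /asboolP Sx /asboolP Sy]; apply/asboolP; first exact: lspan0.
by apply: lspanD => //; rewrite -scaleN1r; apply: lspanZ.
Qed.
HB.instance Definition _ := GRing.isZmodClosed.Build V in_lspan in_lspan_zmod_closed.

Definition lquot := Quotient.quot in_lspan.
HB.instance Definition _ := GRing.Zmodule.on lquot.

Definition lproj_def (x : V) : lquot := (\pi_(Quotient.quot in_lspan) x)%qT.

Lemma lproj_eq x y : (lproj_def x = lproj_def y) <-> lspan (x - y).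
Proof.
split=> [/eqP|Sxy]; last apply/eqP;
  rewrite /lproj_def -Quotient.idealrBE; last exact/asboolP.
by move/asboolP.
Qed.

Lemma lproj_surj (q : lquot) : {x | lproj_def x = q}.
Proof. by exists (repr q); rewrite /lproj_def reprK. Qed.

Lemma lproj_is_zmod_morphism : zmod_morphism lproj_def.
Proof. by move=> x y; rewrite /lproj_def !piE. Qed.
HB.instance Definition _ :=
  GRing.isZmodMorphism.Build V lquot lproj_def lproj_is_zmod_morphism.

Definition lquot_scale (a : K) (q : lquot) : lquot := lproj_def (a *: repr q).

Lemma lproj_scale a x : lquot_scale a (lproj_def x) = lproj_def (a *: x).
Proof.
apply/lproj_eq; rewrite -scalerBr; apply/lspanZ/lproj_eq.
by rewrite {1}/lproj_def reprK.
Qed.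

Lemma lquot_scaleA a b v :
  lquot_scale a (lquot_scale b v) = lquot_scale (a * b) v.
Proof. by have [x <-] := lproj_surj v; rewrite !lproj_scale scalerA. Qed.
Lemma lquot_scale1 : left_id 1 lquot_scale.
Proof. by move=> v; have [x <-] := lproj_surj v; rewrite lproj_scale scale1r. Qed.
Lemma lquot_scaleDr : right_distributive lquot_scale +%R.
Proof.
move=> a v w; have [x <-] := lproj_surj v; have [y <-] := lproj_surj w.
by rewrite -raddfD !lproj_scale -raddfD scalerDr.
Qed.
Lemma lquot_scaleDl v : {morph lquot_scale^~ v : a b / a + b}.
Proof.
by move=> a b; have [x <-] := lproj_surj v; rewrite !lproj_scale -raddfD scalerDl.
Qed.
HB.instance Definition _ := GRing.Zmodule_isLmodule.Build K lquot
  lquot_scaleA lquot_scale1 lquot_scaleDr lquot_scaleDl.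

Lemma lproj_is_scalable : scalable lproj_def.
Proof. by move=> a x; rewrite -lproj_scale. Qed.
HB.instance Definition _ :=
  GRing.isScalable.Build K V lquot *:%R lproj_def lproj_is_scalable.

Definition lproj : {linear V -> lquot} := lproj_def.

Section Lift.
Variables (W : lmodType K) (f : {linear V -> W}).
Hypothesis f_rels : forall x, rels x -> f x = 0.

Definition llift_def (q : lquot) : W := f (repr q).

Lemma f_lspan x : lspan x -> f x = 0.
Proof. by elim=> [|a u v Ru _ IH]; rewrite ?linear0 // linearP f_rels // scaler0 add0r. Qed.

Lemma llift_proj x : llift_def (lproj x) = f x.
Proof.
apply/eqP; rewrite -subr_eq0 -linearB; apply/eqP/f_lspan/lproj_eq.
by rewrite {1}/lproj_def reprK.
Qed.

Lemma llift_is_linear : linear llift_def.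
Proof.
move=> a v w; have [x <-] := lproj_surj v; have [y <-] := lproj_surj w.
by rewrite -[_ + _](linearP lproj) !llift_proj linearP.
Qed.
HB.instance Definition _ :=
  GRing.isLinear.Build K lquot W *:%R llift_def llift_is_linear.

Definition llift : {linear lquot -> W} := llift_def.

Lemma lliftE x : llift (lproj x) = f x.
Proof. exact: llift_proj. Qed.
End Lift.

End LinearQuotient.

Section FreeLift.
Variables (K : nzRingType) (X : choiceType) (W : lmodType K) (f : X -> W).

Lemma fglift_is_linear : linear (fglift f : {freeg X / K} -> W).
Proof.
suff fgliftE D : fglift f D = \sum_(x <- dom D) coeff x D *: f x.
  have wide D (s : seq X) : uniq s -> {subset dom D <= s} ->
      fglift f D = \sum_(x <- s) coeff x D *: f x.
    move=> us Ds; rewrite fgliftE [RHS](bigID (mem (dom D))) /= [X in _ + X]big1.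
      rewrite addr0 -[RHS]big_filter; apply: perm_big; apply: uniq_perm.
      - exact: uniq_dom.
      - by rewrite filter_uniq.
      by move=> x; rewrite mem_filter; case: (boolP (x \in dom D)) => [/Ds->|].
    by move=> x /coeff_outdom->; rewrite scale0r.
  move=> a D1 D2; set s := undup (dom (a *: D1 + D2) ++ dom D1 ++ dom D2).
  have us : uniq s by rewrite undup_uniq.
  rewrite !(wide _ s) //; try by move=> x xD; rewrite mem_undup !mem_cat xD ?orbT.
  rewrite scaler_sumr -big_split /=; apply: eq_bigr => x _.
  by rewrite coeffD coeffZ scalerDl scalerA.
by rewrite -{1}[D]Freeg_dom fglift_Freeg /prelift big_map.
Qed.
HB.instance Definition _ :=
  GRing.isLinear.Build K {freeg X / K} W *:%R (fglift f) fglift_is_linear.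

Definition fglin : {linear {freeg X / K} -> W} := fglift f.

Lemma fglinE x : fglin << x >> = f x.
Proof. by rewrite /fglin /= liftU scale1r. Qed.
End FreeLift.

Section DirectSum.
Variables (K : nzRingType) (V : nat -> lmodType K).

Record dsum : Type := DSum {
  dsum_val :> forall n, V n;
  _ : exists N, forall n, (N <= n)%N -> dsum_val n = 0 }.

Lemma dsumP (x y : dsum) : (forall n, x n = y n) -> x = y.
Proof.
case: x y => [x xP] [y yP] /= exy.
have {}exy : x = y by apply: functional_extensionality_dep.
by case: _ / exy yP => yP; congr DSum; apply: Prop_irrelevance.
Qed.

HB.instance Definition _ := gen_eqMixin dsum.
HB.instance Definition _ := gen_choiceMixin dsum.

Fact dsum_zero_subproof : exists N, forall n, (N <= n)%N -> 0 = 0 :> V n.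
Proof. by exists 0%N. Qed.
Definition dsum_zero := DSum dsum_zero_subproof.

Fact dsum_opp_subproof (x : dsum) :
  exists N, forall n, (N <= n)%N -> - x n = 0.
Proof. by case: x => x [N xN]; exists N => n /xN /= ->; rewrite oppr0. Qed.
Definition dsum_opp x := DSum (dsum_opp_subproof x).

Fact dsum_add_subproof (x y : dsum) :
  exists N, forall n, (N <= n)%N -> x n + y n = 0.
Proof.
case: x y => [x [N xN]] [y [M yM]] /=; exists (maxn N M) => n.
by rewrite geq_max => /andP[/xN-> /yM->]; rewrite addr0.
Qed.
Definition dsum_add x y := DSum (dsum_add_subproof x y).

Fact dsum_scale_subproof (a : K) (x : dsum) :
  exists N, forall n, (N <= n)%N -> a *: x n = 0.
Proof. by case: x => x [N xN]; exists N => n /xN /= ->; rewrite scaler0. Qed.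
Definition dsum_scale a x := DSum (dsum_scale_subproof a x).

Lemma dsum_addA : associative dsum_add.
Proof. by move=> x y z; apply: dsumP => n /=; rewrite addrA. Qed.
Lemma dsum_addC : commutative dsum_add.
Proof. by move=> x y; apply: dsumP => n /=; rewrite addrC. Qed.
Lemma dsum_add0 : left_id dsum_zero dsum_add.
Proof. by move=> x; apply: dsumP => n /=; rewrite add0r. Qed.
Lemma dsum_addN : left_inverse dsum_zero dsum_opp dsum_add.
Proof. by move=> x; apply: dsumP => n /=; rewrite addNr. Qed.
HB.instance Definition _ :=
  GRing.isZmodule.Build dsum dsum_addA dsum_addC dsum_add0 dsum_addN.

Lemma dsum_scaleA a b x : dsum_scale a (dsum_scale b x) = dsum_scale (a * b) x.
Proof. by apply: dsumP => n /=; rewrite scalerA. Qed.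
Lemma dsum_scale1 : left_id 1 dsum_scale.
Proof. by move=> x; apply: dsumP => n /=; rewrite scale1r. Qed.
Lemma dsum_scaleDr : right_distributive dsum_scale +%R.
Proof. by move=> a x y; apply: dsumP => n /=; rewrite scalerDr. Qed.
Lemma dsum_scaleDl x : {morph dsum_scale^~ x : a b / a + b}.
Proof. by move=> a b; apply: dsumP => n /=; rewrite scalerDl. Qed.
HB.instance Definition _ := GRing.Zmodule_isLmodule.Build K dsum
  dsum_scaleA dsum_scale1 dsum_scaleDr dsum_scaleDl.

End DirectSum.

Section DirectSumMap.
Variables (K : nzRingType) (V W : nat -> lmodType K).
Variable f : forall n, {linear V n -> W n}.

Fact dsum_map_subproof (x : dsum V) :
  exists N, forall n, (N <= n)%N -> f n (x n) = 0.
Proof. by case: x => x [N xN]; exists N => n /xN /= ->; rewrite linear0. Qed.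
Definition dsum_map_def (x : dsum V) : dsum W := DSum (dsum_map_subproof x).

Lemma dsum_map_is_linear : linear dsum_map_def.
Proof. by move=> a x y; apply: dsumP => n /=; rewrite linearP. Qed.
HB.instance Definition _ := GRing.isLinear.Build K (dsum V) (dsum W) *:%R
  dsum_map_def dsum_map_is_linear.

Definition dsum_map : {linear dsum V -> dsum W} := dsum_map_def.
End DirectSumMap.

(* [Node A B] stands for a trivalent vertex with cyclic order
   (root edge, A, B). An unrooted planar unitrivalent tree is given by a pair
   (A, B), which represents the tree obtained by gluing the root edges of A
   and B into one edge: each such tree is thus represented once for every
   choice of a directed edge. *)
Inductive btree (L : Type) := Leaf of L | Node of btree L & btree L.
Arguments Leaf {L}.
Arguments Node {L}.

Notation utree L := (btree L * btree L)%type.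

Section BinaryTrees.
Variable L : Type.
Implicit Types (A B : btree L) (T : utree L).

Fixpoint leaves A : seq L :=
  match A with Leaf l => [:: l] | Node A B => leaves A ++ leaves B end.

Fixpoint nodes A : nat :=
  match A with Leaf _ => 0 | Node A B => (nodes A + nodes B).+1 end.

Definition uleaves T := leaves T.1 ++ leaves T.2.
Definition lie_degree T := (nodes T.1 + nodes T.2)%N.

Fixpoint bmap (L' : Type) (f : L -> L') A : btree L' :=
  match A with Leaf l => Leaf (f l) | Node A B => Node (bmap f A) (bmap f B) end.
Definition umap (L' : Type) (f : L -> L') T : utree L' :=
  (bmap f T.1, bmap f T.2).

(* The second argument of [f] is a leaf and the first one is its position in
   the sequence of leaves, counted from [p]. *)
Fixpoint bmapi (L' : Type) (f : nat -> L -> L') p A : btree L' :=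
  match A with
  | Leaf l => Leaf (f p l)
  | Node A B => Node (bmapi f p A) (bmapi f (p + size (leaves A))%N B)
  end.
Definition umapi (L' : Type) (f : nat -> L -> L') T : utree L' :=
  (bmapi f 0 T.1, bmapi f (size (leaves T.1)) T.2).
End BinaryTrees.

Section BinaryTreesEq.
Variable L : choiceType.

Fixpoint btree_enc (A : btree L) : GenTree.tree L :=
  match A with
  | Leaf l => GenTree.Leaf l
  | Node A B => GenTree.Node 0 [:: btree_enc A; btree_enc B]
  end.
Fixpoint btree_dec (t : GenTree.tree L) : option (btree L) :=
  match t with
  | GenTree.Leaf l => Some (Leaf l)
  | GenTree.Node _ [:: s; t] =>
      if (btree_dec s, btree_dec t) is (Some A, Some B) then Some (Node A B)
      else None
  | _ => None
  end.
Lemma btree_encK : pcancel btree_enc btree_dec.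
Proof. by elim=> //= A -> B ->. Qed.
HB.instance Definition _ := Choice.copy (btree L) (pcan_type btree_encK).

Fixpoint bsubst (l : L) (B A : btree L) : btree L :=
  match A with
  | Leaf l' => if l' == l then B else A
  | Node A1 A2 => Node (bsubst l B A1) (bsubst l B A2)
  end.
Definition usubst l B (T : utree L) : utree L :=
  (bsubst l B T.1, bsubst l B T.2).
End BinaryTreesEq.

(* A univalent vertex is either a hair coloured by [v : H], encoded by [inl v],
   or an end of the dotted edge named [i : nat], encoded by [inr (i, b)]: the
   dotted edge is directed from [inr (i, false)] to [inr (i, true)]. *)
Notation vertex H := (H + nat * bool)%type.
Notation hair v := (Leaf (inl v)).
Notation dot_src i := (Leaf (inr (i, false))).
Notation dot_tgt i := (Leaf (inr (i, true))).

Section HairyGraphs.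
Variable H : Type.
Implicit Types (T : utree (vertex H)) (x : vertex H).

Definition dot_ends T : seq (nat * bool) :=
  pmap (fun x => if x is inr d then Some d else None) (uleaves T).

Definition is_hairy_graph (r n : nat) T : bool :=
  [&& lie_degree T == n, (0 < n)%N, uniq (dot_ends T),
      all (fun d => (d.1, ~~ d.2) \in dot_ends T) (dot_ends T)
    & size (dot_ends T) == r.*2].

Definition rename_dot (f : nat -> nat) x : vertex H :=
  if x is inr (i, b) then inr (f i, b) else x.

Definition reverse_dot (i : nat) x : vertex H :=
  if x is inr (j, b) then inr (j, if j == i then ~~ b else b) else x.
End HairyGraphs.

Record hairy_graph (H : choiceType) (r n : nat) := HairyGraph {
  hg_tree : utree (vertex H);
  _ : is_hairy_graph r n hg_tree }.
HB.instance Definition _ (H : choiceType) (r n : nat) :=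
  [isSub for @hg_tree H r n].
HB.instance Definition _ (H : choiceType) (r n : nat) :=
  [Choice of hairy_graph H r n by <:].

Section GraphSpaces.
Variables (H : vectType rat) (r n : nat).
Implicit Types (G : hairy_graph H r n) (A B D E : btree (vertex H)).
Implicit Types (T : utree (vertex H)).

(* The first three relations identify the descriptions of isomorphic graphs:
   they change the edge from which the tree is seen and the names of the dotted
   edges. Since they allow one to look at a graph from any edge, it is enough to
   state the other relations at that edge. *)
Inductive graph_rel : {freeg (hairy_graph H r n) / rat} -> Prop :=
| rel_swap G G' A B :
    hg_tree G = (A, B) -> hg_tree G' = (B, A) ->
    graph_rel (<< G >> - << G' >>)
| rel_rotate G G' A B D :
    hg_tree G = (Node A B, D) -> hg_tree G' = (A, Node B D) ->
    graph_rel (<< G >> - << G' >>)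
| rel_rename G G' (f : nat -> nat) :
    {in unzip1 (dot_ends (hg_tree G)) &, injective f} ->
    hg_tree G' = umap (rename_dot f) (hg_tree G) ->
    graph_rel (<< G >> - << G' >>)
| rel_AS G G' A B D :
    hg_tree G = (Node A B, D) -> hg_tree G' = (Node B A, D) ->
    graph_rel (<< G >> + << G' >>)
| rel_IHX G G' G'' A B D E :
    hg_tree G = (Node A B, Node D E) ->
    hg_tree G' = (Node B D, Node A E) ->
    hg_tree G'' = (Node D A, Node B E) ->
    graph_rel (<< G >> + << G' >> + << G'' >>)
| rel_linear G G' G'' (a : rat) (u v : H) D :
    hg_tree G = (hair (a *: u + v), D) ->
    hg_tree G' = (hair u, D) -> hg_tree G'' = (hair v, D) ->
    graph_rel (<< G >> - (a *: << G' >> + << G'' >>))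
| rel_reverse G G' (i : nat) :
    (i, false) \in dot_ends (hg_tree G) ->
    hg_tree G' = umap (reverse_dot i) (hg_tree G) ->
    graph_rel (<< G >> + << G' >>).

Definition graph_space := lquot graph_rel.

Definition graph_class G : graph_space := lproj graph_rel << G >>.

(* In [omega_slide], the dotted edge i goes from X = [dot_src i] to
   Y = [dot_tgt i], which lies in D. On the left the graph is seen from the third
   edge at h. On the right it is seen from the edge ending at X; the new
   vertex, seen from its other edge, has cyclic order (other, Y, hair), which is
   the same as (Y, hair, other).
   In [omega_tripod], the tripod has three legs carrying, in this cyclic order,
   [dot_src i], [dot_src j] and [dot_src k]; making the dotted edge i solid
   grafts the first leg at the leaf [dot_tgt i] of the other tree T. The
   subset condition excludes substitutions which do nothing; the other
   conditions on T follow from G1, G2, G3 being hairy graphs. *)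
Inductive omega_rel : graph_space -> Prop :=
| omega_adjacent G (i : nat) (b : bool) D :
    hg_tree G = (Node (Leaf (inr (i, b))) (Leaf (inr (i, ~~ b))), D) ->
    omega_rel (graph_class G)
| omega_slide G G' (i : nat) (v : H) D :
    hg_tree G = (Node (hair v) (dot_src i), D) ->
    hg_tree G' = (dot_src i, bsubst (inr (i, true)) (Node (dot_tgt i) (hair v)) D) ->
    omega_rel (graph_class G - graph_class G')
| omega_tripod G1 G2 G3 (i j k : nat) T :
    uniq [:: i; j; k] ->
    {subset [:: (i, true); (j, true); (k, true)] <= dot_ends T} ->
    hg_tree G1 = usubst (inr (i, true)) (Node (dot_src j) (dot_src k)) T ->
    hg_tree G2 = usubst (inr (j, true)) (Node (dot_src k) (dot_src i)) T ->
    hg_tree G3 = usubst (inr (k, true)) (Node (dot_src i) (dot_src j)) T ->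
    omega_rel (graph_class G1 + graph_class G2 + graph_class G3).

Definition omega_space := lquot omega_rel.
End GraphSpaces.

(* An unordered pair of leaves of a tree with m leaves is encoded by the
   pair of their positions in increasing order. *)
Definition matchings (m r : nat) : {set {set 'I_m * 'I_m}} :=
  [set M : {set 'I_m * 'I_m} |
    [&& #|M| == r, [forall e in M, (e.1 < e.2)%N]
      & [forall e in M, forall f in M,
           (e != f) ==> [disjoint [set e.1; e.2] & [set f.1; f.2]]]]].

Definition pair_end (I : Type) (e : I * I) (b : bool) : I :=
  if b then e.2 else e.1.

Section AddDots.
Variable H : vectType rat.
Implicit Types (T : utree (vertex H)).

Definition hair_color T (p : nat) : H :=
  if nth (inl 0) (uleaves T) p is inl v then v else 0.

(* Joins the leaves of each pair in [M] by a dotted edge, directed from the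
   first leaf to the second one and named by the position of its source. *)
Definition add_dots T (M : {set 'I_(size (uleaves T)) * 'I_(size (uleaves T))}) :
    utree (vertex H) :=
  umapi (fun p x =>
    if [pick eb | (eb.1 \in M) && (pair_end eb.1 eb.2 == p :> nat)]
      is Some (e, b) then inr (val e.1, b) else x) T.
End AddDots.

Section TreeFacts.
Variables (L L' : Type).

Lemma leaves_bmap (f : L -> L') A : leaves (bmap f A) = map f (leaves A).
Proof. by elim: A => //= A -> B ->; rewrite map_cat. Qed.

Lemma nodes_bmap (f : L -> L') A : nodes (bmap f A) = nodes A.
Proof. by elim: A => //= A -> B ->. Qed.

Lemma uleaves_umap (f : L -> L') T : uleaves (umap f T) = map f (uleaves T).
Proof. by rewrite /uleaves /= !leaves_bmap map_cat. Qed.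

Lemma lie_degree_umap (f : L -> L') T : lie_degree (umap f T) = lie_degree T.
Proof. by rewrite /lie_degree /= !nodes_bmap. Qed.

Lemma bmap_comp (L'' : Type) (f : L' -> L'') (g : L -> L') A :
  bmap f (bmap g A) = bmap (f \o g) A.
Proof. by elim: A => //= A -> B ->. Qed.

Lemma eq_bmap (f g : L -> L') A : f =1 g -> bmap f A = bmap g A.
Proof. by move=> fg; elim: A => [l|A IHA B IHB] /=; rewrite ?fg ?IHA ?IHB. Qed.

Lemma umap_comp (L'' : Type) (f : L' -> L'') (g : L -> L') T :
  umap f (umap g T) = umap (f \o g) T.
Proof. by rewrite /umap /= !bmap_comp. Qed.

Lemma eq_umap (f g : L -> L') T : f =1 g -> umap f T = umap g T.
Proof. by move=> fg; rewrite /umap !(eq_bmap _ fg). Qed.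

Lemma bskel (c : L' -> L) (s : seq L') A :
  map c s = leaves A -> exists2 S, leaves S = s & bmap c S = A.
Proof.
elim: A s => [l|A IHA B IHB] s /=.
  by case: s => [|x [|? ?]] //= [<-]; exists (Leaf x).
move=> cs; pose k := size (leaves A).
have [|SA SAl SAc] := IHA (take k s); first by rewrite map_take cs take_size_cat.
have [|SB SBl SBc] := IHB (drop k s); first by rewrite map_drop cs drop_size_cat.
by exists (Node SA SB); rewrite /= ?SAl ?SBl ?cat_take_drop // SAc SBc.
Qed.

Lemma uskel (c : L' -> L) (s : seq L') T :
  map c s = uleaves T -> exists2 S, uleaves S = s & umap c S = T.
Proof.
case: T => A B cs; have [S Sl] := @bskel c s (Node A B) cs.
by case: S Sl => [|SA SB] //= <- [<- <-]; exists (SA, SB).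
Qed.
End TreeFacts.

Lemma bmapi_skel (I : eqType) (L L' : Type) (g : nat -> L -> L') (c : I -> L)
    (p : nat) (s1 s2 : seq I) (A : btree I) :
  uniq (s1 ++ leaves A ++ s2) -> p = size s1 ->
  bmapi g p (bmap c A) =
    bmap (fun l => g (index l (s1 ++ leaves A ++ s2)) (c l)) A.
Proof.
elim: A p s1 s2 => [l|A IHA B IHB] p s1 s2 /= us ->.
  rewrite index_cat /= eqxx addn0; case: ifP => // ls.
  by move: us; rewrite cat_uniq => /and3P[_ /hasPn/(_ l (mem_head _ _))/=]; rewrite ls.
rewrite leaves_bmap size_map; congr Node.
  by rewrite -catA in us *; apply: IHA.
rewrite (IHB _ (s1 ++ leaves A) s2) ?size_cat -?catA //.
by rewrite -!catA in us *.
Qed.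

Lemma umapi_skel (I : eqType) (L L' : Type) (g : nat -> L -> L') (c : I -> L)
    (S : utree I) :
  uniq (uleaves S) ->
  umapi g (umap c S) = umap (fun l => g (index l (uleaves S)) (c l)) S.
Proof.
case: S => A B uS; rewrite /umapi /umap /= leaves_bmap size_map; congr pair.
  exact: (@bmapi_skel _ _ _ g c 0 [::]).
rewrite (@bmapi_skel _ _ _ g c _ (leaves A) [::]) ?cats0 //.
Qed.

Section Dotting.
Variables (H : vectType rat) (I E : finType) (M : {set E}).
Variables (f : E -> I * I) (nm : E -> nat) (c : I -> H).

Definition dotify (l : I) : vertex H :=
  if [pick eb | (eb.1 \in M) && (pair_end (f eb.1) eb.2 == l)] is Some (e, b)
  then inr (nm e, b) else inl (c l).

Definition ends_inj :=
  forall e e' b b', e \in M -> e' \in M ->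
  pair_end (f e) b = pair_end (f e') b' -> e = e' /\ b = b'.

Hypotheses (f_inj : ends_inj) (nm_inj : {in M &, injective nm}).

Lemma dotify_end e b : e \in M -> dotify (pair_end (f e) b) = inr (nm e, b).
Proof.
move=> eM; rewrite /dotify; case: pickP => [[e' b'] /= /andP[e'M /eqP]|].
  by case/f_inj=> // -> ->.
by move/(_ (e, b)); rewrite /= eM eqxx.
Qed.

Lemma dotify_spec l :
  (exists e b, [/\ e \in M, l = pair_end (f e) b & dotify l = inr (nm e, b)])
  \/ ((forall e b, e \in M -> pair_end (f e) b != l) /\ dotify l = inl (c l)).
Proof.
rewrite /dotify; case: pickP => [[e b] /= /andP[eM /eqP <-]|none].
  by left; exists e, b.
by right; split=> // e b eM; have := none (e, b); rewrite /= eM /= => ->.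
Qed.

Lemma dot_ends_dotify (S : utree I) : perm_eq (uleaves S) (enum I) ->
  perm_eq (dot_ends (umap dotify S)) [seq (nm e, b) | e <- enum M, b <- [:: false; true]].
Proof.
move=> Sl; rewrite /dot_ends uleaves_umap; set D := pmap _.
have DE (s : seq I) : D (map dotify s) =
    pmap (fun l => if dotify l is inr d then Some d else None) s.
  by elim: s => //= l s ->; case: (dotify l).
have memD (s : seq I) d : reflect
    (exists e b, [/\ e \in M, pair_end (f e) b \in s & d = (nm e, b)])
    (d \in D (map dotify s)).
  rewrite DE mem_pmap; apply: (iffP mapP) => [[l ls]|[e [b [eM es ->]]]].
    have [[e [b [eM el ->]]]|[_ -> //]] := dotify_spec l => -[->].
    by exists e, b; rewrite -el.
  by exists (pair_end (f e) b); rewrite ?dotify_end.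
apply: uniq_perm.
- have: uniq (uleaves S) by rewrite (perm_uniq Sl) enum_uniq.
  elim: (uleaves S) => //= l s IH /andP[ls /IH us].
  have [[e [b [eM el dl]]]|[_ -> //]] := dotify_spec l.
  rewrite dl /= us andbT; apply: contra ls => /memD[e' [b' [e'M es [ee eb]]]].
  by rewrite el (nm_inj eM e'M ee) eb.
- rewrite allpairs_uniq ?enum_uniq //.
  move=> p q /allpairsP[[x bx] [xM _ ->]] /allpairsP[[y b] [yM _ ->]] /=.
  by move: xM yM; rewrite !mem_enum => xM yM [/nm_inj -> // ->].
- move=> d; apply/memD/allpairsP => [[e [b [eM _ ->]]]|[[e b] [/= eM _ ->]]].
    by exists (e, b); rewrite /= mem_enum eM; case: b.
  by exists e, b; rewrite -mem_enum eM (perm_mem Sl) mem_enum.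
Qed.

Lemma dotify_is_hairy_graph (r n : nat) (S : utree I) :
  perm_eq (uleaves S) (enum I) -> #|M| = r -> lie_degree S = n -> (0 < n)%N ->
  is_hairy_graph r n (umap dotify S).
Proof.
move=> /dot_ends_dotify Sd Mr Sn n0; apply/and5P; split=> //.
- by rewrite lie_degree_umap Sn.
- rewrite (perm_uniq Sd) allpairs_uniq ?enum_uniq //.
  move=> p q /allpairsP[[x bx] [xM _ ->]] /allpairsP[[y b] [yM _ ->]] /=.
  by move: xM yM; rewrite !mem_enum => xM yM [/nm_inj -> // ->].
- apply/allP=> d; rewrite (perm_mem Sd) => /allpairsP[[e b] [eM _ ->]].
  rewrite (perm_mem Sd) {Sd}; rewrite /= in eM.
  by apply/allpairsP; exists (e, ~~ b); rewrite eM; split=> //; case: (b).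
- by rewrite (perm_size Sd) size_allpairs -cardE Mr muln2.
Qed.
End Dotting.

Section TraceDef.
Variable H : vectType rat.
Implicit Types (T : utree (vertex H)).

Definition pair_map (I J : Type) (h : I -> J) (e : I * I) := (h e.1, h e.2).

Lemma pair_map_end (I J : Type) (h : I -> J) e b :
  pair_end (pair_map h e) b = h (pair_end e b).
Proof. by case: b. Qed.

Lemma matchings_ends_inj (m r : nat) (J : finType) (h : 'I_m -> J) M :
  injective h -> M \in matchings m r -> ends_inj M (pair_map h).
Proof.
rewrite inE => h_inj /and3P[_ /forall_inP Mlt /forall_inP Mdis].
move=> e e' b b' eM e'M; rewrite !pair_map_end => /h_inj ee'.
have [eqe|ne] := eqVneq e e'.
  split=> //; move: ee' (Mlt e eM); rewrite -eqe.
  by case: b b' => -[] //= ->; rewrite ltnn.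
have /forall_inP/(_ e' e'M) := Mdis e eM; rewrite ne /=.
move/disjointFl/(_ (_ : pair_end e' b' \in [set e'.1; e'.2])).
rewrite -ee' !inE; case: (b) ee' => /= ->; case: (b') => /=; rewrite eqxx ?orbT; by move=> /(_ isT).
Qed.

Lemma matchings_nm_inj (m r : nat) M :
  M \in matchings m r -> {in M &, injective (fun e : 'I_m * 'I_m => val e.1)}.
Proof.
move=> MM e e' eM e'M /val_inj ee'.
have /(_ e e' false false eM e'M ee')[] := matchings_ends_inj (@inj_id _) MM.
by [].
Qed.

Lemma add_dots_skel (I : finType) (S : utree I) (c : I -> H)
    (T := umap (fun l => inl (c l) : vertex H) S) :
  perm_eq (uleaves S) (enum I) ->
  exists h : 'I_(size (uleaves T)) -> I,
  [/\ bijective h, forall p : 'I_(size (uleaves T)), hair_color T p = c (h p)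
    & forall M, add_dots M
        = umap (dotify M (pair_map h) (fun e => val e.1) c) S].
Proof.
move=> Sl; have uS : uniq (uleaves S) by rewrite (perm_uniq Sl) enum_uniq.
have memS l : l \in uleaves S by rewrite (perm_mem Sl) mem_enum.
have sz : size (uleaves T) = size (uleaves S) by rewrite uleaves_umap size_map.
pose h p := tnth (in_tuple (uleaves S)) (cast_ord sz p).
have hE (p : 'I_(size (uleaves T))) l : (h p == l) = (p == index l (uleaves S) :> nat).
  rewrite /h (tnth_nth l) /=; apply/eqP/eqP=> [<-|->].
    by rewrite index_uniq // -sz.
  by rewrite nth_index.
have ltS l : (index l (uleaves S) < size (uleaves T))%N by rewrite sz index_mem.
exists h; split.
- exists (fun l => Ordinal (ltS l)) => [p|l]; last by apply/eqP; rewrite hE.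
  by apply/val_inj/esym/eqP => /=; rewrite -hE.
- move=> p; have pS : (p < size (uleaves S))%N by rewrite -sz.
  have -> : h p = nth (h p) (uleaves S) p by rewrite {1}/h (tnth_nth (h p)).
  move: (h p) (nat_of_ord p) pS => x0 q qS.
  by rewrite /hair_color uleaves_umap (nth_map x0).
- move=> M; rewrite /add_dots /T umapi_skel //; apply: eq_umap => l.
  rewrite /dotify; congr (if _ is Some _ then _ else _); apply: eq_pick => -[e b] /=.
  by rewrite pair_map_end hE.
Qed.

Lemma hairy_graph0_skel n T : is_hairy_graph 0 n T ->
  exists (m : nat) (S : utree 'I_m) (c : 'I_m -> H),
    perm_eq (uleaves S) (enum 'I_m)
    /\ T = umap (fun l => inl (c l) : vertex H) S.
Proof.
case/and5P=> _ _ _ _ /nilP dT; pose k := size (uleaves T).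
have nodot p : (p < k)%N -> nth (inl 0) (uleaves T) p = inl (hair_color T p).
  move=> pk; rewrite /hair_color.
  case: nth (mem_nth (inl 0 : vertex H) pk) => // d dl.
  have : d \in dot_ends T by rewrite mem_pmap; apply/mapP; exists (inr d).
  by rewrite dT.
have [|S Sl Sc] := @uskel _ _ (fun l : 'I_k => inl (hair_color T l)) (enum 'I_k) T.
  apply: (@eq_from_nth _ (inl 0)); rewrite size_map size_enum_ord // => p pk.
  have i0 : 'I_k by exact: Ordinal pk.
  by rewrite (nth_map i0) ?size_enum_ord // nodot // nth_enum_ord.
by exists k, S, (fun l : 'I_k => hair_color T l); rewrite Sl.
Qed.

Fact add_dots_subproof r n (G : hairy_graph H 0 n) M :
  M \in matchings (size (uleaves (hg_tree G))) r ->
  is_hairy_graph r n (add_dots M).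
Proof.
move: M; case: G => T /= TP; have [m [S [c [Sp TE]]]] := hairy_graph0_skel TP.
case/and5P: TP => /eqP dT n0 _ _ _; subst T => M MM.
have [h [h_bij _ ->]] := add_dots_skel c Sp.
apply: dotify_is_hairy_graph => //.
- exact/(matchings_ends_inj _ MM)/bij_inj.
- exact: matchings_nm_inj MM.
- by move: MM; rewrite inE => /and3P[/eqP].
- by rewrite -dT lie_degree_umap.
Qed.

Variables (omega : {skew_symmetric H}) (r n : nat).

Definition trace_graph (G : hairy_graph H 0 n) : graph_space H r n :=
  \sum_(M : {M | M \in matchings (size (uleaves (hg_tree G))) r})
    (\prod_(e in val M) omega (hair_color (hg_tree G) e.1)
                              (hair_color (hg_tree G) e.2))
      *: graph_class (HairyGraph (add_dots_subproof (valP M))).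
End TraceDef.

Section TraceWellDefined.
Variables (H : vectType rat) (omega : {skew_symmetric H}) (r n : nat).
Implicit Types (T : utree (vertex H)).

Definition raw_class T : graph_space H r n :=
  if insub T is Some G then graph_class G else 0.

Lemma raw_class_hg (G : hairy_graph H r n) : raw_class (hg_tree G) = graph_class G.
Proof. by rewrite /raw_class valK. Qed.

Lemma graph_relE x : graph_rel x -> lproj (@graph_rel H r n) x = 0.
Proof. by move=> Rx; rewrite -(linear0 (lproj _)); apply/lproj_eq; rewrite subr0; apply: lspan_gen. Qed.

Lemma raw_class_rename T (f : nat -> nat) :
  is_hairy_graph r n T -> is_hairy_graph r n (umap (rename_dot f) T) ->
  {in unzip1 (dot_ends T) &, injective f} ->
  raw_class (umap (rename_dot f) T) = raw_class T.
Proof.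
move=> TP T'P f_inj; pose G := HairyGraph TP; pose G' := HairyGraph T'P.
rewrite -[T]/(hg_tree G) -[umap _ _]/(hg_tree G') !raw_class_hg.
apply/eqP; rewrite eq_sym -subr_eq0 -linearB; apply/eqP/graph_relE.
by apply: (@rel_rename _ _ _ G G' f).
Qed.

Lemma raw_class_reverse T i :
  is_hairy_graph r n T -> is_hairy_graph r n (umap (reverse_dot i) T) ->
  (i, false) \in dot_ends T ->
  raw_class (umap (reverse_dot i) T) = - raw_class T.
Proof.
move=> TP T'P iT; pose G := HairyGraph TP; pose G' := HairyGraph T'P.
rewrite -[T]/(hg_tree G) -[umap _ _]/(hg_tree G') !raw_class_hg.
apply/eqP; rewrite -addr_eq0 addrC -linearD; apply/eqP/graph_relE.
by apply: (@rel_reverse _ _ _ G G' i).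
Qed.

Section Change.
Variables (I E : finType) (M : {set E}) (c : I -> H) (S : utree I).
Hypotheses (Sp : perm_eq (uleaves S) (enum I)) (Mr : #|M| = r).
Hypotheses (Sn : lie_degree S = n) (n0 : (0 < n)%N).

Definition weight (f : E -> I * I) : rat :=
  \prod_(e in M) omega (c (f e).1) (c (f e).2).

Definition swap_on (J : seq E) (f : E -> I * I) e :=
  if e \in J then ((f e).2, (f e).1) else f e.

Lemma swap_on_end J f e b :
  pair_end (swap_on J f e) b = pair_end (f e) (b (+) (e \in J)).
Proof. by rewrite /swap_on; case: ifP => _; case: b. Qed.

Lemma swap_on_inj J f : ends_inj M f -> ends_inj M (swap_on J f).
Proof.
move=> f_inj e e' b b' eM e'M; rewrite !swap_on_end => /f_inj-/(_ eM e'M)[ee].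
by rewrite ee => /addIb.
Qed.

Lemma eq_dotify f f' nm : {in M, f =1 f'} -> dotify M f nm c =1 dotify M f' nm c.
Proof.
move=> ff' l; rewrite /dotify; congr (if _ is Some _ then _ else _).
by apply: eq_pick => -[e b] /=; case: (boolP (e \in M)) => //= /ff'->.
Qed.

Lemma swap_on_cons (e : E) J f nm : ends_inj M f -> {in M &, injective nm} ->
  e \in M -> e \notin J ->
  weight (swap_on (e :: J) f) *: raw_class (umap (dotify M (swap_on (e :: J) f) nm c) S)
  = weight (swap_on J f) *: raw_class (umap (dotify M (swap_on J f) nm c) S).
Proof.
move=> f_inj nm_inj eM eJ; set f1 := swap_on J f; set f2 := swap_on _ f.
have f1_inj : ends_inj M f1 by apply: swap_on_inj.
have f2_inj : ends_inj M f2 by apply: swap_on_inj.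
have -> : weight f2 = - weight f1.
  rewrite /weight (bigD1 e) //= [in RHS](bigD1 e) //= -mulNr; congr (_ * _).
    rewrite /f1 /f2 /swap_on mem_head (negPf eJ) /=.
    by rewrite (hermC omega) /= expr1 mulN1r.
  apply: eq_bigr => e' /andP[_ ne].
  by rewrite /f1 /f2 /swap_on inE (negPf ne).
have E2 : umap (dotify M f2 nm c) S
    = umap (reverse_dot (nm e)) (umap (dotify M f1 nm c) S).
  rewrite umap_comp; apply: eq_umap => l /=.
  have [[e' [b [e'M -> ->]]]|[none ->]] := dotify_spec M f1 nm c l.
    have -> : pair_end (f1 e') b = pair_end (f2 e') (if e' == e then ~~ b else b).
      rewrite !swap_on_end inE; case: eqP => [->|_] //=.
      by rewrite (negPf eJ) addbT negbK addbF.
    rewrite dotify_end //=; congr (inr (_, _)).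
    by rewrite (inj_in_eq nm_inj).
  have [[e' [b [e'M el _]]]|[_ ->] //] := dotify_spec M f2 nm c l.
  have := none e' (b (+) (e' \in e :: J) (+) (e' \in J)) e'M.
  by rewrite swap_on_end -!addbA addbb addbF el swap_on_end eqxx.
have wf1 := dotify_is_hairy_graph c f1_inj nm_inj Sp Mr Sn n0.
have wf2 := dotify_is_hairy_graph c f2_inj nm_inj Sp Mr Sn n0.
rewrite E2 in wf2 *; rewrite raw_class_reverse ?scalerN ?scaleNr ?opprK //.
rewrite (perm_mem (dot_ends_dotify c f1_inj nm_inj Sp)).
by apply/allpairsP; exists (e, false); rewrite mem_enum eM.
Qed.

Lemma dotify_change f f' nm nm' : ends_inj M f ->
  {in M &, injective nm} -> {in M &, injective nm'} ->
  (forall e, e \in M -> f' e = f e \/ f' e = ((f e).2, (f e).1)) ->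
  weight f' *: raw_class (umap (dotify M f' nm' c) S)
  = weight f *: raw_class (umap (dotify M f nm c) S).
Proof.
move=> f_inj nm_inj nm'_inj ff'.
have step J : uniq J -> {subset J <= M} ->
    weight (swap_on J f) *: raw_class (umap (dotify M (swap_on J f) nm c) S)
    = weight f *: raw_class (umap (dotify M f nm c) S).
  elim: J => [//|e J IH] /= /andP[eJ uJ] sJ.
  rewrite swap_on_cons ?IH ?sJ ?mem_head // => x xJ.
  by rewrite sJ // inE xJ orbT.
pose J := [seq e <- enum M | f' e != f e].
have uJ : uniq J by rewrite filter_uniq ?enum_uniq.
have sJ : {subset J <= M} by move=> e; rewrite mem_filter mem_enum => /andP[].
rewrite -(step J uJ sJ).
have f'E : {in M, f' =1 swap_on J f}.
  move=> e eM; rewrite /swap_on mem_filter mem_enum eM andbT.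
  by case: eqP => [-> //|]; case: (ff' e eM).
have fJ_inj : ends_inj M (swap_on J f) by apply: swap_on_inj.
have -> : weight f' = weight (swap_on J f) by apply: eq_bigr => e /f'E->.
congr (_ *: _); rewrite (eq_umap _ (eq_dotify nm' f'E)).
pose g k := if [pick e in M | nm e == k] is Some e then nm' e else 0%N.
have gE e : e \in M -> g (nm e) = nm' e.
  move=> eM; rewrite /g; case: pickP => [e' /andP[e'M /eqP/nm_inj->] //|].
  by move/(_ e); rewrite eM eqxx.
have E2 : umap (dotify M (swap_on J f) nm' c) S
    = umap (rename_dot g) (umap (dotify M (swap_on J f) nm c) S).
  rewrite umap_comp; apply: eq_umap => l /=.
  have [[e' [b [e'M -> ->]]]|[none ->]] := dotify_spec M (swap_on J f) nm c l.
    by rewrite dotify_end //= gE.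
  have [[e' [b [e'M el _]]]|[_ ->] //] := dotify_spec M (swap_on J f) nm' c l.
  by have := none e' b e'M; rewrite el eqxx.
have wf1 := dotify_is_hairy_graph c fJ_inj nm_inj Sp Mr Sn n0.
have wf2 := dotify_is_hairy_graph c fJ_inj nm'_inj Sp Mr Sn n0.
rewrite E2 in wf2 *; apply: raw_class_rename => //.
have dE k : k \in unzip1 (dot_ends (umap (dotify M (swap_on J f) nm c) S)) ->
    exists2 e, e \in M & k = nm e.
  case/mapP=> d; rewrite (perm_mem (dot_ends_dotify c fJ_inj nm_inj Sp)).
  by case/allpairsP=> -[e b] [eM _ ->] ->; exists e; rewrite // -mem_enum.
by move=> k k' /dE[e eM ->] /dE[e' e'M ->]; rewrite !gE // => /nm'_inj->.
Qed.
End Change.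
End TraceWellDefined.

Section MatchingMap.

Lemma matchingsP (m r : nat) (M : {set 'I_m * 'I_m}) : reflect
  [/\ #|M| = r, forall e, e \in M -> (e.1 < e.2)%N & ends_inj M id]
  (M \in matchings m r).
Proof.
apply: (iffP idP) => [MM|[Mr Mlt M_inj]].
  move: (MM); rewrite inE => /and3P[/eqP Mr /forall_inP Mlt _]; split=> //.
  move=> e e' b b' eM e'M ee'.
  by apply: (matchings_ends_inj (@inj_id _) MM); rewrite ?pair_map_end.
rewrite inE Mr eqxx /=; apply/andP; split; first exact/forall_inP.
apply/forall_inP => e eM; apply/forall_inP => f fM; apply/implyP => ne.
rewrite -setI_eq0; apply/eqP/setP => x; rewrite !inE.
have endsE (e' : 'I_m * 'I_m) :
    (x == e'.1) || (x == e'.2) -> exists b, x = pair_end e' b.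
  by case/orP=> /eqP->; [exists false|exists true].
apply/negP => /andP[/endsE[b xb] /endsE[b' xb']].
have [|ef _] := M_inj e f b b' eM fM; first by rewrite -xb -xb'.
by rewrite ef eqxx in ne.
Qed.

Definition orient (m : nat) (e : 'I_m * 'I_m) :=
  if (e.1 < e.2)%N then e else (e.2, e.1).

Lemma orient_end (m : nat) (e : 'I_m * 'I_m) b :
  pair_end (orient e) b = pair_end e (b (+) ~~ (e.1 < e.2)%N).
Proof. by rewrite /orient; case: ltnP => _; case: b. Qed.

Lemma orientK (a b : nat) (h : 'I_a -> 'I_b) (g : 'I_b -> 'I_a) (e : 'I_a * 'I_a) :
  cancel h g -> (e.1 < e.2)%N ->
  orient (pair_map g (orient (pair_map h e))) = e.
Proof.
case: e => i j hK /= ij; rewrite [X in pair_map g X]/orient /=.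
case: ifP => _; rewrite /pair_map /= !hK /orient /= ?ij //.
by rewrite ltnNge (ltnW ij).
Qed.

Definition match_map (a b : nat) (h : 'I_a -> 'I_b) (M : {set 'I_a * 'I_a}) :=
  [set orient (pair_map h e) | e in M].

Lemma match_map_inj (a b r : nat) (h : 'I_a -> 'I_b) M :
  injective h -> M \in matchings a r ->
  {in M &, injective (fun e => orient (pair_map h e))}.
Proof.
move=> h_inj MM e e' eM e'M /(congr1 (fun x => pair_end x false)).
rewrite !orient_end => /(matchings_ends_inj h_inj MM).
by case/(_ eM e'M).
Qed.

Lemma match_mapP (a b r : nat) (h : 'I_a -> 'I_b) M :
  injective h -> M \in matchings a r -> match_map h M \in matchings b r.
Proof.
move=> h_inj MM; have hM_inj := matchings_ends_inj h_inj MM.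
have [Mr Mlt M_inj] := matchingsP _ _ MM.
apply/matchingsP; split.
- by rewrite card_in_imset //; apply: match_map_inj MM.
- move=> _ /imsetP[e eM ->]; rewrite /orient; case: ifPn => //=.
  rewrite -leqNgt => le_h; rewrite ltn_neqAle le_h andbT.
  apply/eqP => /val_inj/h_inj ee.
  by have := Mlt e eM; rewrite ee ltnn.
move=> _ _ s t /imsetP[e eM ->] /imsetP[e' e'M ->].
rewrite !orient_end => /hM_inj-/(_ eM e'M)[->].
by move=> /addIb.
Qed.

Lemma match_mapK (a b r : nat) (h : 'I_a -> 'I_b) (g : 'I_b -> 'I_a) M :
  cancel h g -> M \in matchings a r -> match_map g (match_map h M) = M.
Proof.
move=> hK /matchingsP[_ Mlt _]; rewrite /match_map -imset_comp /=.
rewrite -[RHS]imset_id; apply: eq_in_imset => e eM /=.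
by rewrite (orientK hK) // Mlt.
Qed.
End MatchingMap.

Section TraceRelations.
Variables (H : vectType rat) (omega : {skew_symmetric H}) (r n : nat).
Implicit Types (T : utree (vertex H)) (G : hairy_graph H 0 n).

Definition skel_trace (m : nat) (S : utree 'I_m) (c : 'I_m -> H) :=
  \sum_(D in matchings m r) weight omega D c id *:
    raw_class r n (umap (dotify D id (fun e => val e.1) c) S).

Lemma trace_skel G (m : nat) (S : utree 'I_m) (c : 'I_m -> H) :
  perm_eq (uleaves S) (enum 'I_m) ->
  hg_tree G = umap (fun l => inl (c l) : vertex H) S ->
  trace_graph omega r G = skel_trace S c.
Proof.
case: G => T TP /= Sp TE; have /and5P[/eqP Tn n0 _ _ _] := TP.
subst T; set T := umap _ S in TP Tn *.
have Sn : lie_degree S = n by rewrite -Tn lie_degree_umap.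
have [h [[g hK gK] hc hdots]] := add_dots_skel c Sp.
rewrite -/T in h hK gK hc hdots.
transitivity (\sum_(M in matchings (size (uleaves T)) r)
    weight omega M c (pair_map h) *: raw_class r n (add_dots M)).
  rewrite big_sub; apply: eq_bigr => M _; congr (_ *: _).
    by apply: eq_bigr => e _ /=; rewrite !hc.
  by rewrite -raw_class_hg.
have h_inj := can_inj hK; have g_inj := can_inj gK.
rewrite /skel_trace.
rewrite (reindex_onto (match_map h) (match_map g)); last first.
  by move=> D DM; apply: match_mapK gK DM.
apply: eq_big => [M|M MM].
  apply/idP/andP => [MM|[MM /eqP<-]]; last exact: match_mapP.
  by rewrite match_mapP // (match_mapK hK MM).
have hM_inj := matchings_ends_inj h_inj MM.
have oM_inj := match_map_inj h_inj MM.
have [Mr _ _] := matchingsP _ _ MM.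
rewrite hdots.
rewrite -(@dotify_change _ omega r n _ _ M c S Sp Mr Sn n0 (pair_map h)
  (fun e => orient (pair_map h e)) (fun e => val e.1)
  (fun e => val (orient (pair_map h e)).1)) //.
- congr (_ *: _).
    by rewrite /weight /match_map big_imset.
  congr (raw_class _ _ _); apply: eq_umap => l.
  have hMM := match_mapP h_inj MM.
  have [_ _ D_inj] := matchingsP _ _ hMM.
  have [[e [b [eM el ->]]]|[none ->]] :=
    dotify_spec M (fun e => orient (pair_map h e)) (fun e => val (orient (pair_map h e)).1) c l.
    by rewrite el (dotify_end _ _ D_inj) //; apply: imset_f.
  have [[e [b [/imsetP[e' e'M ->] el _]]]|[_ ->] //] :=
    dotify_spec (match_map h M) id (fun e => val e.1) c l.
  by have := none e' b e'M; rewrite el eqxx.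
- exact: matchings_nm_inj MM.
- move=> e e' eM e'M /val_inj E; apply: oM_inj => //.
  have DM := match_mapP h_inj MM.
  by apply: (matchings_nm_inj DM) (congr1 val E); apply: imset_f.
- by move=> e _; rewrite /orient; case: ifP; [left|right].
Qed.
End TraceRelations.

Section TraceRelations2.
Variables (H : vectType rat) (omega : {skew_symmetric H}) (r n : nat).
Implicit Types (T : utree (vertex H)) (G : hairy_graph H 0 n).

Section Skeletons.
Variables (m : nat) (n0 : (0 < n)%N).
Implicit Types (S : utree 'I_m) (c : 'I_m -> H) (D : {set 'I_m * 'I_m}).

Definition dot_skel D c S := umap (dotify D id (fun e => val e.1) c) S.

Lemma dot_skel_wf D c S : perm_eq (uleaves S) (enum 'I_m) ->
  lie_degree S = n -> D \in matchings m r ->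
  is_hairy_graph r n (dot_skel D c S).
Proof.
move=> Sp Sn DM; have [Dr _ D_inj] := matchingsP _ _ DM.
by apply: dotify_is_hairy_graph => //; apply: matchings_nm_inj DM.
Qed.

Lemma skel_trace_rel S S' c (s : rat) :
  perm_eq (uleaves S) (enum 'I_m) -> perm_eq (uleaves S') (enum 'I_m) ->
  lie_degree S = n -> lie_degree S' = n ->
  (forall D (G G' : hairy_graph H r n), hg_tree G = dot_skel D c S ->
     hg_tree G' = dot_skel D c S' -> graph_rel (<< G >> + s *: << G' >>)) ->
  skel_trace omega r n S c + s *: skel_trace omega r n S' c = 0.
Proof.
move=> Sp S'p Sn S'n rel; rewrite scaler_sumr -big_split /= big1 // => D DM.
rewrite scalerA mulrC -scalerA -scalerDr.
pose G := HairyGraph (dot_skel_wf c Sp Sn DM).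
pose G' := HairyGraph (dot_skel_wf c S'p S'n DM).
rewrite -[X in raw_class _ _ X + _]/(hg_tree G).
rewrite -[X in _ + _ *: raw_class _ _ X]/(hg_tree G').
by rewrite !raw_class_hg -linearZ -linearD graph_relE ?scaler0 //; apply: rel.
Qed.

Lemma skel_trace_rel3 S S' S'' c :
  perm_eq (uleaves S) (enum 'I_m) -> perm_eq (uleaves S') (enum 'I_m) ->
  perm_eq (uleaves S'') (enum 'I_m) ->
  lie_degree S = n -> lie_degree S' = n -> lie_degree S'' = n ->
  (forall D (G G' G'' : hairy_graph H r n), hg_tree G = dot_skel D c S ->
     hg_tree G' = dot_skel D c S' -> hg_tree G'' = dot_skel D c S'' ->
     graph_rel (<< G >> + << G' >> + << G'' >>)) ->
  skel_trace omega r n S c + skel_trace omega r n S' c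
    + skel_trace omega r n S'' c = 0.
Proof.
move=> Sp S'p S''p Sn S'n S''n rel; rewrite -!big_split /= big1 // => D DM.
rewrite -!scalerDr.
pose G := HairyGraph (dot_skel_wf c Sp Sn DM).
pose G' := HairyGraph (dot_skel_wf c S'p S'n DM).
pose G'' := HairyGraph (dot_skel_wf c S''p S''n DM).
rewrite -[X in raw_class _ _ X + _ + _]/(hg_tree G).
rewrite -[X in _ + raw_class _ _ X + _]/(hg_tree G').
rewrite -[X in _ + raw_class _ _ X]/(hg_tree G'').
by rewrite !raw_class_hg -!linearD graph_relE ?scaler0 //; apply: rel.
Qed.

Definition upd c l u := fun x : 'I_m => if x == l then u else c x.

Lemma skel_trace_linear l (B : btree 'I_m) c a u v :
  perm_eq (uleaves (Leaf l, B)) (enum 'I_m) -> lie_degree (Leaf l, B) = n ->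
  skel_trace omega r n (Leaf l, B) (upd c l (a *: u + v))
  = a *: skel_trace omega r n (Leaf l, B) (upd c l u)
    + skel_trace omega r n (Leaf l, B) (upd c l v).
Proof.
move=> Sp Sn; rewrite scaler_sumr -big_split /=; apply: eq_bigr => D DM.
have lB : l \notin leaves B.
  have : uniq (l :: leaves B) by rewrite (perm_uniq Sp) enum_uniq.
  by case/andP.
have [Dr Dlt D_inj] := matchingsP _ _ DM.
have nm_inj := matchings_nm_inj DM.
have [[e [b [eD el _]]]|[none _]] := dotify_spec D id (fun e => val e.1) c l.
  have dE w : umap (dotify D id (fun e => val e.1) (upd c l w)) (Leaf l, B)
      = umap (dotify D id (fun e => val e.1) c) (Leaf l, B).
    apply: eq_umap => x.
    have [[e' [b' [e'D -> ->]]]|[none ->]] :=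
      dotify_spec D id (fun e => val e.1) (upd c l w) x.
      by rewrite (dotify_end _ _ D_inj).
    have [[e' [b' [e'D ex _]]]|[_ ->]] := dotify_spec D id (fun e => val e.1) c x.
      by have := none e' b' e'D; rewrite ex eqxx.
    rewrite /upd; case: eqP => // xl.
    by have := none e b eD; rewrite xl el eqxx.
  rewrite !dE scalerA -scalerDl; congr (_ *: _).
  rewrite /weight !(bigD1 e eD) /=.
  set R := \prod_(i in D | i != e) omega (upd c l u _) _.
  have RE w : \prod_(i in D | i != e) omega (upd c l w i.1) (upd c l w i.2) = R.
    apply: eq_bigr => e' /andP[e'D ne].
    have nl b' : (pair_end e' b' == l) = false.
      apply/eqP; rewrite el => /(D_inj e' e b' b e'D eD)[ee _].
      by rewrite ee eqxx in ne.
    by rewrite /upd (nl false) (nl true).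
  rewrite !RE mulrA -mulrDl; congr (_ * _).
  have e12 : (e.1 == e.2) = false by apply/eqP => ee; have := Dlt e eD; rewrite ee ltnn.
  case: b el => /= ->; rewrite /upd eqxx ?e12 1?eq_sym ?e12.
    by rewrite linearPr.
  by rewrite linearPl.
have notl e b : e \in D -> (pair_end e b == l) = false by move=> eD; apply/negbTE/none.
have wE w : weight omega D (upd c l w) id = weight omega D c id.
  apply: eq_bigr => e eD.
  by rewrite /upd (notl e false eD) (notl e true eD).
rewrite !wE scalerA mulrC -scalerA -scalerDr; congr (_ *: _).
have lE w : dotify D id (fun e => val e.1) (upd c l w) l = inl w.
  have [[e [b [eD el _]]]|[_ ->]] := dotify_spec D id (fun e => val e.1) (upd c l w) l.
    by have := notl e b eD; rewrite -el eqxx.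
  by rewrite /upd eqxx.
have BE w : bmap (dotify D id (fun e => val e.1) (upd c l w)) B
    = bmap (dotify D id (fun e => val e.1) c) B.
  elim: B lB {Sp Sn} => [x|B1 IH1 B2 IH2] /=.
    rewrite inE eq_sym => xl; congr Leaf; rewrite /dotify /upd.
    by case: pickP => // _; rewrite (negPf xl).
  by rewrite mem_cat => /norP[/IH1-> /IH2->].
pose Gw w := HairyGraph (dot_skel_wf (upd c l w) Sp Sn DM).
have raw w : raw_class r n (umap (dotify D id (fun e => val e.1) (upd c l w)) (Leaf l, B))
    = graph_class (Gw w) by rewrite -raw_class_hg.
rewrite !raw /graph_class -linearZ -linearD; apply/eqP; rewrite -subr_eq0 -linearB.
apply/eqP/graph_relE; apply: rel_linear; rewrite /= /dot_skel /umap /= lE BE;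
  reflexivity.
Qed.
End Skeletons.

Lemma bmap_leaf (L L' : Type) (f : L -> L') A l :
  bmap f A = Leaf l -> exists2 x, A = Leaf x & f x = l.
Proof. by case: A => //= x [<-]; exists x. Qed.

Lemma bmap_node (L L' : Type) (f : L -> L') A B1 B2 :
  bmap f A = Node B1 B2 ->
  exists A1 A2, [/\ A = Node A1 A2, bmap f A1 = B1 & bmap f A2 = B2].
Proof. by case: A => //= A1 A2 [<- <-]; exists A1, A2. Qed.

Lemma graph0_skel G : exists (m : nat) (S : utree 'I_m) (c : 'I_m -> H),
  [/\ perm_eq (uleaves S) (enum 'I_m), lie_degree S = n, (0 < n)%N
    & hg_tree G = umap (fun l => inl (c l) : vertex H) S].
Proof.
case: G => T TP /=; have [m [S [c [Sp TE]]]] := hairy_graph0_skel TP.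
exists m, S, c; split=> //; case/and5P: TP => /eqP <- //.
by rewrite TE lie_degree_umap.
Qed.

Lemma graph0_no_dots G : dot_ends (hg_tree G) = [::].
Proof. by case: G => T /= /and5P[_ _ _ _ /nilP]. Qed.

Lemma trace_graph_rel x : graph_rel x -> fglin (@trace_graph H omega r n) x = 0.
Proof.
case=> {x}.
- move=> G G' A B GE G'E; rewrite linearB !fglinE.
  have [m [[SA SB] [c [Sp Sn n0]]]] := graph0_skel G.
  rewrite GE => -[AE BE]; subst A B.
  have S'p : perm_eq (uleaves (SB, SA)) (enum 'I_m) by rewrite -(permPr Sp) /uleaves perm_catC.
  have S'n : lie_degree (SB, SA) = n by rewrite -Sn /lie_degree addnC.
  rewrite (trace_skel omega r Sp GE) (trace_skel omega r S'p G'E).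
  rewrite -scaleN1r; apply: skel_trace_rel => // D G1 G2 G1E G2E.
  by rewrite scaleN1r; apply: rel_swap G1E G2E.
- move=> G G' A B D GE G'E; rewrite linearB !fglinE.
  have [m [[S1 SD] [c [Sp Sn n0]]]] := graph0_skel G.
  rewrite GE => -[/esym/bmap_node[SA [SB [? AE BE]]] DE]; subst S1 A B D.
  have S'p : perm_eq (uleaves (SA, Node SB SD)) (enum 'I_m).
    by rewrite -(permPr Sp) /uleaves /= catA.
  have S'n : lie_degree (SA, Node SB SD) = n.
    by rewrite -Sn /lie_degree /= addnS addSn addnA.
  rewrite (trace_skel omega r Sp GE) (trace_skel omega r S'p G'E).
  rewrite -scaleN1r; apply: skel_trace_rel => // D G1 G2 G1E G2E.
  by rewrite scaleN1r; apply: rel_rotate G1E G2E.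
- move=> G G' f _ G'E; suff -> : G' = G by rewrite subrr linear0.
  apply/val_inj => /=; rewrite G'E.
  have [m [S [c [_ _ _ ->]]]] := graph0_skel G.
  by rewrite umap_comp; apply: eq_umap.
- move=> G G' A B D GE G'E; rewrite linearD !fglinE.
  have [m [[S1 SD] [c [Sp Sn n0]]]] := graph0_skel G.
  rewrite GE => -[/esym/bmap_node[SA [SB [? AE BE]]] DE]; subst S1 A B D.
  have S'p : perm_eq (uleaves (Node SB SA, SD)) (enum 'I_m).
    by rewrite -(permPr Sp) /uleaves /= perm_cat2r perm_catC.
  have S'n : lie_degree (Node SB SA, SD) = n.
    by rewrite -Sn /lie_degree /= [(nodes SB + _)%N]addnC.
  rewrite (trace_skel omega r Sp GE) (trace_skel omega r S'p G'E).
  rewrite -[X in _ + X]scale1r; apply: skel_trace_rel => // D G1 G2 G1E G2E.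
  by rewrite scale1r; apply: rel_AS G1E G2E.
- move=> G G' G'' A B D E GE G'E G''E; rewrite !linearD !fglinE.
  have [m [[S1 S2] [c [Sp Sn n0]]]] := graph0_skel G.
  rewrite GE => -[/esym/bmap_node[SA [SB [? AE BE]]]].
  move=> /esym/bmap_node[SD [SE [? DE EE]]]; subst S1 S2 A B D E.
  have S'p : perm_eq (uleaves (Node SB SD, Node SA SE)) (enum 'I_m).
    rewrite -(permPr Sp) /uleaves /=; apply/permP => p; rewrite !count_cat.
    by rewrite addnC addnACA; congr addn; rewrite addnC.
  have S''p : perm_eq (uleaves (Node SD SA, Node SB SE)) (enum 'I_m).
    rewrite -(permPr Sp) /uleaves /=; apply/permP => p; rewrite !count_cat.
    by rewrite [RHS]addnACA; congr addn; rewrite addnC.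
  have S'n : lie_degree (Node SB SD, Node SA SE) = n.
    rewrite -Sn /lie_degree /= !addSn !addnS; do 2 congr _.+1.
    by rewrite addnC addnACA; congr addn; rewrite addnC.
  have S''n : lie_degree (Node SD SA, Node SB SE) = n.
    rewrite -Sn /lie_degree /= !addSn !addnS; do 2 congr _.+1.
    by rewrite [RHS]addnACA; congr addn; rewrite addnC.
  rewrite (trace_skel omega r Sp GE) (trace_skel omega r S'p G'E).
  rewrite (trace_skel omega r S''p G''E).
  apply: skel_trace_rel3 => // D G1 G2 G3 G1E G2E G3E.
  exact: rel_IHX G1E G2E G3E.
- move=> G G' G'' a u v B GE G'E G''E; rewrite linearB linearP !fglinE.
  have [m [[S1 S2] [c [Sp Sn n0]]]] := graph0_skel G.
  rewrite GE => -[AE BE]; have [l S1E] := bmap_leaf (esym AE).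
  subst S1 B => _ {AE}.
  have lB : l \notin leaves S2.
    have : uniq (l :: leaves S2) by rewrite (perm_uniq Sp) enum_uniq.
    by case/andP.
  have SE w : umap (fun x => inl (upd c l w x) : vertex H) (Leaf l, S2)
      = (hair w, bmap (fun x => inl (c x)) S2).
    rewrite /umap /= /upd eqxx; congr pair.
    elim: S2 lB {Sp Sn GE G'E G''E} => [x|B1 IH1 B2 IH2] /=.
      by rewrite inE eq_sym => /negPf->.
    by rewrite mem_cat => /norP[/IH1-> /IH2->].
  rewrite -!SE in GE G'E G''E.
  rewrite (trace_skel omega r Sp GE) (trace_skel omega r Sp G'E).
  rewrite (trace_skel omega r Sp G''E).
  by rewrite skel_trace_linear // subrr.
- by move=> G G' i; rewrite graph0_no_dots.
Qed.
End TraceRelations2.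

Section Spaces.
Variable H : vectType rat.

Definition trace (omega : {skew_symmetric H}) (r n : nat) :
    {linear graph_space H 0 n -> graph_space H r n} :=
  llift (@trace_graph_rel H omega r n).

(* The summand of index n consists of the classes of Lie degree n + 1. *)
Definition hairy_lie := dsum (fun n => graph_space H 0 n.+1).

Definition Omega (r : nat) := dsum (fun n => omega_space H r n.+1).

Definition traceC (omega : {skew_symmetric H}) (r : nat) :
    {linear hairy_lie -> Omega r} :=
  dsum_map (fun n => lproj (@omega_rel H r n.+1) \o trace omega r n.+1).
End Spaces.

(* Main.v *)
(* By IHX, a tree with one dotted edge from X to Y is a combination of combs,
   that is, of words of hairs read along the path from X to Y, and (C2) makes
   these words cyclic.  Phi adds a dotted chord between any two hairs v_i, v_j
   of such a circle, weighted by v_i . v_j: with theta(a, b) the class of the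
   circle p a q b with solid arc a, dotted arc b and a dotted chord from p to q,
   Phi(w) is the sum over i <> j of (v_i . v_j) theta(arc ij, arc ji), which is
   visibly invariant under rotation of w.

   Conversely, a tree with dotted edges xy and pq is a theta graph with one solid
   arc; write theta^a, theta^b, theta^m for the three ways of making one arc
   solid.  Adding xy first and pq as a chord, or pq first and xy as a chord,
   produces (theta^a - theta^b) + (theta^a - theta^m), where the signs come from
   the two orders of the ends of the chord, and (C3), which reads
   theta^a + theta^b + theta^m = 0, turns this into 3 theta^a.  Summing over all
   pairs of pairs of leaves gives Phi Tr_1 = 3 Tr_2.

   Trees are handled as iterated Lie brackets, expanded into signed words: an
   alternating function on trees which satisfies the Jacobi identity is
   determined by its values on the combs with a prescribed last leaf. *)

Require Import Defs.
From HB Require Import structures.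
From mathcomp Require Import all_boot all_order all_algebra zify.
From mathcomp.multinomials Require Import freeg.

Set Implicit Arguments.
Unset Strict Implicit.
Unset Printing Implicit Defensive.

Import GRing.Theory.
Local Open Scope ring_scope.

(** * Equalities in abelian groups *)

(** [Phi] is not defined by choosing a normal form by combs: it is a sum over all cyclic words in
    the associative expansion of the tree, so AS, IHX and the change of root edge hold identically,
    and only the rules for the dotted edge remain to be checked. (C3) imposes nothing on the source,
    whose graphs have only two dotted ends.

    The obstacle is that a tree with two dotted edges has to be read along both. A comb from [x] to
    [y] is in general no comb when read from [p] to [q]: its two outer arms become subtrees which
    must be expanded. Sliding hairs through the dotted edge [xy] gathers both arms into one word,
    which is why (C3) is needed only for a bare third arc.

    This part is carried out for an abstract function [F] of two words with values in an abelian
    group, on trees whose leaves are distinct positions; colours, which may coincide, enter only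
    through [F]. In the final sums each pair of dotted edges occurs in both orders and with both
    directions of each edge, so the identity appears multiplied by 8. *)

Inductive zexpr := ZVar of nat | ZZero | ZAdd of zexpr & zexpr | ZOpp of zexpr.

Fixpoint zeval (V : zmodType) (env : seq V) e : V :=
  match e with
  | ZVar k => env`_k
  | ZZero => 0
  | ZAdd e1 e2 => zeval env e1 + zeval env e2
  | ZOpp e1 => - zeval env e1
  end.

Fixpoint zcoef e (i : nat) : int :=
  match e with
  | ZVar k => (k == i)%:Z
  | ZZero => 0
  | ZAdd e1 e2 => zcoef e1 i + zcoef e2 i
  | ZOpp e1 => - zcoef e1 i
  end.

Lemma zevalE (V : zmodType) (env : seq V) e :
  zeval env e = \sum_(i < size env) env`_i *~ zcoef e i.
Proof.
elim: e => [k||e1 IH1 e2 IH2|e IH] /=.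
- have [km|mk] := ltnP k (size env); last first.
    rewrite nth_default // big1 // => i _; case: eqP => // ki.
    by have := ltn_ord i; rewrite -ki ltnNge mk.
  rewrite (bigD1 (Ordinal km)) //= eqxx big1 ?addr0 // => i ne.
  by case: eqP => // ki; case/eqP: ne; apply/val_inj.
- by rewrite big1.
- by rewrite IH1 IH2 -big_split; apply: eq_bigr => i _; rewrite mulrzDr.
- by rewrite IH -sumrN; apply: eq_bigr => i _; rewrite mulrNz.
Qed.

(** The hypothesis compares integer coefficients by computation, so the tactic [zmod] proves it by
    [isT]. *)
Lemma zeval_eq (V : zmodType) (env : seq V) e1 e2 :
  all (fun i => zcoef e1 i == zcoef e2 i) (iota 0 (size env)) ->
  zeval env e1 = zeval env e2.
Proof.
move/allP=> e12; rewrite !zevalE; apply: eq_bigr => i _.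
by rewrite (eqP (e12 i _)) // mem_iota /=.
Qed.

Ltac zmod_pos x env :=
  lazymatch env with
  | x :: _ => constr:(0%N)
  | _ :: ?env' => let k := zmod_pos x env' in constr:(k.+1)
  end.

Ltac zmod_add x env :=
  match env with
  | _ => let k := zmod_pos x env in env
  | _ => constr:(x :: env)
  end.

Ltac zmod_atoms t env :=
  lazymatch t with
  | ?a + ?b => let env := zmod_atoms a env in zmod_atoms b env
  | - ?a => zmod_atoms a env
  | 0 => env
  | ?x => zmod_add x env
  end.

Ltac zmod_reify t env :=
  lazymatch t with
  | ?a + ?b =>
      let u := zmod_reify a env in let v := zmod_reify b env in constr:(ZAdd u v)
  | - ?a => let u := zmod_reify a env in constr:(ZOpp u)
  | 0 => constr:(ZZero)
  | ?x => let k := zmod_pos x env in constr:(ZVar k)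
  end.

(* Decides equalities which hold in every abelian group. *)
Ltac zmod :=
  rewrite ?opprD ?opprK;
  lazymatch goal with
  | |- @eq ?V ?l ?r =>
      let env := zmod_atoms l (@nil V) in
      let env := zmod_atoms r env in
      let e1 := zmod_reify l env in
      let e2 := zmod_reify r env in
      exact: (@zeval_eq _ env e1 e2 isT)
  end.

(** * Expansion of trees into words *)

Section WordSums.
Variables (L : eqType) (V : zmodType).
Implicit Types (A B D : btree L) (T : utree L) (u w : seq L) (l x y : L).
Implicit Types f g : seq L -> V.

(* The sum of the values of f over the signed words obtained by expanding A,
   read as a Lie bracket, in the free associative algebra. *)
Fixpoint wsum A f : V :=
  match A with
  | Leaf l => f [:: l]
  | Node A B => wsum A (fun a => wsum B (fun b => f (a ++ b) - f (b ++ a)))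
  end.

(** Gluing two root edges corresponds to multiplying the two expansions. For [f] invariant under
    rotation the result depends only on the unrooted tree, by [uwsum_swap] and [uwsum_rotate]. *)
Definition uwsum T f : V := wsum T.1 (fun a => wsum T.2 (fun b => f (a ++ b))).

(** Every word of the expansion is a rearrangement of the leaves. This is how distinctness of the
    leaves passes to the words. *)
Lemma eq_wsum_perm A f g :
  (forall u, perm_eq u (leaves A) -> f u = g u) -> wsum A f = wsum A g.
Proof.
elim: A f g => [l|A IHA B IHB] f g /= fg; first exact: fg.
apply: IHA => a aA; apply: IHB => b bB.
have abP : perm_eq (a ++ b) (leaves A ++ leaves B) by apply: perm_cat.
by rewrite !fg // perm_catC.
Qed.

Lemma eq_wsum A f g : f =1 g -> wsum A f = wsum A g.
Proof. by move=> fg; apply: eq_wsum_perm => u _. Qed.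

Lemma wsumD A f g : wsum A (fun u => f u + g u) = wsum A f + wsum A g.
Proof.
elim: A f g => [//|A IHA B IHB] f g /=; rewrite -IHA; apply: eq_wsum => a.
by rewrite -IHB; apply: eq_wsum => b; zmod.
Qed.

Lemma wsumN A f : wsum A (fun u => - f u) = - wsum A f.
Proof.
elim: A f => [//|A IHA B IHB] f /=; rewrite -IHA; apply: eq_wsum => a.
by rewrite -IHB; apply: eq_wsum => b; zmod.
Qed.

Lemma wsumB A f g : wsum A (fun u => f u - g u) = wsum A f - wsum A g.
Proof. by rewrite wsumD wsumN. Qed.

Lemma wsum0 A : wsum A (fun=> 0) = 0.
Proof.
by have := wsumB A (fun=> 0) (fun=> 0); rewrite !subrr.
Qed.

Lemma wsumC A B (f : seq L -> seq L -> V) :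
  wsum A (fun a => wsum B (f a)) = wsum B (fun b => wsum A (f^~ b)).
Proof.
elim: A f => [//|A1 IH1 A2 IH2] f /=; rewrite -IH1; apply: eq_wsum => a1.
by rewrite -IH2; apply: eq_wsum => a2; rewrite wsumB.
Qed.

Lemma wsum_anti A B f : wsum (Node A B) f = - wsum (Node B A) f.
Proof.
rewrite /= wsumC -wsumN; apply: eq_wsum => b; rewrite -wsumN.
by apply: eq_wsum => a; zmod.
Qed.

Lemma wsum_jacobi A B D f : wsum (Node (Node A B) D) f =
  wsum (Node A (Node B D)) f - wsum (Node B (Node A D)) f.
Proof.
rewrite /= [X in _ - X]wsumC -wsumB; apply: eq_wsum => a.
rewrite -wsumB; apply: eq_wsum => b; rewrite -!wsumB; apply: eq_wsum => d.
by rewrite -?catA; zmod.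
Qed.

Definition rot_inv f := forall u w, f (u ++ w) = f (w ++ u).

Lemma eq_uwsum_perm T f g :
  (forall u, perm_eq u (uleaves T) -> f u = g u) -> uwsum T f = uwsum T g.
Proof.
move=> fg; apply: eq_wsum_perm => a aP; apply: eq_wsum_perm => b bP.
by apply: fg; apply: perm_cat.
Qed.

Lemma uwsum_anti A B D f : uwsum (Node A B, D) f = - uwsum (Node B A, D) f.
Proof. exact: wsum_anti. Qed.

Section Cyclic.
Variable f : seq L -> V.
Hypothesis f_rot : rot_inv f.

Lemma uwsum_swap A B : uwsum (A, B) f = uwsum (B, A) f.
Proof.
by rewrite /uwsum wsumC; apply: eq_wsum => b; apply: eq_wsum => a.
Qed.

(** This is the invariance tr([A,B]D) = tr(A[B,D]) of a trace: the terms BAD and ADB agree up to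
    rotation. *)
Lemma uwsum_rotate A B D : uwsum (Node A B, D) f = uwsum (A, Node B D) f.
Proof.
rewrite /uwsum /=; apply: eq_wsum => a; apply: eq_wsum => b.
rewrite -wsumB; apply: eq_wsum => d.
have -> : f ((b ++ a) ++ d) = f (a ++ (d ++ b)) by rewrite -catA f_rot catA.
by rewrite -!catA.
Qed.

(** Once the edge is rotated, [E] is a spectator and the three terms are the cyclic permutations of
    [[A,B],D]. *)
Lemma uwsum_IHX A B D E : uwsum (Node A B, Node D E) f
  + uwsum (Node B D, Node A E) f + uwsum (Node D A, Node B E) f = 0.
Proof.
have hE X Y Z : uwsum (Node X Y, Node Z E) f = wsum (Node (Node X Y) Z)
    (fun u => wsum E (fun e => f (u ++ e))).
  by rewrite -uwsum_rotate.
rewrite !hE wsum_jacobi (wsum_anti (Node B D)).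
have -> g : wsum (Node (Node D A) B) g = wsum (Node B (Node A D)) g.
  rewrite [RHS]wsum_anti.
  exact: (wsum_anti D A (fun u => wsum B (fun b => g (u ++ b) - g (b ++ u)))).
by zmod.
Qed.
End Cyclic.

Definition comb w t := foldr (fun l t => Node (Leaf l) t) t w.
Definition lcomb t w := foldl (fun t l => Node t (Leaf l)) t w.

Lemma comb_cat u w t : comb (u ++ w) t = comb u (comb w t).
Proof. exact: foldr_cat. Qed.

Lemma leaves_comb w t : leaves (comb w t) = w ++ leaves t.
Proof. by elim: w => //= l w ->. Qed.

Lemma leaves_lcomb w t : leaves (lcomb t w) = leaves t ++ w.
Proof. by elim: w t => [|l w IH] t /=; rewrite ?cats0 // IH /= -catA. Qed.

(** The value 0 on the empty word is a convention; it does no harm because expansions of trees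
    contain no empty word. *)
Definition ends_with y f s : V :=
  if s is l :: s' then if last l s' == y then f (belast l s') else 0 else 0.

Lemma ends_with_rcons y f w l :
  ends_with y f (rcons w l) = if l == y then f w else 0.
Proof.
by case: w => [|k w] //=; rewrite belast_rcons last_rcons.
Qed.

Lemma ends_with_cat y f s l w :
  ends_with y f (s ++ l :: w) = ends_with y (fun w => f (s ++ w)) (l :: w).
Proof. by rewrite lastI -rcons_cat !ends_with_rcons. Qed.

(* The terms ending in y of the expansion of D, which determine D if y occurs
   once among its leaves. *)
Fixpoint psum y D f : V :=
  match D with
  | Leaf l => if l == y then f [::] else 0
  | Node A B => wsum A (fun a => psum y B (fun b => f (a ++ b)))
                - wsum B (fun b => psum y A (fun a => f (b ++ a)))
  end.

Lemma size_leaves_gt0 A : (0 < size (leaves A))%N.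
Proof. by elim: A => //= A IH B _; rewrite size_cat addn_gt0 IH. Qed.

Lemma psumE y D f : psum y D f = wsum D (ends_with y f).
Proof.
elim: D f => [l|A IHA B IHB] f //=.
rewrite [X in _ - X](eq_wsum B (g := fun b => wsum A (fun a => ends_with y f (b ++ a)))).
  rewrite [X in _ - X]wsumC -wsumB; apply: eq_wsum => a; rewrite wsumB IHB.
  congr (_ - _); apply: eq_wsum_perm => b /perm_size bB.
  (* If [b] were empty, the last letter of [a ++ b] would come from [a]; a tree has at least one
     leaf. *)
  case: b bB => [|l b]; last by rewrite ends_with_cat.
  by have := size_leaves_gt0 B => /[swap] <-.
move=> b; rewrite IHA; apply: eq_wsum_perm => a /perm_size aA.
case: a aA => [|l a]; last by rewrite ends_with_cat.
by have := size_leaves_gt0 A => /[swap] <-.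
Qed.

Lemma eq_psum y D f g : f =1 g -> psum y D f = psum y D g.
Proof.
by move=> fg; rewrite !psumE; apply: eq_wsum => -[|l w] //=; rewrite fg.
Qed.

Lemma psum_notin y D f : y \notin leaves D -> psum y D f = 0.
Proof.
move=> yD; rewrite psumE -(wsum0 D); apply: eq_wsum_perm => -[|l w] //= wD.
case: eqP => // ly; case/negP: yD; rewrite -(perm_mem wD) -ly.
exact: mem_last.
Qed.

Lemma eq_psum_perm y D f g :
  (forall w, perm_eq (rcons w y) (leaves D) -> f w = g w) ->
  psum y D f = psum y D g.
Proof.
move=> fg; rewrite !psumE; apply: eq_wsum_perm => -[|l w] //= wD.
by case: eqP => // ly; apply: fg; rewrite -[X in rcons _ X]ly -lastI.
Qed.

(* The prefix p lets both identities be used at any depth along a comb. *)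
Definition lie_function (K : btree L -> V) :=
  (forall p A B, K (comb p (Node A B)) = - K (comb p (Node B A))) /\
  (forall p A B D, K (comb p (Node (Node A B) D)) =
     K (comb p (Node A (Node B D))) - K (comb p (Node B (Node A D)))).

(** By the Jacobi identity ad [A1,A2] is the commutator of ad A1 and ad A2, so bracketing with [A]
    expands into words whose letters act one after the other. *)
Lemma lie_function_comb K p A B : lie_function K ->
  K (comb p (Node A B)) = wsum A (fun a => K (comb (p ++ a) B)).
Proof.
case=> _ KJ; elim: A p B => [l|A1 IH1 A2 IH2] p B /=; first by rewrite comb_cat.
rewrite KJ IH1 IH2; under [X in X - _]eq_wsum do rewrite IH2.
under [X in _ - X]eq_wsum do rewrite IH1.
rewrite [X in _ - X]wsumC -wsumB; apply: eq_wsum => a1; rewrite -wsumB.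
by apply: eq_wsum => a2; rewrite !catA.
Qed.

(** Brackets nested to the right and ending in a fixed leaf [y] span the multilinear part of a free
    Lie algebra, and the coordinate of [D] at such a bracket is the coefficient of the word [w y] in
    its expansion. *)
Lemma lie_function_psum K y D : lie_function K -> uniq (leaves D) ->
  y \in leaves D -> K D = psum y D (fun w => K (comb w (Leaf y))).
Proof.
(* The prefix has to vary in the induction: it collects the words of the subtrees that do not
   contain [y]. *)
move=> KL; rewrite -[K D]/(K (comb [::] D)).
rewrite -[RHS]/(psum y D (fun w => K (comb ([::] ++ w) (Leaf y)))).
elim: D [::] => [l|A IHA B IHB] p /=.
  by rewrite inE => _ /eqP->; rewrite eqxx cats0.
rewrite cat_uniq mem_cat => /and3P[uA AB uB] /orP[yA|yB].
  have yB : y \notin leaves B by apply: contraTN yA => /(hasPn AB).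
  rewrite (eq_wsum _ (g := fun=> 0)) ?wsum0 => [|a]; last exact: psum_notin.
  case: (KL) => -> _; rewrite lie_function_comb // sub0r; congr (- _).
  by apply: eq_wsum => b; rewrite IHA //; apply: eq_psum => a; rewrite catA.
have yA : y \notin leaves A by apply: (hasPn AB).
rewrite [X in _ - X](eq_wsum _ (g := fun=> 0)) ?wsum0 => [|b]; last exact: psum_notin.
rewrite lie_function_comb // subr0.
by apply: eq_wsum => a; rewrite IHB //; apply: eq_psum => b; rewrite catA.
Qed.

(** Bracketing with a fixed prefix is transposed into a change of the test function, so identities
    at the root hold at any depth. *)
Lemma wsum_comb w f : exists g, forall t, wsum (comb w t) f = wsum t g.
Proof.
elim: w f => [|l w IH] f; first by exists f.
have [g gE] := IH (fun b => f (l :: b) - f (b ++ [:: l])).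
by exists g => t'; rewrite /= gE.
Qed.

Lemma wsum_lie_function f : lie_function (fun A => wsum A f).
Proof.
split=> p *; have [g gE] := wsum_comb p f; rewrite !gE.
  exact: wsum_anti.
exact: wsum_jacobi.
Qed.

(** The same [D] serves all invariant functions [J], so that two of them can be compared on one
    rooted form of [T]. *)
Lemma reroot x T : x \in uleaves T -> exists D,
  (forall (W : Type) (J : utree L -> W), (forall A B, J (A, B) = J (B, A)) ->
     (forall A B D, J (Node A B, D) = J (A, Node B D)) -> J T = J (Leaf x, D))
  /\ perm_eq (uleaves T) (x :: leaves D).
Proof.
case: T => A B; wlog xA : A B / x \in leaves A.
  move=> wl; rewrite mem_cat => /orP[xA|xB]; first by apply: wl => //; rewrite mem_cat xA.
  have [||D [JD DP]] := wl B A; rewrite ?mem_cat ?xB //.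
  exists D; split=> [W J J_swap J_rot|]; first by rewrite J_swap JD.
  by rewrite -(permPr DP) /uleaves perm_catC.
move=> _; elim: A B xA => [l|A1 IH1 A2 IH2] B /=.
  by rewrite inE => /eqP<-; exists B.
rewrite mem_cat => /orP[xA|xA].
  have [D [JD DP]] := IH1 (Node A2 B) xA.
  exists D; split=> [W J J_swap J_rot|]; first by rewrite J_rot JD.
  by rewrite -(permPr DP) /uleaves /= catA.
have [D [JD DP]] := IH2 (Node B A1) xA.
exists D; split=> [W J J_swap J_rot|].
  by rewrite J_rot J_swap J_rot JD.
by rewrite -(permPr DP) /uleaves /= -catA perm_catC catA.
Qed.

Implicit Types (F : seq L -> seq L -> V) (G : seq L -> L -> seq L -> V).

Fixpoint splitsum G w : V :=
  if w is l :: w' then G [::] l w' + splitsum (fun a => G (l :: a)) w' else 0.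

Lemma eq_splitsum G G' w :
  (forall a l b, w = a ++ l :: b -> G a l b = G' a l b) ->
  splitsum G w = splitsum G' w.
Proof.
elim: w G G' => //= l w IH G G' GG'; congr (_ + _); first exact: GG'.
by apply: IH => a l' b wE; apply: GG'; rewrite wE.
Qed.

Lemma splitsum0 w : splitsum (fun _ _ _ => 0) w = 0.
Proof. by elim: w => //= l w ->; rewrite addr0. Qed.

Lemma splitsum_eq0 G w : (forall a l b, w = a ++ l :: b -> G a l b = 0) ->
  splitsum G w = 0.
Proof. by move=> G0; rewrite -[RHS](splitsum0 w); apply: eq_splitsum. Qed.

Lemma splitsum_cat G u w : splitsum G (u ++ w) =
  splitsum (fun a l b => G a l (b ++ w)) u + splitsum (fun a => G (u ++ a)) w.
Proof. by elim: u G => [|l u IH] G /=; rewrite ?add0r // IH addrA. Qed.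

(** The circle is cut open at each letter in turn, which makes the sum invariant under rotation
    whatever [h] is. *)
Definition cycsum (h : L -> seq L -> V) w :=
  splitsum (fun a l b => h l (b ++ a)) w.

Lemma eq_cycsum h h' w :
  (forall l s, perm_eq (l :: s) w -> h l s = h' l s) -> cycsum h w = cycsum h' w.
Proof.
move=> hh'; apply: eq_splitsum => a l b wE; apply: hh'.
by rewrite wE perm_sym perm_catC.
Qed.

Lemma cycsum_rot h : rot_inv (cycsum h).
Proof.
move=> u w; rewrite /cycsum !splitsum_cat addrC.
by congr (_ + _); apply: eq_splitsum => a l b _; rewrite catA.
Qed.

Definition cpick x (k : seq L -> V) w :=
  cycsum (fun l s => if l == x then k s else 0) w.

Lemma cpick_rot x k : rot_inv (cpick x k).
Proof. exact: cycsum_rot. Qed.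

Lemma cpick_notin x k w : x \notin w -> cpick x k w = 0.
Proof.
move=> xw; apply: splitsum_eq0 => a l b wE; case: eqP => // lx.
by case/negP: xw; rewrite wE -lx mem_cat mem_head orbT.
Qed.

Lemma cpick_cons x k w : x \notin w -> cpick x k (x :: w) = k w.
Proof.
move=> xw; rewrite /cpick /cycsum /= eqxx cats0 splitsum_eq0 ?addr0 //.
move=> a l b wE; case: eqP => // lx.
by case/negP: xw; rewrite wE -lx mem_cat mem_head orbT.
Qed.

Lemma eq_cpick x k k' w : (forall s, perm_eq (x :: s) w -> k s = k' s) ->
  cpick x k w = cpick x k' w.
Proof. by move=> kk'; apply: eq_cycsum => l s; case: eqP => // ->; apply: kk'. Qed.

(* Sum of f w over the signed cyclic words x w y of the expansion of T, i.e. over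
   what is read along the path from x to y when the leaves of T are distinct. *)
Definition path_sum x y f T := uwsum T (cpick x (ends_with y f)).

Lemma path_sum_swap x y f A B : path_sum x y f (A, B) = path_sum x y f (B, A).
Proof. exact/uwsum_swap/cpick_rot. Qed.

Lemma path_sum_rotate x y f A B D :
  path_sum x y f (Node A B, D) = path_sum x y f (A, Node B D).
Proof. exact/uwsum_rotate/cpick_rot. Qed.

Lemma path_sum_leaf x y f D : x \notin leaves D ->
  path_sum x y f (Leaf x, D) = psum y D f.
Proof.
move=> xD; rewrite psumE /path_sum /uwsum /=; apply: eq_wsum_perm => u uD.
by rewrite cpick_cons // (perm_mem uD).
Qed.

Lemma eq_path_sum x y f g T :
  (forall w, perm_eq (x :: rcons w y) (uleaves T) -> f w = g w) ->
  path_sum x y f T = path_sum x y g T.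
Proof.
move=> fg; apply: eq_uwsum_perm => u uT; apply: eq_cpick => -[|l s] //= su.
case: eqP => // ly; apply: fg; rewrite -[X in rcons _ X]ly -lastI.
exact: perm_trans su uT.
Qed.

(* The value F c d at the cyclic word p c q d. *)
Definition arcs p q F := cpick p (splitsum (fun c l d => if l == q then F c d else 0)).

Lemma arcs_rot p q F : rot_inv (arcs p q F).
Proof. exact: cpick_rot. Qed.

Lemma arcs_cons p q F c d : uniq (p :: c ++ q :: d) ->
  arcs p q F (p :: c ++ q :: d) = F c d.
Proof.
rewrite cons_uniq cat_uniq => /and4P[pcd uc /hasPn cqd /andP[qd ud]].
rewrite /arcs cpick_cons // splitsum_cat /= eqxx cats0.
have qc := cqd q (mem_head _ _).
rewrite !splitsum_eq0 ?addr0 ?add0r // => a l b E; case: eqP => // lq.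
  by case/negP: qd; rewrite E -lq mem_cat mem_head orbT.
by case/negP: qc; rewrite E -lq mem_cat mem_head orbT.
Qed.

Lemma arcs_cat p q F u c d : uniq (u ++ p :: c ++ q :: d) ->
  arcs p q F (u ++ p :: c ++ q :: d) = F c (d ++ u).
Proof.
rewrite uniq_catC cat_cons -catA cat_cons => U.
by rewrite arcs_rot cat_cons -catA cat_cons arcs_cons.
Qed.

Lemma arcs_cat2 p q F u c d : uniq (u ++ q :: c ++ p :: d) ->
  arcs p q F (u ++ q :: c ++ p :: d) = F (d ++ u) c.
Proof.
rewrite -cat_cons catA uniq_catC cat_cons catA => U.
by rewrite arcs_rot cat_cons catA arcs_cons.
Qed.
End WordSums.

Lemma size_leaves (L : Type) (A : btree L) : size (leaves A) = (nodes A).+1.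
Proof. by elim: A => //= A IHA B IHB; rewrite size_cat IHA IHB addSn addnS. Qed.

(** * Reversal of words, and expansion of combs *)

Section Reversal.
Variables (L : eqType) (V : zmodType).
Implicit Types (A B D : btree L) (T : utree L) (f : seq L -> V).
Implicit Types (x y v : L) (u w a : seq L).

Lemma wsumMsign B f k :
  wsum B (fun u => f u *~ (-1) ^+ k) = wsum B f *~ (-1) ^+ k.
Proof.
have E (x : V) : x *~ (-1) ^+ k = if odd k then - x else x :> V.
  by rewrite -signr_odd; case: odd; rewrite ?mulrNz.
rewrite E (eq_wsum _ (g := fun u => if odd k then - f u else f u)) => [|u].
  by case: odd; rewrite ?wsumN.
exact: E.
Qed.

(** Reversal is an antiautomorphism of the free associative algebra, so each bracket contributes a
    factor -1. *)
Lemma wsum_rev A f :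
  wsum A (fun u => f (rev u)) = wsum A f *~ (-1) ^+ nodes A.
Proof.
elim: A f => [l|A IHA B IHB] f //=.
pose k a := wsum B (fun b => f (b ++ a) - f (a ++ b)).
transitivity (wsum A (fun a => k (rev a) *~ (-1) ^+ nodes B)).
  apply: eq_wsum => a; rewrite -IHB; apply: eq_wsum => b.
  by rewrite !rev_cat.
rewrite wsumMsign IHA -mulrzA -exprD exprS mulN1r mulrNz -mulNrz; congr (_ *~ _).
by rewrite -wsumN; apply: eq_wsum => a; rewrite -wsumN; apply: eq_wsum => b; zmod.
Qed.

Lemma uwsum_rev T f : rot_inv f ->
  uwsum T (fun u => f (rev u)) = uwsum T f *~ (-1) ^+ lie_degree T.
Proof.
case: T => A B f_rot; rewrite /uwsum /lie_degree /= exprD.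
rewrite mulrzA -wsum_rev -wsumMsign; apply: eq_wsum => a.
by rewrite -wsum_rev; apply: eq_wsum => b; rewrite rev_cat f_rot.
Qed.

Lemma uniq_pair_split x y w : uniq w -> x \in w -> y \in w -> x != y ->
  exists u c d, (w = u ++ x :: c ++ y :: d \/ w = u ++ y :: c ++ x :: d).
Proof.
move=> uw xw yw xy; case/splitPr: xw uw yw => u d _.
rewrite mem_cat inE eq_sym (negPf xy) /= => /orP[] /splitPr[c e].
  by exists c, e, d; right; rewrite -catA.
by exists u, c, e; left.
Qed.

Lemma ends_with_mid y f s t : y \notin t ->
  ends_with y f (s ++ y :: t) = if t is [::] then f s else 0.
Proof.
case/lastP: t => [|t z]; first by rewrite cats1 ends_with_rcons eqxx.
rewrite -rcons_cons -rcons_cat ends_with_rcons mem_rcons inE eq_sym.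
by case: eqP => //; case: t.
Qed.

Lemma path_sum_rev x y f T : uniq (uleaves T) -> x != y ->
  x \in uleaves T -> y \in uleaves T ->
  path_sum y x f T = path_sum x y (fun s => f (rev s)) T *~ (-1) ^+ lie_degree T.
Proof.
move=> uT xy xT yT; rewrite -uwsum_rev; last exact: cpick_rot.
apply: eq_uwsum_perm => w wT.
have uw : uniq w by rewrite (perm_uniq wT).
rewrite -!(perm_mem wT) in xT yT.
case/splitPr: xT uw yT {wT} => u d uw yw.
have [c [e E]] : exists c e, d ++ u = c ++ y :: e.
  have : y \in d ++ u.
    by move: yw; rewrite !mem_cat inE eq_sym (negPf xy) orbC.
  by case/splitPr=> c e; exists c, e.
(* The cyclic word is [x c y e]. Both sides vanish unless [c] is empty, and then both give [f e]. *)
have -> k : cpick y k (u ++ x :: d) = cpick y k (y :: e ++ x :: c).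
  by rewrite cpick_rot cat_cons E -cat_cons cpick_rot.
have -> k : cpick x k (rev (u ++ x :: d)) = cpick x k (x :: rev e ++ y :: rev c).
  rewrite rev_cat cpick_rot -rev_cat cat_cons E -cat_cons rev_cat !rev_cons.
  by rewrite cat_rcons -rcons_cons -rcons_cat -cats1 cpick_rot.
move: uw; rewrite uniq_catC cat_cons E cons_uniq cat_uniq mem_cat.
case/and4P=> /norP[xc xye] uc /hasPn cye /andP[ye ue].
have yc := cye y (mem_head _ _).
move: xye; rewrite inE => /norP[_ xe].
rewrite !cpick_cons; last 2 first.
- by rewrite mem_cat inE !mem_rev (negPf xy) (negPf xc) (negPf xe).
- by rewrite mem_cat inE eq_sym (negPf xy) (negPf yc) (negPf ye).
rewrite !ends_with_mid ?mem_rev //.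
by case: (c) => [|z c']; rewrite ?revK //= rev_cons; case: rev.
Qed.

(** The expansion of [comb u (Leaf y)]: each letter goes to the left of [y], or to the right with a
    sign and in reverse order. [lcomb_sum] is the expansion of [lcomb (Leaf x) u], where the signs
    are on the left. *)
Fixpoint comb_sum u (g : seq L -> seq L -> V) : V :=
  if u is v :: u' then comb_sum u' (fun l r => g (v :: l) r - g l (rcons r v))
  else g [::] [::].

Fixpoint lcomb_sum u (g : seq L -> seq L -> V) : V :=
  if u is v :: u' then lcomb_sum u' (fun l r => g l (v :: r) - g (rcons l v) r)
  else g [::] [::].

Implicit Types g : seq L -> seq L -> V.

Lemma eq_comb_sum u g g' : (forall l r, g l r = g' l r) -> comb_sum u g = comb_sum u g'.
Proof. by elim: u g g' => //= v u IH g g' gg'; apply: IH => l r; rewrite !gg'. Qed.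

Lemma eq_lcomb_sum u g g' : (forall l r, g l r = g' l r) -> lcomb_sum u g = lcomb_sum u g'.
Proof. by elim: u g g' => //= v u IH g g' gg'; apply: IH => l r; rewrite !gg'. Qed.

Lemma eq_comb_sum_perm u g g' :
  (forall l r, perm_eq (l ++ r) u -> g l r = g' l r) -> comb_sum u g = comb_sum u g'.
Proof.
elim: u g g' => [|v u IH] g g' gg' /=; first exact: gg'.
apply: IH => l r lr; congr (_ - _); apply: gg'; first by rewrite perm_cons.
by rewrite -rcons_cat perm_rcons perm_cons.
Qed.

Lemma eq_lcomb_sum_perm u g g' :
  (forall l r, perm_eq (l ++ r) u -> g l r = g' l r) -> lcomb_sum u g = lcomb_sum u g'.
Proof.
elim: u g g' => [|v u IH] g g' gg' /=; first exact: gg'.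
apply: IH => l r lr; have P : perm_eq (l ++ v :: r) (v :: u).
  by rewrite perm_catC /= perm_cons perm_catC.
by congr (_ - _); apply: gg'; rewrite ?cat_rcons.
Qed.

Lemma comb_sumB u g g' :
  comb_sum u (fun l r => g l r - g' l r) = comb_sum u g - comb_sum u g'.
Proof.
by elim: u g g' => //= v u IH g g'; rewrite -IH; apply: eq_comb_sum => l r; zmod.
Qed.

Lemma lcomb_sumB u g g' :
  lcomb_sum u (fun l r => g l r - g' l r) = lcomb_sum u g - lcomb_sum u g'.
Proof.
by elim: u g g' => //= v u IH g g'; rewrite -IH; apply: eq_lcomb_sum => l r; zmod.
Qed.

Lemma comb_sum_rcons u v g :
  comb_sum (rcons u v) g = comb_sum u (fun l r => g (rcons l v) r - g l (v :: r)).
Proof.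
by elim: u g => //= v' u IH g; rewrite IH; apply: eq_comb_sum => l r /=; zmod.
Qed.

Lemma lcomb_sum_rcons u v g :
  lcomb_sum (rcons u v) g = lcomb_sum u (fun l r => g l (rcons r v) - g (v :: l) r).
Proof.
by elim: u g => //= v' u IH g; rewrite IH; apply: eq_lcomb_sum => l r /=; zmod.
Qed.

Lemma wsum_comb_leaf u y f :
  wsum (comb u (Leaf y)) f = comb_sum u (fun l r => f (l ++ y :: r)).
Proof.
elim: u f => //= v u IH f; rewrite IH; apply: eq_comb_sum => l r.
by rewrite -cats1 -catA.
Qed.

Lemma wsum_lcomb_leaf u x f :
  wsum (lcomb (Leaf x) u) f = lcomb_sum u (fun l r => f (l ++ x :: r)).
Proof.
elim/last_ind: u f => //= u v IH f.
rewrite /lcomb -cats1 foldl_cat cats1 /= -/(lcomb _ _) IH lcomb_sum_rcons.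
by apply: eq_lcomb_sum => l r; rewrite -cats1 -catA.
Qed.

(* The relation satisfied when the class of p w q z, closed up into a circle
   with a dotted chord from p to q, allows one to slide a letter through the
   chord. *)
Definition slides (F : seq L -> seq L -> V) := forall v w z,
  F w (rcons z v) - F (v :: w) z = F w (v :: z) - F (rcons w v) z.

(** [slides] exchanges a letter expanded next to [x] for the same letter expanded next to [y], at
    the other end of the dotted edge. The letters of [u1] thus move one by one to the inner end of
    [u2]. *)
Lemma comb_sum_slide F a u1 u2 : slides F ->
  lcomb_sum u1 (fun l r => comb_sum u2 (fun l' r' => F (r' ++ l) (r ++ a ++ l')))
  = comb_sum (u2 ++ u1) (fun l' r' => F r' (a ++ l')).
Proof.
move=> Fs; elim: u1 u2 => [|v u1 IH] u2 /=.
  by rewrite cats0; apply: eq_comb_sum => l r; rewrite cats0.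
rewrite -cat_rcons -IH; apply: eq_lcomb_sum => l r; rewrite comb_sum_rcons -comb_sumB.
by apply: eq_comb_sum => l' r'; rewrite -!rcons_cat !cat_cons Fs.
Qed.

Lemma psum_comb y a D f :
  y \notin a -> psum y (comb a D) f = psum y D (fun w => f (a ++ w)).
Proof.
elim: a f => //= v a IH f; rewrite inE => /norP[yv ya].
rewrite IH // (eq_wsum (comb a D) (g := fun=> 0)) ?wsum0 ?subr0 // => b.
by case: eqP => // vy; rewrite vy eqxx in yv.
Qed.

Lemma path_sumN x y f T : path_sum x y (fun w => - f w) T = - path_sum x y f T.
Proof.
rewrite /path_sum /uwsum -wsumN; apply: eq_wsum => a; rewrite -wsumN.
apply: eq_wsum => b; move: (a ++ b) => w; rewrite /cpick /cycsum.
have splitsumN G : splitsum (fun a l b => - G a l b) w = - splitsum G w :> V.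
  elim: w G => [|v w IH] G /=; first by rewrite oppr0.
  by rewrite opprD -IH.
rewrite -splitsumN; apply: eq_splitsum => c l d _; case: eqP; rewrite ?oppr0 //.
by case: (d ++ c) => [|v s] /=; rewrite ?oppr0 //; case: eqP; rewrite ?oppr0.
Qed.

Lemma path_sum_comb x y f w : uniq (x :: rcons w y) ->
  path_sum x y f (Leaf x, comb w (Leaf y)) = f w.
Proof.
rewrite cons_uniq rcons_uniq mem_rcons => /and3P[xw yw _].
rewrite path_sum_leaf ?psum_comb //= ?eqxx ?cats0 //.
by rewrite leaves_comb cats1 mem_rcons.
Qed.

Lemma comb_lcomb (W : Type) (J : utree L -> W) A u D :
  (forall A B D, J (Node A B, D) = J (A, Node B D)) ->
  J (A, comb u D) = J (lcomb A u, D).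
Proof. by move=> J_rot; elim: u A => //= v u IH A; rewrite -IH J_rot. Qed.

Lemma reroot_comb (W : Type) (J : utree L -> W) x y p q u1 a u2 :
  (forall A B, J (A, B) = J (B, A)) ->
  (forall A B D, J (Node A B, D) = J (A, Node B D)) ->
  J (Leaf x, comb (u1 ++ p :: a ++ q :: u2) (Leaf y)) =
  J (Leaf p, Node (comb a (Node (Leaf q) (comb u2 (Leaf y)))) (lcomb (Leaf x) u1)).
Proof.
move=> J_swap J_rot; rewrite comb_cat comb_lcomb //= -J_rot J_swap -J_rot.
by rewrite J_swap comb_cat.
Qed.

(** Read from [p] to [q], the leaf [x] with [u1] is a subtree hanging near [p], and [y] with [u2] is
    one hanging near [q]. Each hangs on the side that costs a sign, and the two signs cancel. *)
Lemma path_sum_comb_inner x y p q f u1 a u2 :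
  uniq (x :: rcons (u1 ++ p :: a ++ q :: u2) y) ->
  path_sum p q f (Leaf x, comb (u1 ++ p :: a ++ q :: u2) (Leaf y)) =
  lcomb_sum u1 (fun l r => comb_sum u2 (fun l' r' => f (l ++ x :: r ++ a ++ l' ++ y :: r'))).
Proof.
move=> U; rewrite (reroot_comb _ _ _ _ _ _ _ (path_sum_swap p q f)); last first.
  exact: path_sum_rotate.
have P : perm_eq (x :: rcons (u1 ++ p :: a ++ q :: u2) y)
    (p :: q :: a ++ (rcons u2 y) ++ x :: u1).
  by apply/permP=> k; do 3! rewrite /= -?cats1 ?count_cat; lia.
move: U; rewrite (perm_uniq P) !cons_uniq !inE => /and3P[/norP[pq pP] qP _].
have [pa pu] : p \notin a /\ p \notin x :: u1.
  by move: pP; rewrite !mem_cat => /norP[? /norP[]].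
have [qa qu2 qx] : [/\ q \notin a, q \notin rcons u2 y & q \notin x :: u1].
  by move: qP; rewrite !mem_cat => /norP[? /norP[]].
rewrite path_sum_leaf; last first.
  rewrite /= leaves_lcomb leaves_comb /= leaves_comb.
  move: pP; rewrite !(mem_cat, mem_rcons, inE, negb_or) (negPf pq) /=.
  by case/and3P=> -> /andP[-> ->] /andP[-> ->].
rewrite [psum _ _ _]/= (eq_wsum _ (g := fun=> 0)) ?wsum0 ?sub0r; last first.
  by move=> w; apply: psum_notin; rewrite leaves_lcomb.
rewrite wsum_lcomb_leaf.
have E (g : seq L -> V) :
    psum q (comb a (Node (Leaf q) (comb u2 (Leaf y)))) g =
    - comb_sum u2 (fun l r => g (a ++ l ++ y :: r)).
  rewrite psum_comb //= eqxx psum_notin ?leaves_comb ?cats1 // sub0r.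
  by rewrite wsum_comb_leaf; congr (- _); apply: eq_comb_sum => l r; rewrite cats0.
have lcomb_sumN u g : - lcomb_sum u g = lcomb_sum u (fun l r => - g l r).
  by elim: u g => //= v u IH g; rewrite IH; apply: eq_lcomb_sum => l r; zmod.
rewrite lcomb_sumN; apply: eq_lcomb_sum => l r; rewrite E opprK; apply: eq_comb_sum => l' r'.
by rewrite -catA.
Qed.

(** * The key identity *)

Section KeyIdentity.
Variable F : seq L -> seq L -> V.
Hypothesis F_slides : slides F.
(* The relation (C3) for a theta graph whose third arc carries no hair. *)
Hypothesis F_tripod : forall a z,
  F a z + F z a + comb_sum z (fun l r => F r (a ++ l)) = 0.
Hypothesis F_rev : forall a z,
  F (rev a) (rev z) = F a z *~ (-1) ^+ (size a + size z).

(** A chord is counted with both orders of its ends, and its skew weight turns the sum of the two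
    values into this difference. *)
Definition arcsB x y w := arcs x y F w - arcs y x F w.

Lemma arcsB_anti x y w : arcsB x y w = - arcsB y x w.
Proof. by rewrite /arcsB; zmod. Qed.

Lemma arcs_rev x y w : uniq w -> x \in w -> y \in w -> x != y ->
  arcs x y F (rev w) = arcs y x F w *~ (-1) ^+ size w.
Proof.
move=> uw xw yw xy.
(* The two ends of the chord add 2 to the length, which leaves the sign unchanged. *)
have sz (s t r : seq L) l l' : (-1) ^+ size (s ++ l :: t ++ l' :: r) =
    (-1) ^+ (size t + size (r ++ s)) :> int.
  rewrite -signr_odd -[in RHS]signr_odd; congr (_ ^+ nat_of_bool _).
  by rewrite !size_cat /= size_cat /= !addnS !oddS negbK; congr odd; lia.
have ur : uniq (rev w) by rewrite rev_uniq.
have [u [c [d [] wE]]] := uniq_pair_split uw xw yw xy;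
  rewrite wE in uw ur *; rewrite sz;
  rewrite !(rev_cat, rev_cons) -!cats1 -!catA /= in ur *.
  by rewrite !arcs_cat2 // -rev_cat F_rev addnC.
by rewrite !arcs_cat // -rev_cat F_rev.
Qed.

Lemma arcsB_rev x y w : uniq w -> x \in w -> y \in w -> x != y ->
  arcsB x y (rev w) = - arcsB x y w *~ (-1) ^+ size w.
Proof.
move=> uw xw yw xy; rewrite /arcsB !arcs_rev // 1?eq_sym // -mulrzBl.
by rewrite opprB.
Qed.

(** The path contributes (-1)^k with k the number of nodes, and [arcsB_rev] contributes -(-1)^k,
    since the word between the two ends has k letters. *)
Lemma path_sum_arcsB_rev x y p q T : uniq [:: x; y; p; q] ->
  uniq (uleaves T) -> {subset [:: x; y; p; q] <= uleaves T} ->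
  path_sum q p (arcsB x y) T = - path_sum p q (arcsB x y) T.
Proof.
rewrite /= !inE !negb_or andbT => /and3P[/and3P[xy xp xq] /andP[yp yq] pq] uT sT.
have [xT yT pT qT] : [/\ x \in uleaves T, y \in uleaves T, p \in uleaves T
    & q \in uleaves T].
  by split; apply: sT; rewrite !inE eqxx ?orbT.
rewrite (@path_sum_rev p q) //; set k := lie_degree T.
have E (z : V) : z *~ (-1) ^+ k = if odd k then - z else z.
  by rewrite -signr_odd; case: odd; rewrite ?mulrNz.
rewrite (@eq_path_sum _ _ p q _ (fun w => - (if odd k then - arcsB x y w
    else arcsB x y w))) ?path_sumN => [|w wT].
  by rewrite E; case: odd; rewrite ?path_sumN ?opprK.
have U : uniq (p :: rcons w q) by rewrite (perm_uniq wT).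
have memw z : z != p -> z != q -> z \in uleaves T -> z \in w.
  by move=> zx zy; rewrite -(perm_mem wT) inE mem_rcons inE (negPf zx) (negPf zy).
rewrite arcsB_rev ?memw //; last by move: U; rewrite cons_uniq rcons_uniq => /and3P[].
have -> : size w = k.
  have := perm_size wT; rewrite /= size_rcons /uleaves size_cat !size_leaves.
  by rewrite addSn addnS => -[].
by rewrite mulNrz E.
Qed.

Section Class.
Variable J : utree L -> V.
Hypothesis J_swap : forall A B, J (A, B) = J (B, A).
Hypothesis J_rotate : forall A B D, J (Node A B, D) = J (A, Node B D).
Hypothesis J_lie : forall l, lie_function (fun D => J (Leaf l, D)).

Lemma class_path_sum x y T : uniq (uleaves T) -> x != y ->
  x \in uleaves T -> y \in uleaves T ->
  J T = path_sum x y (fun w => J (Leaf x, comb w (Leaf y))) T.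
Proof.
move=> uT xy xT; have [D [JD DP]] := reroot xT.
rewrite (JD _ J) // (JD _ (path_sum x y _)); last exact: path_sum_rotate.
  move: uT; rewrite !(perm_uniq DP) (perm_mem DP) inE eq_sym (negPf xy) /=.
  move=> /andP[xD uD] yD; rewrite path_sum_leaf //.
  exact: (lie_function_psum (J_lie x)).
exact: path_sum_swap.
Qed.

(* Seen from p, the arms u1 and u2 have to be expanded; F_slides moves all the
   letters of u1 past x to the side of y, after which F_tripod applies. *)
Lemma arcs_identity_comb x y p q u1 a u2 :
  let T := (Leaf x, comb (u1 ++ p :: a ++ q :: u2) (Leaf y)) in
  J T = F a (u2 ++ u1) -> uniq (uleaves T) ->
  (forall u1 a u2, uniq (p :: rcons (u1 ++ x :: a ++ y :: u2) q) ->
     J (Leaf p, comb (u1 ++ x :: a ++ y :: u2) (Leaf q)) = F a (u2 ++ u1)) ->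
  path_sum x y (arcsB p q) T + path_sum p q (arcsB x y) T = J T *+ 3.
Proof.
move=> T JT; have -> : uleaves T = x :: rcons (u1 ++ p :: a ++ q :: u2) y.
  by rewrite /uleaves /= leaves_comb cats1.
move=> uT Jpq.
rewrite path_sum_comb // path_sum_comb_inner //.
have uW : uniq (u1 ++ p :: a ++ q :: u2).
  by move: uT; rewrite cons_uniq rcons_uniq => /and3P[].
(* From [x] to [y] the tree is already a comb: with [z = u2 ++ u1], the first path sum is
   [F a z - F z a]. *)
rewrite [arcsB p q _]/arcsB arcs_cat // arcs_cat2 //.
pose W l r l' r' := l ++ x :: r ++ a ++ l' ++ y :: r'.
have WP l r l' r' : perm_eq (l ++ r) u1 -> perm_eq (l' ++ r') u2 ->
    perm_eq (p :: rcons (W l r l' r') q) (x :: rcons (u1 ++ p :: a ++ q :: u2) y).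
  move=> /permP P1 /permP P2; apply/permP => k; have := P1 k; have := P2 k.
  do 3! rewrite /W /= -?cats1 ?count_cat.
  by lia.
have JE : J T = lcomb_sum u1 (fun l r => comb_sum u2 (fun l' r' =>
    J (Leaf p, comb (W l r l' r') (Leaf q)))).
  rewrite (@class_path_sum p q) ?path_sum_comb_inner //.
  - by rewrite /uleaves /= leaves_comb cats1.
  - move: uW; rewrite cat_uniq => /and3P[_ _ /andP[]].
    by rewrite mem_cat inE => /norP[_ /norP[]].
  - by rewrite /uleaves /= leaves_comb !(mem_cat, inE) eqxx !orbT.
  by rewrite /uleaves /= leaves_comb !(mem_cat, inE) eqxx !orbT.
(* After the slide, what remains is the third term of [F_tripod], with all letters of the two arms
   in the word [u2 ++ u1]. *)
have BE : lcomb_sum u1 (fun l r => comb_sum u2 (fun l' r' => F (r' ++ l) (r ++ a ++ l')))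
    = - F a (u2 ++ u1) - F (u2 ++ u1) a.
  rewrite comb_sum_slide //; have := F_tripod a (u2 ++ u1).
  by move/eqP; rewrite addrC addr_eq0 => /eqP->; zmod.
(* On each word [arcsB x y] is [F c d - F d c]. The terms [F c d] are classes of combs from [p] to
   [q] and add up to [J T]; the others are the sum computed in [BE]. *)
rewrite (@eq_lcomb_sum_perm _ _ (fun l r => comb_sum u2 (fun l' r' =>
    J (Leaf p, comb (W l r l' r') (Leaf q)))
  - comb_sum u2 (fun l' r' => F (r' ++ l) (r ++ a ++ l')))).
  (* The total is [F a z - F z a], plus [J T], plus [F a z + F z a], where [J T = F a z]. *)
  rewrite lcomb_sumB -JE BE JT mulrS mulr2n; zmod.
move=> l r lP; rewrite -comb_sumB; apply: eq_comb_sum_perm => l' r' rP.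
have uW' : uniq (p :: rcons (W l r l' r') q) by rewrite (perm_uniq (WP _ _ _ _ lP rP)).
have WE : W l r l' r' = l ++ x :: (r ++ a ++ l') ++ y :: r' by rewrite -!catA.
have uW2 : uniq (W l r l' r').
  by move: uW'; rewrite cons_uniq rcons_uniq => /and3P[].
rewrite -[X in arcsB _ _ X]/(W l r l' r') WE in uW' uW2 *.
by rewrite Jpq // /arcsB arcs_cat // arcs_cat2.
Qed.
End Class.

(* J is the class of a graph with dotted edges from x to y and from p to q, as
   a function of the underlying tree. *)
Lemma arcs_identity (J : utree L -> V) T x y p q :
  (forall A B, J (A, B) = J (B, A)) ->
  (forall A B D, J (Node A B, D) = J (A, Node B D)) ->
  (forall l, lie_function (fun D => J (Leaf l, D))) ->
  (forall u1 a u2, uniq (x :: rcons (u1 ++ p :: a ++ q :: u2) y) ->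
     J (Leaf x, comb (u1 ++ p :: a ++ q :: u2) (Leaf y)) = F a (u2 ++ u1)) ->
  (forall u1 a u2, uniq (x :: rcons (u1 ++ q :: a ++ p :: u2) y) ->
     J (Leaf x, comb (u1 ++ q :: a ++ p :: u2) (Leaf y)) = - F a (u2 ++ u1)) ->
  (forall u1 a u2, uniq (p :: rcons (u1 ++ x :: a ++ y :: u2) q) ->
     J (Leaf p, comb (u1 ++ x :: a ++ y :: u2) (Leaf q)) = F a (u2 ++ u1)) ->
  (forall u1 a u2, uniq (q :: rcons (u1 ++ x :: a ++ y :: u2) p) ->
     J (Leaf q, comb (u1 ++ x :: a ++ y :: u2) (Leaf p)) = - F a (u2 ++ u1)) ->
  uniq [:: x; y; p; q] -> uniq (uleaves T) ->
  {subset [:: x; y; p; q] <= uleaves T} ->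
  path_sum x y (arcsB p q) T + path_sum p q (arcsB x y) T = J T *+ 3.
Proof.
move=> J_swap J_rotate J_lie Jxy Jyx Jp Jq.
rewrite /= !inE !negb_or andbT => /and3P[/and3P[xy xp xq] /andP[yp yq] pq] uT sT.
have [xT yT pT qT] : [/\ x \in uleaves T, y \in uleaves T, p \in uleaves T
    & q \in uleaves T].
  by split; apply: sT; rewrite !inE eqxx ?orbT.
(* The defect is itself invariant under re-rooting and a Lie function, so it vanishes once it does
   on the combs from [x] to [y]. *)
pose Z S := path_sum x y (arcsB p q) S + path_sum p q (arcsB x y) S - J S *+ 3.
apply/eqP; rewrite -subr_eq0 -/(Z T); apply/eqP.
have [D [JD DP]] := reroot xT.
rewrite (JD _ Z); last 2 first.
- by move=> A B; rewrite /Z J_swap !(path_sum_swap _ _ _ A).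
- by move=> A B E; rewrite /Z J_rotate !path_sum_rotate.
have Z_lie : lie_function (fun D => Z (Leaf x, D)).
  have [J1 J2] := J_lie x.
  have [P1 P2] := wsum_lie_function (fun u => cpick x (ends_with y (arcsB p q)) (x :: u)).
  have [Q1 Q2] := wsum_lie_function (fun u => cpick p (ends_with q (arcsB x y)) (x :: u)).
  split=> [c A B|c A B E].
    rewrite /Z /path_sum /uwsum /= P1 Q1 J1 mulNrn; zmod.
  rewrite /Z /path_sum /uwsum /= P2 Q2 J2 mulrnBl; zmod.
have uxD : uniq (x :: leaves D) by rewrite -(perm_uniq DP).
have [xD uD] : x \notin leaves D /\ uniq (leaves D) by apply/andP.
have yD : y \in leaves D.
  by move: yT; rewrite (perm_mem DP) inE eq_sym (negPf xy).
rewrite (lie_function_psum Z_lie uD yD).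
rewrite (eq_psum_perm (g := fun=> 0)) => [|w wD].
  by rewrite psumE -[RHS](wsum0 V D); apply: eq_wsum => -[|l w] //=; case: ifP.
have wT : perm_eq (x :: rcons w y) (uleaves T).
  by rewrite perm_sym (perm_trans DP) // perm_cons perm_sym.
have uw' : uniq (x :: rcons w y) by rewrite (perm_uniq wT).
have uw : uniq w by move: uw'; rewrite cons_uniq rcons_uniq => /and3P[].
have memw z : z != x -> z != y -> z \in uleaves T -> z \in w.
  by move=> zx zy; rewrite -(perm_mem wT) inE mem_rcons inE (negPf zx) (negPf zy).
have pw : p \in w by apply: memw; rewrite // eq_sym.
have qw : q \in w by apply: memw; rewrite // eq_sym.
apply/eqP; rewrite subr_eq0; apply/eqP.
have [u1 [a [u2 [] wE]]] := uniq_pair_split uw pw qw pq; rewrite wE in uw' *.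
  apply: arcs_identity_comb; rewrite ?Jxy //.
  by rewrite /uleaves /= leaves_comb cats1.
(* Here [q] comes before [p]. Reversing that dotted edge changes the sign of [J] and of both path
   sums, which reduces to the previous case with [p] and [q] exchanged. *)
pose J' S := - J S; set T' := (_, _).
have T'T : perm_eq (uleaves T') (uleaves T).
  by rewrite -(permPr wT) wE /uleaves /= leaves_comb cats1.
have uT' : uniq (uleaves T') by rewrite (perm_uniq T'T).
have J'_swap A B : J' (A, B) = J' (B, A) by rewrite /J' J_swap.
have J'_rotate A B E : J' (Node A B, E) = J' (A, Node B E) by rewrite /J' J_rotate.
have J'_lie l : lie_function (fun D => J' (Leaf l, D)).
  have [J1 J2] := J_lie l.
  split=> [c A B|c A B E]; rewrite /J'; first by rewrite J1.
  by rewrite J2 opprB; zmod.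
have := @arcs_identity_comb J' J'_swap J'_rotate J'_lie x y q p u1 a u2.
rewrite -/T' => /(_ _ uT' _); rewrite {1}/J' Jyx // opprK => /(_ erefl).
have Jq' u1' a' u2' : uniq (q :: rcons (u1' ++ x :: a' ++ y :: u2') p) ->
    J' (Leaf q, comb (u1' ++ x :: a' ++ y :: u2') (Leaf p)) = F a' (u2' ++ u1').
  by move=> U; rewrite /J' Jq // opprK.
move/(_ Jq'); rewrite path_sum_comb // [path_sum x y (arcsB p q) _]path_sum_comb //.
rewrite path_sum_arcsB_rev //; last first.
- by move=> z /sT; rewrite (perm_mem T'T).
- by rewrite /= !inE !negb_or xy xp xq yp yq pq.
rewrite arcsB_anti /J' mulNrn => /eqP; rewrite -opprD eqr_opp => /eqP.
by move=> ->; rewrite [J T']Jyx.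
Qed.
End KeyIdentity.
End Reversal.

(** * From AS and IHX to the Lie identities at any depth *)

Section LieClass.
Variables (L : eqType) (V : zmodType) (J : utree L -> V).
Implicit Types (A B D E : btree L).
Hypothesis J_swap : forall A B, J (A, B) = J (B, A).
Hypothesis J_rotate : forall A B D, J (Node A B, D) = J (A, Node B D).
Hypothesis J_anti : forall A B D, J (Node A B, D) = - J (Node B A, D).
Hypothesis J_IHX : forall A B D E,
  J (Node A B, Node D E) + J (Node B D, Node A E) + J (Node D A, Node B E) = 0.

(** The relations are given at the root edge only. [comb_lcomb] moves the prefix to the other side
    together with [E], so that the bracket in question sits at the root. *)
Lemma class_lie_function E : lie_function (fun D => J (E, D)).
Proof.
split=> [p A B|p A B D]; rewrite !comb_lcomb //; set F := lcomb E p.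
  by rewrite ![J (F, _)]J_swap J_anti.
have := J_IHX A B D F; rewrite ![J (F, _)]J_swap -!J_rotate.
rewrite [J (Node A (Node B D), F)]J_anti [J (Node B (Node A D), F)]J_anti.
rewrite [J (Node (Node D A) B, F)]J_rotate [J (Node D A, _)]J_anti -J_rotate.
by rewrite -addrA => /eqP; rewrite addr_eq0 => /eqP ->; zmod.
Qed.

(** Seen from the other end every hair lies on the other side of the path, which costs one AS sign
    per letter. *)
Lemma class_rev x y w : J (Leaf x, comb w (Leaf y)) =
  J (Leaf y, comb (rev w) (Leaf x)) *~ (-1) ^+ size w.
Proof.
have rev_lcomb p : J (Leaf y, comb p (lcomb (Leaf x) w)) =
    J (Leaf y, comb (p ++ rev w) (Leaf x)) *~ (-1) ^+ size w.
  elim/last_ind: w p => [|w v IH] p; first by rewrite cats0.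
  rewrite /lcomb -cats1 foldl_cat cats1 /= -/(lcomb _ _).
  have [-> _] := class_lie_function (Leaf y).
  rewrite size_rcons exprS mulN1r mulrNz rev_rcons -cat_rcons -IH -cats1.
  by rewrite comb_cat.
by rewrite comb_lcomb // J_swap; apply: (rev_lcomb [::]).
Qed.
End LieClass.

(** * Relations between classes of graphs *)

Section HairyGraphs.
Variables (H : vectType rat) (r n : nat).
Implicit Types (T : utree (vertex H)) (A B D E : btree (vertex H)).
Implicit Types (G : hairy_graph H r n).

Lemma raw_class_valid T (TP : is_hairy_graph r n T) :
  raw_class r n T = graph_class (HairyGraph TP).
Proof. by rewrite -raw_class_hg. Qed.

Lemma raw_class_invalid T : ~~ is_hairy_graph r n T -> raw_class r n T = 0.
Proof. by move=> TP; rewrite /raw_class insubN. Qed.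

(** Validity depends only on the degree and on the leaves up to order, and [raw_class] is 0 on
    invalid trees. Hence the relations below hold for arbitrary trees, as functions on all trees
    require. *)
Lemma is_hairy_graph_perm T T' : lie_degree T = lie_degree T' ->
  perm_eq (uleaves T) (uleaves T') -> is_hairy_graph r n T = is_hairy_graph r n T'.
Proof.
move=> dT /(perm_pmap (fun x : vertex H => if x is inr d then Some d else None)) P.
rewrite /is_hairy_graph dT /dot_ends (perm_uniq P) (perm_size P) (perm_all _ P).
by congr [&& _, _, _, _ & _]; apply: eq_all => d; apply: perm_mem.
Qed.

Lemma raw_class_swap A B : raw_class r n (A, B) = raw_class r n (B, A).
Proof.
have E : is_hairy_graph r n (A, B) = is_hairy_graph r n (B, A).
  by apply: is_hairy_graph_perm; [exact: addnC | exact/permEl/perm_catC].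
have [P|P] := boolP (is_hairy_graph r n (A, B)); last first.
  by rewrite !raw_class_invalid -?E.
have P' := P; rewrite E in P'; rewrite !raw_class_valid.
by apply/eqP; rewrite -subr_eq0 -linearB; apply/eqP/graph_relE/rel_swap.
Qed.

Lemma raw_class_rotate A B D :
  raw_class r n (Node A B, D) = raw_class r n (A, Node B D).
Proof.
have E : is_hairy_graph r n (Node A B, D) = is_hairy_graph r n (A, Node B D).
  apply: is_hairy_graph_perm; first by rewrite /lie_degree /= addnS addSn addnA.
  by rewrite /uleaves /= catA.
have [P|P] := boolP (is_hairy_graph r n (Node A B, D)); last first.
  by rewrite !raw_class_invalid -?E.
have P' := P; rewrite E in P'; rewrite !raw_class_valid.
by apply/eqP; rewrite -subr_eq0 -linearB; apply/eqP/graph_relE/rel_rotate.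
Qed.

Lemma raw_class_anti A B D :
  raw_class r n (Node A B, D) = - raw_class r n (Node B A, D).
Proof.
have E : is_hairy_graph r n (Node A B, D) = is_hairy_graph r n (Node B A, D).
  apply: is_hairy_graph_perm; first by rewrite /lie_degree /= (addnC (nodes A)).
  by rewrite /uleaves /= perm_cat2r; apply/permEl/perm_catC.
have [P|P] := boolP (is_hairy_graph r n (Node A B, D)); last first.
  by rewrite !raw_class_invalid -?E ?oppr0.
have P' := P; rewrite E in P'; rewrite !raw_class_valid.
by apply/eqP; rewrite -addr_eq0 -linearD; apply/eqP/graph_relE/rel_AS.
Qed.

Lemma raw_class_IHX A B D E : raw_class r n (Node A B, Node D E)
  + raw_class r n (Node B D, Node A E) + raw_class r n (Node D A, Node B E) = 0.
Proof.
have E1 : is_hairy_graph r n (Node A B, Node D E) = is_hairy_graph r n (Node B D, Node A E).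
  apply: is_hairy_graph_perm; rewrite /lie_degree /uleaves /=; first by clear; lia.
  by apply/permP => k; rewrite !count_cat; clear; lia.
have E2 : is_hairy_graph r n (Node A B, Node D E) = is_hairy_graph r n (Node D A, Node B E).
  apply: is_hairy_graph_perm; rewrite /lie_degree /uleaves /=; first by clear; lia.
  by apply/permP => k; rewrite !count_cat; clear; lia.
have [P|P] := boolP (is_hairy_graph r n (Node A B, Node D E)); last first.
  by rewrite !raw_class_invalid -?E1 -?E2 ?addr0.
have P1 := P; have P2 := P; rewrite E1 in P1; rewrite E2 in P2.
rewrite !raw_class_valid -!linearD; apply/graph_relE/rel_IHX; reflexivity.
Qed.
End HairyGraphs.

Section Relabelling.
Variables (H : vectType rat) (r n : nat).
Implicit Types (T : utree (vertex H)) (A B D E : btree (vertex H)).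

(** A common form of [rename_dot] and [reverse_dot], so that validity is checked once for both. *)
Definition relabel (f : nat -> nat) (h : nat -> bool) (x : vertex H) : vertex H :=
  if x is inr (j, b) then inr (f j, b (+) h j) else x.

Lemma mem_dot_ends d T : (d \in dot_ends T) = (inr d \in uleaves T).
Proof.
rewrite /dot_ends; elim: (uleaves T) => //= -[v|e] s IH; rewrite inE IH //.
Qed.

Lemma dot_ends_relabel f h T : dot_ends (umap (relabel f h) T) =
  [seq (f d.1, d.2 (+) h d.1) | d <- dot_ends T].
Proof.
rewrite /dot_ends uleaves_umap; elim: (uleaves T) => //= -[v|[j b]] s IH //=.
by rewrite IH.
Qed.

Lemma is_hairy_graph_relabel f h T :
  {in unzip1 (dot_ends T) &, injective f} ->
  is_hairy_graph r n (umap (relabel f h) T) = is_hairy_graph r n T.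
Proof.
move=> f_inj; rewrite /is_hairy_graph dot_ends_relabel lie_degree_umap size_map.
have mem1 d : d \in dot_ends T -> d.1 \in unzip1 (dot_ends T) by apply: map_f.
have g_inj : {in dot_ends T &, injective (fun d => (f d.1, d.2 (+) h d.1))}.
  move=> [i b] [j c] /mem1 iT /mem1 jT [/(f_inj _ _ iT jT) /= ij].
  by rewrite ij => /addIb->.
rewrite (map_inj_in_uniq g_inj) all_map; congr [&& _, _, _, _ & _].
apply: eq_in_all => d /mem1 dT /=; apply/mapP/idP => [[d' d'T []]|dT'].
  move/(f_inj _ _ dT (mem1 _ d'T)) => E; rewrite -E -addNb => /addIb E2.
  by rewrite E2 E -surjective_pairing.
by exists (d.1, ~~ d.2); rewrite //= addNb.
Qed.

Lemma raw_class_rename_dot f T :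
  {in unzip1 (dot_ends T) &, injective f} ->
  raw_class r n (umap (rename_dot f) T) = raw_class r n T.
Proof.
move=> f_inj; have E : umap (rename_dot f) T = umap (relabel f xpred0) T.
  by apply: eq_umap => -[v|[j b]] //=; rewrite addbF.
have [P|P] := boolP (is_hairy_graph r n T).
  by apply: raw_class_rename; rewrite // E is_hairy_graph_relabel.
by rewrite !raw_class_invalid // E is_hairy_graph_relabel.
Qed.

Lemma raw_class_reverse_dot i T : (i, false) \in dot_ends T ->
  raw_class r n (umap (reverse_dot i) T) = - raw_class r n T.
Proof.
move=> iT; have E : umap (reverse_dot i) T = umap (relabel id (pred1 i)) T.
  by apply: eq_umap => -[v|[j b]] //=; case: eqP => _; rewrite ?addbT ?addbF.
have [P|P] := boolP (is_hairy_graph r n T).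
  by apply: raw_class_reverse; rewrite // E is_hairy_graph_relabel // => ? ?.
by rewrite !raw_class_invalid ?oppr0 // E is_hairy_graph_relabel // => ? ?.
Qed.
End Relabelling.

(** * Classes modulo (C1), (C2) and (C3) *)

Section OmegaClass.
Variables (H : vectType rat) (r n : nat).
Implicit Types (T : utree (vertex H)) (A B D E : btree (vertex H)).

Definition omega_class T : omega_space H r n :=
  lproj (@omega_rel H r n) (raw_class r n T).

Lemma omega_relE x : omega_rel x -> lproj (@omega_rel H r n) x = 0.
Proof.
move=> Rx; rewrite -(linear0 (lproj _)); apply/lproj_eq.
by rewrite subr0; apply: lspan_gen.
Qed.

Lemma omega_class_swap A B : omega_class (A, B) = omega_class (B, A).
Proof. by rewrite /omega_class raw_class_swap. Qed.

Lemma omega_class_rotate A B D :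
  omega_class (Node A B, D) = omega_class (A, Node B D).
Proof. by rewrite /omega_class raw_class_rotate. Qed.

Lemma omega_class_anti A B D :
  omega_class (Node A B, D) = - omega_class (Node B A, D).
Proof. by rewrite /omega_class raw_class_anti linearN. Qed.

Lemma omega_class_IHX A B D E : omega_class (Node A B, Node D E)
  + omega_class (Node B D, Node A E) + omega_class (Node D A, Node B E) = 0.
Proof. by rewrite /omega_class -!linearD raw_class_IHX linear0. Qed.

Lemma omega_class_lie E : lie_function (fun D => omega_class (E, D)).
Proof.
exact: (class_lie_function omega_class_swap omega_class_rotate
  omega_class_anti omega_class_IHX).
Qed.

Lemma omega_class_comb_anti E p A B :
  omega_class (E, comb p (Node A B)) = - omega_class (E, comb p (Node B A)).
Proof. by have [E_anti _] := omega_class_lie E; apply: E_anti. Qed.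

Lemma omega_class_comb_jacobi E p A B D :
  omega_class (E, comb p (Node (Node A B) D)) =
  omega_class (E, comb p (Node A (Node B D)))
  - omega_class (E, comb p (Node B (Node A D))).
Proof. by have [_ E_jacobi] := omega_class_lie E; apply: E_jacobi. Qed.

Lemma omega_class_invalid T : ~~ is_hairy_graph r n T -> omega_class T = 0.
Proof. by move=> TP; rewrite /omega_class raw_class_invalid // linear0. Qed.

Lemma omega_class_reverse_dot i T : (i, false) \in dot_ends T ->
  omega_class (umap (reverse_dot i) T) = - omega_class T.
Proof. by move=> iT; rewrite /omega_class raw_class_reverse_dot // linearN. Qed.

Lemma omega_class_rename_dot f T : {in unzip1 (dot_ends T) &, injective f} ->
  omega_class (umap (rename_dot f) T) = omega_class T.
Proof. by move=> f_inj; rewrite /omega_class raw_class_rename_dot. Qed.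

(* The condition on D' holds when dot_tgt i is a leaf of D. *)
Lemma omega_class_slide (i : nat) (v : H) D
    (D' := bsubst (inr (i, true)) (Node (dot_tgt i) (hair v)) D) :
  perm_eq (leaves D') (inl v :: leaves D) ->
  omega_class (Node (hair v) (dot_src i), D) = omega_class (dot_src i, D').
Proof.
move=> D'P; have E : is_hairy_graph r n (Node (hair v) (dot_src i), D)
    = is_hairy_graph r n (dot_src i, D').
  apply: is_hairy_graph_perm.
    have := perm_size D'P; rewrite /= !size_leaves => -[dE].
    by rewrite /lie_degree /= dE.
  rewrite /uleaves /= perm_sym.
  apply: (@perm_trans _ (inr (i, false) :: inl v :: leaves D)).
    by rewrite perm_cons.
  by apply/permP => k /=; rewrite addnCA.
have [P|P] := boolP (is_hairy_graph r n (Node (hair v) (dot_src i), D)); last first.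
  by rewrite !omega_class_invalid -?E.
have P' := P; rewrite E in P'; rewrite /omega_class !raw_class_valid.
by apply/eqP; rewrite -subr_eq0 -linearB; apply/eqP/omega_relE/omega_slide.
Qed.
End OmegaClass.

(** * Theta graphs *)

Section Theta.
Variables (H : vectType rat) (n : nat).
Implicit Types (T : utree (vertex H)) (A B D E : btree (vertex H)).
Implicit Types (w : seq (vertex H)) (a b c u z : seq H).

Notation hairs := (@map _ (vertex H) inl).
Notation cls := (@omega_class H 2 n).

Lemma bsubst_comb (l : vertex H) B w D : l \notin w ->
  bsubst l B (comb w D) = comb w (bsubst l B D).
Proof.
elim: w => //= k w IH; rewrite inE negb_or => /andP[lk lw].
by rewrite eq_sym (negPf lk) IH.
Qed.

(** (C2) makes the word along a dotted edge cyclic. In combs the hair lies on the opposite side from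
    the slide relation at both ends, so two AS signs appear and cancel. *)
Lemma omega_class_cut_move r i (v : H) w : inr (i, true) \notin w ->
  omega_class r n (dot_src i, comb (inl v :: w) (dot_tgt i)) =
  omega_class r n (dot_src i, comb (rcons w (inl v)) (dot_tgt i)).
Proof.
move=> iw; rewrite /= -omega_class_rotate omega_class_anti.
rewrite omega_class_slide ?bsubst_comb //= eqxx; last first.
  by rewrite !leaves_comb /= -cat_rcons !cats1 perm_rcons.
rewrite omega_class_comb_anti.
by rewrite opprK -cats1 comb_cat.
Qed.

Lemma omega_class_cut_cat r i a w : inr (i, true) \notin w ->
  omega_class r n (dot_src i, comb (hairs a ++ w) (dot_tgt i)) =
  omega_class r n (dot_src i, comb (w ++ hairs a) (dot_tgt i)).
Proof.
elim: a w => [|v a IH] w iw; first by rewrite cats0.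
rewrite [map _ _]/= cat_cons omega_class_cut_move; last first.
  by rewrite mem_cat negb_or iw andbT; apply/negP=> /mapP[].
by rewrite rcons_cat IH ?cat_rcons // mem_rcons inE.
Qed.

(* The class of the circle p a q b with one dotted edge between b and p and
   one dotted chord from p to q. *)
Definition theta_word i a b : seq (vertex H) :=
  inr (i, false) :: hairs a ++ inr (i, true) :: hairs b.

Definition theta a b := cls (dot_src 0, comb (theta_word 1 a b) (dot_tgt 0)).

Lemma dot_notin_hairs (d : nat * bool) a : (inr d \in hairs a : bool) = false.
Proof. by apply/negP=> /mapP[]. Qed.

Lemma thetaE a b u : cls (dot_src 0, comb (hairs u ++ inr (1, false) :: hairs a
    ++ inr (1, true) :: hairs b) (dot_tgt 0)) = theta a (b ++ u).
Proof.
rewrite omega_class_cut_cat; last first.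
  by rewrite inE /= mem_cat inE !dot_notin_hairs.
by rewrite /theta /theta_word map_cat /= -catA.
Qed.

(** By the Jacobi identity each difference is a single graph, with [v] grafted on the leg of the
    source, respectively of the target, of the chord; (C2) for the chord identifies them. *)
Lemma theta_slides : slides theta.
Proof.
move=> v w z; set Z := comb (hairs z) (dot_tgt 0).
have -> : theta w (rcons z v) - theta (v :: w) z = cls (dot_src 0,
    Node (Node (hair v) (dot_src 1)) (comb (hairs w) (Node (dot_tgt 1) Z))).
  rewrite -cats1 -[theta w _](thetaE w z [:: v]) /theta /= !comb_cat /=.
  by rewrite [RHS](@omega_class_comb_jacobi _ _ _ _ [::]).
have -> : theta w (v :: z) - theta (rcons w v) z = cls (dot_src 0,
    comb (inr (1, false) :: hairs w) (Node (Node (dot_tgt 1) (hair v)) Z)).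
  rewrite omega_class_comb_jacobi /theta /theta_word map_rcons -cats1 /=.
  by rewrite !comb_cat.
rewrite [LHS]omega_class_swap omega_class_rotate.
have nw (d : nat * bool) a : inr d \notin hairs a by rewrite dot_notin_hairs.
have E : bsubst (inr (1, true)) (Node (dot_tgt 1) (hair v))
    (Node (comb (hairs w) (Node (dot_tgt 1) Z)) (dot_src 0))
    = Node (comb (hairs w) (Node (Node (dot_tgt 1) (hair v)) Z)) (dot_src 0).
  by rewrite /= !bsubst_comb //= !bsubst_comb //=.
rewrite omega_class_slide E.
  by rewrite omega_class_swap omega_class_rotate omega_class_swap omega_class_rotate.
rewrite /= !leaves_comb /= leaves_comb -!catA /=; set t := _ ++ [:: _].
by rewrite -!cat_rcons perm_sym -cat1s perm_catCA /= !cat_rcons.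
Qed.

Lemma bmap_comb (L L' : eqType) (g : L -> L') (c : seq L) (D : btree L) :
  bmap g (comb c D) = comb (map g c) (bmap g D).
Proof. by elim: c => //= l c ->. Qed.

Lemma theta_names i j a b : i != j ->
  cls (dot_src i, comb (theta_word j a b) (dot_tgt i)) = theta a b.
Proof.
move=> ij; pose f k := if k == 0%N then i else j.
have mapf (g : vertex H -> vertex H) (c : seq H) :
    (forall v, g (inl v) = inl v) -> map g (hairs c) = hairs c.
  by move=> gE; rewrite -map_comp; apply: eq_map.
rewrite /theta -[RHS](@omega_class_rename_dot _ _ _ f).
  by rewrite /theta_word /umap /= !bmap_comb map_cat /= !mapf.
have dinl (c : seq H) s : pmap (fun x : vertex H => if x is inr d then Some d else None)
    (hairs c ++ s) = pmap (fun x : vertex H => if x is inr d then Some d else None) s.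
  by elim: c => //= v c ->.
rewrite /dot_ends /uleaves /= !leaves_comb /= -catA dinl /= dinl /=.
have f01 : f 0%N != f 1%N by [].
have mem01 k : k \in [:: 0; 1; 1; 0]%N -> k = (k != 0)%N :> nat.
  by rewrite !inE => /or4P[] /eqP->.
move=> k l /mem01 -> /mem01 ->; case: (k == 0%N); case: (l == 0%N) => //= /eqP E.
  by rewrite E in f01.
by rewrite eq_sym E in f01.
Qed.

(** Reading the comb backwards gives the sign and reverses both dotted edges; restoring their
    directions costs two signs, which cancel. *)
Lemma theta_rev a b :
  theta (rev a) (rev b) = theta a b *~ (-1) ^+ (size a + size b).
Proof.
have revh (c : seq H) : rev (hairs c) = hairs (rev c) by rewrite map_rev.
have E : theta a b = cls (dot_tgt 0,
    comb (hairs (rev b) ++ inr (1, true) :: hairs (rev a) ++ [:: inr (1, false)])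
    (dot_src 0)) *~ (-1) ^+ (size a + size b).
  rewrite /theta (class_rev (@omega_class_swap H 2 n) (@omega_class_rotate H 2 n)
    (@omega_class_anti H 2 n) (@omega_class_IHX H 2 n)).
  rewrite /theta_word rev_cons rev_cat rev_cons !revh cat_rcons -cats1.
  rewrite -!catA /=; congr (_ *~ _).
  rewrite -signr_odd -[RHS]signr_odd; congr (_ ^+ nat_of_bool _).
  by rewrite /= size_cat /= !size_map addnS /= negbK.
pose T := (dot_src 0, comb (hairs (rev b) ++ inr (1, false) :: hairs (rev a)
  ++ [:: inr (1, true)]) (dot_tgt 0)) : utree (vertex H).
have TE : cls T = theta (rev a) (rev b) by rewrite /T (thetaE (rev a) [::]).
have ET : umap (reverse_dot 0) (umap (reverse_dot 1) T) = (dot_tgt 0,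
    comb (hairs (rev b) ++ inr (1, true) :: hairs (rev a) ++ [:: inr (1, false)])
    (dot_src 0)).
  rewrite umap_comp /umap /= !bmap_comb map_cat /= map_cat /= -!map_comp.
  by rewrite !(@eq_map _ _ _ inl).
rewrite E -ET !omega_class_reverse_dot ?opprK ?TE; last 2 first.
- by rewrite mem_dot_ends /uleaves /= leaves_comb !(mem_cat, inE) eqxx !orbT.
- rewrite mem_dot_ends uleaves_umap; apply/mapP; exists (inr (0%N, false)) => //.
by rewrite -mulrzA -exprD addnn -signr_odd odd_double expr0 mulr1z.
Qed.
End Theta.

Lemma comb_sum_map (L L' : eqType) (V : zmodType) (h : L -> L') u
    (g : seq L' -> seq L' -> V) :
  comb_sum (map h u) g = comb_sum u (fun l r => g (map h l) (map h r)).
Proof.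
by elim: u g => //= v u IH g; rewrite IH; apply: eq_comb_sum => l r; rewrite map_rcons.
Qed.

Lemma comb_sum0 (L : eqType) (V : zmodType) (u : seq L) :
  comb_sum u (fun _ _ => 0) = 0 :> V.
Proof. by elim: u => //= v u IH; under eq_comb_sum do rewrite subrr; apply: IH. Qed.

Lemma perm_two_dots (L : eqType) (s t p q : L) a b :
  perm_eq (s :: (p :: a ++ q :: b) ++ [:: t]) [:: s, t, p, q & a ++ b].
Proof. by apply/permP => k; do 3! rewrite /= ?count_cat; lia. Qed.

(** * The tripod relation for theta graphs *)

Section Tripod.
Variables (H : vectType rat) (n : nat).
Implicit Types (T : utree (vertex H)) (A B D E : btree (vertex H)).
Implicit Types (w : seq (vertex H)) (a b c u z : seq H).

Notation hairs := (@map _ (vertex H) inl).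
Notation cls := (@omega_class H 2 n).

Definition two_dots (i j : nat) c : seq (vertex H) :=
  [:: inr (i, false), inr (i, true), inr (j, false), inr (j, true) & hairs c].

(** A tree has two more leaves than trivalent vertices, and here there are [size c + 4] leaves. *)
Lemma two_dots_valid i j c T : i != j -> perm_eq (uleaves T) (two_dots i j c) ->
  is_hairy_graph 2 n T = (n == size c + 2)%N.
Proof.
move=> ij TP; have := perm_size TP; rewrite size_cat !size_leaves /= size_map.
rewrite addSn addnS => -[dT].
have DP : perm_eq (dot_ends T) [:: (i, false); (i, true); (j, false); (j, true)].
  move: TP => /(perm_pmap (fun x : vertex H => if x is inr d then Some d else None)).
  by rewrite /= (_ : pmap _ (hairs c) = [::]) //; elim: (c).
rewrite /is_hairy_graph (perm_uniq DP) (perm_size DP) (perm_all _ DP).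
have ij' : j != i by rewrite eq_sym.
rewrite /= !(perm_mem DP) !inE !xpair_eqE !eqxx /= (negPf ij) (negPf ij') /= andbT.
by rewrite /lie_degree dT addn2 eq_sym; case: eqP => //= ->.
Qed.

(** Words of the wrong length give 0, so identities for [theta] need no condition on lengths. *)
Lemma theta_size a b : n != (size a + size b + 2)%N -> theta n a b = 0.
Proof.
move=> nab; apply: omega_class_invalid.
rewrite (@two_dots_valid 0 1 (a ++ b)) ?size_cat //.
by rewrite /uleaves /= leaves_comb /two_dots map_cat; apply: perm_two_dots.
Qed.

Lemma bsubst_hairs (d : nat * bool) B c D :
  bsubst (inr d) B (comb (hairs c) D) = comb (hairs c) (bsubst (inr d) B D).
Proof. by rewrite bsubst_comb // dot_notin_hairs. Qed.

(** In (C3) the second tree has one vertex from which three arms lead to the ends 2, 1 and 0, with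
    hairs [a], none and [z]. Making the arc of 2 or of 0 solid gives a theta word at once; for the
    bare arc the arm with [z] must be expanded. *)
Lemma theta_tripod a z :
  theta n a z + theta n z a + comb_sum z (fun l r => theta n r (a ++ l)) = 0.
Proof.
have [nE|nE] := eqVneq n (size a + size z + 2)%N; last first.
  rewrite !theta_size ?add0r //; last by rewrite [(size z + _)%N]addnC.
  rewrite -[RHS](comb_sum0 _ z); apply: eq_comb_sum_perm => l r /perm_size.
  rewrite size_cat => lr; rewrite theta_size // size_cat.
  by apply: contra nE => /eqP ->; rewrite -lr [X in _ == (X + _)%N]addnA addnC
    [(size r + _)%N]addnC addnC.
pose G1 : utree (vertex H) := (Node (dot_src 1) (dot_src 0),
  comb (hairs a) (Node (dot_tgt 1) (comb (hairs z) (dot_tgt 0)))).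
pose G2 : utree (vertex H) := (dot_tgt 2, comb (hairs a)
  (Node (Node (dot_src 0) (dot_src 2)) (comb (hairs z) (dot_tgt 0)))).
pose G3 : utree (vertex H) := (dot_tgt 2, comb (hairs a)
  (Node (dot_tgt 1) (comb (hairs z) (Node (dot_src 2) (dot_src 1))))).
have G123 : cls G1 + cls G2 + cls G3 = 0.
  have V1 : is_hairy_graph 2 n G1.
    have P (s t p q : vertex H) (x y : seq (vertex H)) :
        perm_eq ([:: p, s & x ++ q :: y ++ [:: t]]) [:: s, t, p, q & x ++ y].
      by apply/permP => k; do 3! rewrite /= ?count_cat; clear; lia.
    rewrite (@two_dots_valid 0 1 (a ++ z)) ?size_cat ?nE //.
    by rewrite /uleaves; do 3! rewrite /= ?leaves_comb; rewrite /two_dots map_cat; apply: P.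
  have V2 : is_hairy_graph 2 n G2.
    have P (s t p q : vertex H) (x y : seq (vertex H)) :
        perm_eq (q :: x ++ [:: s, p & y ++ [:: t]]) [:: s, t, p, q & x ++ y].
      by apply/permP => k; do 3! rewrite /= ?count_cat; clear; lia.
    rewrite (@two_dots_valid 0 2 (a ++ z)) ?size_cat ?nE //.
    by rewrite /uleaves; do 3! rewrite /= ?leaves_comb; rewrite /two_dots map_cat; apply: P.
  have V3 : is_hairy_graph 2 n G3.
    have P (s t p q : vertex H) (x y : seq (vertex H)) :
        perm_eq (t :: x ++ q :: y ++ [:: s; p]) [:: s, t, p, q & x ++ y].
      by apply/permP => k; do 3! rewrite /= ?count_cat; clear; lia.
    rewrite (@two_dots_valid 2 1 (a ++ z)) ?size_cat ?nE //.
    by rewrite /uleaves; do 3! rewrite /= ?leaves_comb; rewrite /two_dots map_cat; apply: P.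
  rewrite /omega_class -!linearD !raw_class_valid; apply: omega_relE.
  pose T : utree (vertex H) := (dot_tgt 2, comb (hairs a)
    (Node (dot_tgt 1) (comb (hairs z) (dot_tgt 0)))).
  apply: (@omega_tripod H 2 n _ _ _ 2 1 0 T) => //=.
  - move=> d; rewrite !mem_dot_ends /uleaves /= !leaves_comb /= leaves_comb.
    by rewrite !inE => /or3P[] /eqP->; rewrite !(mem_cat, inE) eqxx ?orbT.
  - by do 3! rewrite /usubst /= ?bsubst_hairs.
  - by do 3! rewrite /usubst /= ?bsubst_hairs.
  - by do 3! rewrite /usubst /= ?bsubst_hairs.
have G1E : cls G1 = - theta n a z.
  rewrite omega_class_rotate omega_class_swap omega_class_rotate.
  by rewrite (@omega_class_comb_anti _ _ _ _ [::]) /theta /= comb_cat.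
have mapr i c : map (@reverse_dot H i) (hairs c) = hairs c.
  by rewrite -map_comp; apply: eq_map.
have chord i j b c : i != j ->
    cls (dot_src i, comb (hairs b ++ inr (j, false) :: hairs c ++ [:: inr (j, true)])
      (dot_tgt i)) = theta n c b.
  move=> ij; rewrite omega_class_cut_cat; last first.
    apply/negP; rewrite inE mem_cat inE dot_notin_hairs /= => /orP[/eqP[]|/eqP[E]] //.
    by rewrite E eqxx in ij.
  by rewrite -(theta_names n c b ij) /theta_word cat_cons -catA.
have G3E : cls G3 = - theta n z a.
  have -> : G3 = (dot_tgt 2, comb (hairs a ++ inr (1, true) :: hairs z)
      (Node (dot_src 2) (dot_src 1))) by rewrite /G3 comb_cat.
  rewrite omega_class_comb_anti -(chord 2%N 1%N) //; congr (- _).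
  set T3 := (dot_src 2, _).
  have -> : (dot_tgt 2, comb (hairs a ++ inr (1, true) :: hairs z)
      (Node (dot_src 1) (dot_src 2))) = umap (reverse_dot 2) (umap (reverse_dot 1) T3).
    rewrite umap_comp /umap /= !bmap_comb map_cat /= map_cat /= -!map_comp.
    by rewrite !(@eq_map _ _ _ inl) // !comb_cat /= comb_cat.
  rewrite !omega_class_reverse_dot ?opprK //.
  by rewrite mem_dot_ends /uleaves /= leaves_comb !(mem_cat, inE) eqxx !orbT.
have G2E : cls G2 = - comb_sum z (fun l r => theta n r (a ++ l)).
  pose C := comb (hairs z) (dot_tgt 0).
  pose T2 : utree (vertex H) := (dot_src 2, comb (hairs a)
    (Node (Node (dot_src 0) (dot_tgt 2)) C)).
  have -> : G2 = umap (reverse_dot 2) T2.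
    by rewrite /G2 /umap /= !bmap_comb /= !bmap_comb !mapr.
  rewrite omega_class_reverse_dot ?mem_dot_ends //; congr (- _).
  (* Turned to the left, the branch [C] acts through its expansion around [dot_tgt 0], and each word
     of it closes up to a theta graph. *)
  rewrite omega_class_comb_anti.
  rewrite (lie_function_comb _ _ _ (omega_class_lie 2 n (dot_src 2))).
  rewrite wsum_comb_leaf comb_sum_map.
  have comb_sumN (g : seq H -> seq H -> omega_space H 2 n) :
      - comb_sum z g = comb_sum z (fun l r => - g l r).
    by rewrite -sub0r -(comb_sum0 _ z) -comb_sumB; apply: eq_comb_sum => l r; rewrite sub0r.
  rewrite comb_sumN; apply: eq_comb_sum => l r.
  rewrite -(chord 2%N 0%N) //; set T4 := (dot_src 2, _ : btree _).
  rewrite -(@omega_class_reverse_dot _ _ _ 0); last first.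
    by rewrite mem_dot_ends /uleaves /= leaves_comb !(mem_cat, inE) eqxx !orbT.
  rewrite /T4 /umap /= bmap_comb; do 3! rewrite /= ?map_cat.
  by rewrite !mapr -!catA !comb_cat /= comb_cat.
by apply: oppr_inj; rewrite oppr0 -G123 G1E G2E G3E; zmod.
Qed.
End Tripod.

(** * Sums under relabelling, substitution and linear combination *)

Section MoreSums.
Variable V : zmodType.

Lemma wsum_bmap (L L' : eqType) (h : L -> L') A (f : seq L' -> V) :
  wsum (bmap h A) f = wsum A (fun u => f (map h u)).
Proof.
elim: A f => //= A IHA B IHB f; rewrite IHA; apply: eq_wsum => a.
by rewrite IHB; apply: eq_wsum => b; rewrite !map_cat.
Qed.

Lemma uwsum_umap (L L' : eqType) (h : L -> L') T (f : seq L' -> V) :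
  uwsum (umap h T) f = uwsum T (fun u => f (map h u)).
Proof.
rewrite /uwsum wsum_bmap; apply: eq_wsum => a; rewrite wsum_bmap.
by apply: eq_wsum => b; rewrite map_cat.
Qed.

Lemma splitsum_map (L L' : eqType) (h : L -> L') (w : seq L)
    (G : seq L' -> L' -> seq L' -> V) :
  splitsum G (map h w) = splitsum (fun a l b => G (map h a) (h l) (map h b)) w.
Proof. by elim: w G => //= l w IH G; rewrite IH. Qed.

Lemma cycsum_map (L L' : eqType) (h : L -> L') (w : seq L) (k : L' -> seq L' -> V) :
  cycsum k (map h w) = cycsum (fun l s => k (h l) (map h s)) w.
Proof.
rewrite /cycsum splitsum_map; apply: eq_splitsum => a l b _.
by rewrite map_cat.
Qed.

End MoreSums.

Lemma bsubst_notin (L : choiceType) (l : L) B A :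
  l \notin leaves A -> bsubst l B A = A.
Proof.
elim: A => [k|A1 IH1 A2 IH2] /=; first by rewrite inE eq_sym => /negPf->.
by rewrite mem_cat negb_or => /andP[/IH1-> /IH2->].
Qed.

(** Of the two terms of [y,v] = yv - vy only the second ends in [y]. *)
Lemma psum_slide (L : choiceType) (V : zmodType) (y v : L) D (f : seq L -> V) :
  count_mem y (leaves D) = 1%N -> v != y ->
  psum y (bsubst y (Node (Leaf y) (Leaf v)) D) f =
  - psum y D (fun w => f (rcons w v)).
Proof.
move=> yD vy; elim: D f yD => [l|A IHA B IHB] f /=.
  by rewrite addn0; case: (l =P y) => // _ _; rewrite /= eqxx (negPf vy) sub0r.
rewrite count_cat => yAB.
have [yA|yA] := boolP (y \in leaves A).
  have yA0 : count_mem y (leaves A) <> 0%N by move/count_memPn; rewrite yA.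
  have [yA1 /count_memPn yB] :
      count_mem y (leaves A) = 1%N /\ count_mem y (leaves B) = 0%N.
    by move: yA0 yAB; case: (count_mem y _) => [|[|k]] // _ [].
  rewrite (bsubst_notin _ yB).
  rewrite (eq_wsum _ (g := fun=> 0)) => [|a]; last exact: psum_notin.
  rewrite [in RHS](eq_wsum _ (g := fun=> 0)) => [|a]; last exact: psum_notin.
  rewrite !wsum0 !sub0r; congr (- _); rewrite -wsumN; apply: eq_wsum => b.
  by rewrite IHA //; congr (- _); apply: eq_psum => a; rewrite rcons_cat.
have yA1 : count_mem y (leaves A) = 0%N by apply/count_memPn.
rewrite (bsubst_notin _ yA).
rewrite [X in _ - X](eq_wsum _ (g := fun=> 0)) => [|a]; last exact: psum_notin.
rewrite [X in - (_ - X)](eq_wsum _ (g := fun=> 0)) => [|a]; last exact: psum_notin.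
rewrite !wsum0 !subr0 -wsumN; apply: eq_wsum => a.
rewrite IHB; last by rewrite -yAB yA1.
by congr (- _); apply: eq_psum => b; rewrite rcons_cat.
Qed.

Section LinearSums.
Variables (K : nzRingType) (V : lmodType K) (L : eqType).
Implicit Types (f g : seq L -> V) (G : seq L -> L -> seq L -> V).
Implicit Types (x y : L) (T : utree L).

Lemma wsumZ A k f : wsum A (fun u => k *: f u) = k *: wsum A f.
Proof.
elim: A f => //= A IHA B IHB f; rewrite -IHA; apply: eq_wsum => a.
by rewrite -IHB; apply: eq_wsum => b; rewrite scalerBr.
Qed.

Lemma splitsum_linear k G G1 G2 w :
  (forall a l b, w = a ++ l :: b -> G a l b = k *: G1 a l b + G2 a l b) ->
  splitsum G w = k *: splitsum G1 w + splitsum G2 w.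
Proof.
elim: w G G1 G2 => [|l w IH] G G1 G2 GE /=; first by rewrite scaler0 addr0.
rewrite GE // (IH _ (fun a => G1 (l :: a)) (fun a => G2 (l :: a))).
  by rewrite scalerDr; zmod.
by move=> a m b wE; apply: GE; rewrite wE.
Qed.

Lemma splitsum_sum (I : finType) (G : I -> seq L -> L -> seq L -> V) w :
  splitsum (fun a l b => \sum_i G i a l b) w = \sum_i splitsum (G i) w.
Proof.
elim: w G => [|l w IH] G /=; first by rewrite big1.
by rewrite (IH (fun i a => G i (l :: a))) -big_split.
Qed.

Lemma splitsumZ k G w : splitsum (fun a l b => k *: G a l b) w = k *: splitsum G w.
Proof.
by elim: w G => [|l w IH] G /=; rewrite ?scaler0 // IH scalerDr.
Qed.

Lemma path_sum_linear x y k f g T :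
  path_sum x y (fun w => k *: f w + g w) T = k *: path_sum x y f T + path_sum x y g T.
Proof.
rewrite /path_sum /uwsum -wsumZ -wsumD; apply: eq_wsum => a.
rewrite -wsumZ -wsumD; apply: eq_wsum => b; apply: splitsum_linear => c l d _.
case: eqP => _; rewrite ?scaler0 ?addr0 //.
by case: (d ++ c) => [|v s] /=; rewrite ?scaler0 ?addr0 //; case: eqP;
  rewrite ?scaler0 ?addr0.
Qed.

Lemma path_sum0 x y T : path_sum x y (fun=> 0 : V) T = 0.
Proof.
rewrite (@eq_path_sum _ _ x y _ (fun=> -1 *: 0 + 0)) => [|w _]; last first.
  by rewrite scaler0 addr0.
by rewrite path_sum_linear scaleN1r addNr.
Qed.

Lemma path_sum_sum (J : finType) x y (k : J -> K) (f : J -> seq L -> V) T :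
  path_sum x y (fun w => \sum_j k j *: f j w) T = \sum_j k j *: path_sum x y (f j) T.
Proof.
elim: (index_enum J) => [|j r IH].
  rewrite big_nil -[RHS](path_sum0 x y T); apply: eq_path_sum => w _.
  by rewrite big_nil.
rewrite big_cons -IH -path_sum_linear; apply: eq_path_sum => w _.
by rewrite big_cons.
Qed.
End LinearSums.

Section OmegaLinear.
Variables (H : vectType rat) (r n : nat).

Lemma omega_class_linear k (u v : H) D :
  omega_class r n (hair (k *: u + v), D) =
  k *: omega_class r n (hair u, D) + omega_class r n (hair v, D).
Proof.
have E x y : is_hairy_graph r n (hair x, D) = is_hairy_graph r n (hair y, D) by [].
have [P|P] := boolP (is_hairy_graph r n (hair u, D)); last first.
  by rewrite !omega_class_invalid ?scaler0 ?addr0 //.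
have Pv := P; have Ps := P; rewrite (E _ v) in Pv; rewrite (E _ (k *: u + v)) in Ps.
rewrite /omega_class -linearP !raw_class_valid; congr (lproj _ _).
apply/eqP; rewrite -subr_eq0 /graph_class -linearP -linearB; apply/eqP/graph_relE.
by apply: rel_linear; reflexivity.
Qed.
End OmegaLinear.

(** * The map Phi *)

Section Phi.
Variables (H : vectType rat) (omega : {skew_symmetric H}) (n : nat).
Implicit Types (a b c w z : seq H).

Notation hairs := (@map _ (vertex H) inl).
Notation W := (omega_space H 2 n).

Definition multilinear (f : seq H -> W) := forall s t k u v,
  f (s ++ (k *: u + v) :: t) = k *: f (s ++ u :: t) + f (s ++ v :: t).

(** Linearity is given for a hair at the root only, so the tree is re-rooted at the hair in
    question. *)
Lemma cls_multilinear E s t D k (u v : H) :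
  omega_class 2 n (E, comb (s ++ inl (k *: u + v) :: t) D) =
  k *: omega_class 2 n (E, comb (s ++ inl u :: t) D)
  + omega_class 2 n (E, comb (s ++ inl v :: t) D).
Proof.
have tilt x : omega_class 2 n (E, comb (s ++ inl x :: t) D) =
    omega_class 2 n (hair x, Node (comb t D) (lcomb E s)).
  rewrite comb_cat (comb_lcomb _ _ _ (@omega_class_rotate H 2 n)) /=.
  by rewrite omega_class_swap omega_class_rotate.
by rewrite !tilt omega_class_linear.
Qed.

Lemma theta_linearl b : multilinear ((theta n)^~ b).
Proof.
move=> s t k u v; rewrite /theta /theta_word !map_cat /=.
have := cls_multilinear (dot_src 0) (inr (1, false) :: hairs s)
  (hairs t ++ inr (1, true) :: hairs b) (dot_tgt 0) k u v.
by rewrite /= -!catA.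
Qed.

Lemma theta_linearr a : multilinear (theta n a).
Proof.
move=> s t k u v; rewrite /theta /theta_word !map_cat /=.
have := cls_multilinear (dot_src 0) (inr (1, false) :: hairs a ++ inr (1, true) :: hairs s)
  (hairs t) (dot_tgt 0) k u v.
by rewrite /= -!catA.
Qed.

(* The value of Phi on the circle which carries the hairs w and one dotted
   edge: a second dotted edge is added as a chord between any two hairs. *)
Definition phi w : W := cycsum (fun p s =>
  splitsum (fun c q d => omega p q *: theta n c d) s) w.

Lemma phi_rot : rot_inv phi.
Proof. exact: cycsum_rot. Qed.

Lemma phi_single v : phi [:: v] = 0.
Proof. by rewrite /phi /cycsum /= addr0. Qed.

Lemma phi_multilinear : multilinear phi.
Proof.
move=> s t k u v; rewrite ![phi (s ++ _)]phi_rot !cat_cons; set w := t ++ s.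
(* The varied hair is rotated to the front. [F1] collects the chords starting at it, [F2] those
   starting at another hair [p]; below, [F3] and [F4] are the parts of [F2] where it lies on the
   second or on the first arc. *)
pose F1 x := splitsum (fun c q d => omega x q *: theta n c d) w.
pose F2 x := splitsum (fun a p b =>
  splitsum (fun c q d => omega p q *: theta n c d) (b ++ x :: a)) w.
have phiE x : phi (x :: w) = F1 x + F2 x by rewrite /phi /cycsum /= cats0.
have F1E : F1 (k *: u + v) = k *: F1 u + F1 v.
  by apply: splitsum_linear => c q d _; rewrite linearPl /= scalerDl scalerA.
suff F2E : F2 (k *: u + v) = k *: F2 u + F2 v.
  by rewrite !phiE F1E F2E addrACA -scalerDr.
apply: splitsum_linear => a p b _.
pose F3 x := splitsum (fun c q d => omega p q *: theta n c (d ++ x :: a)) b.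
pose F4 x := splitsum (fun c q d => omega p q *: theta n (b ++ x :: c) d) a.
have FE x : splitsum (fun c q d => omega p q *: theta n c d) (b ++ x :: a) =
    F3 x + (omega p x *: theta n b a + F4 x).
  by rewrite splitsum_cat /= cats0.
have F3E : F3 (k *: u + v) = k *: F3 u + F3 v.
  apply: splitsum_linear => c q d _.
  by rewrite theta_linearr scalerDr !scalerA mulrC.
have F4E : F4 (k *: u + v) = k *: F4 u + F4 v.
  apply: splitsum_linear => c q d _.
  by rewrite (theta_linearl d b c) scalerDr !scalerA mulrC.
rewrite !FE F3E F4E linearPr /= scalerDl -scalerA !scalerDr.
by rewrite [RHS]addrACA; congr (_ + _); apply: addrACA.
Qed.

Definition hair_of (x : vertex H) : H := if x is inl v then v else 0.

Definition psi (x : vertex H) (s : seq (vertex H)) : W :=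
  if x is inr (i, false) then ends_with (inr (i, true)) (fun t => phi (map hair_of t)) s
  else 0.

(** As a cyclic sum over the expansion it respects change of root, AS and IHX for every tree,
    without reference to the position of the dotted edge. *)
Definition phi_tree (T : utree (vertex H)) : W := uwsum T (cycsum psi).

Lemma phi_tree_swap A B : phi_tree (A, B) = phi_tree (B, A).
Proof. exact/uwsum_swap/cycsum_rot. Qed.

Lemma phi_tree_rotate A B D : phi_tree (Node A B, D) = phi_tree (A, Node B D).
Proof. exact/uwsum_rotate/cycsum_rot. Qed.

Lemma phi_tree_linear k u v D : phi_tree (hair (k *: u + v), D) =
  k *: phi_tree (hair u, D) + phi_tree (hair v, D).
Proof.
rewrite /phi_tree /uwsum /= -wsumZ -wsumD; apply: eq_wsum => s.
rewrite /cycsum /= !add0r.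
apply: splitsum_linear => a l b _; case: l => [?|[i []]] /=; rewrite ?scaler0 ?addr0 //.
case/lastP: a => [|a l].
  by rewrite !cats1 !ends_with_rcons scaler0 addr0.
rewrite -!rcons_cons -!rcons_cat !ends_with_rcons; case: eqP; rewrite ?scaler0 ?addr0 //.
by rewrite !map_cat /= phi_multilinear.
Qed.

Lemma phi_tree_anti A B D : phi_tree (Node A B, D) = - phi_tree (Node B A, D).
Proof. exact: uwsum_anti. Qed.

Lemma phi_tree_root i D : (forall j, inr (j, false) \notin leaves D) ->
  phi_tree (dot_src i, D) =
  psum (inr (i, true)) D (fun t => phi (map hair_of t)).
Proof.
move=> nD; rewrite psumE /phi_tree /uwsum /=; apply: eq_wsum_perm => u uD.
rewrite /cycsum /= cats0 splitsum_eq0 ?addr0 // => a l b uE.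
case: l uE => [//|[j []] //] uE; case/negP: (nD j).
by rewrite -(perm_mem uD) uE mem_cat mem_head orbT.
Qed.

Section Skeleton.
Variable I : finType.
Implicit Types (S : utree I) (x y : I) (C : I -> H) (t : seq I).

(** Trees are labelled by positions, which stay distinct when colours coincide; [path_sum] follows
    positions. *)
Definition one_dot x y i C (l : I) : vertex H :=
  if l == x then inr (i, false) else if l == y then inr (i, true) else inl (C l).

Lemma phi_tree_one_dot x y i C S : uniq (uleaves S) -> x != y ->
  phi_tree (umap (one_dot x y i C) S) = path_sum x y (fun t => phi (map C t)) S.
Proof.
move=> uS xy; rewrite /phi_tree uwsum_umap; apply: eq_uwsum_perm => u uP.
have uu : uniq u by rewrite (perm_uniq uP).
rewrite cycsum_map; apply: eq_cycsum => l s lsP.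
have : uniq (l :: s) by rewrite (perm_uniq lsP).
rewrite /one_dot /psi /=; case: eqP => [->|_ _]; last by case: eqP.
case/lastP: s lsP => [//|s z] _; rewrite mem_rcons inE negb_or rcons_uniq.
case/and3P=> /andP[xz xs] zs us.
rewrite map_rcons !ends_with_rcons [z == x]eq_sym (negPf xz).
have [zy|zy] := eqVneq z y; last by [].
rewrite eqxx; congr phi; rewrite -map_comp; apply/eq_in_map => k ks /=.
have [kx|_] := eqVneq k x; first by rewrite -kx ks in xs.
by have [ky|] := eqVneq k y; first by rewrite zy -ky ks in zs.
Qed.

Definition thetaI C (a b : seq I) := theta n (map C a) (map C b).

Lemma arcs_out x y C t : uniq t -> ~~ [&& x \in t, y \in t & x != y] ->
  arcs x y (thetaI C) t = 0.
Proof.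
move=> ut; have [xt|xt _] := boolP (x \in t); last exact: cpick_notin.
move=> yt; have {}yt : (y \notin t) || (y == x).
  by move: yt; rewrite /= negb_and negbK eq_sym.
case/splitPr: xt ut yt => u v; rewrite uniq_catC cat_cons => uvu yu.
rewrite arcs_rot cat_cons /arcs cpick_cons; last by case/andP: uvu.
apply: splitsum_eq0 => a l b E; case: eqP => // ly.
have yvu : y \in v ++ u by rewrite E ly mem_cat mem_head orbT.
case/orP: yu => [|/eqP yx].
  by rewrite mem_cat inE orbCA -mem_cat => /norP[_]; rewrite mem_cat orbC -mem_cat yvu.
by case/andP: uvu; rewrite -yx yvu.
Qed.

(** Each chord matches exactly one ordered pair of positions. This form takes the weights out of the
    sum over words. *)
Lemma phi_arcs C t : phi (map C t) =
  \sum_p \sum_q omega (C p) (C q) *: arcs p q (thetaI C) t.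
Proof.
rewrite /phi cycsum_map /arcs /cpick /cycsum.
under eq_bigr => p _ do under eq_bigr => q _ do rewrite -splitsumZ.
under eq_bigr => p _ do rewrite -splitsum_sum.
rewrite -splitsum_sum; apply: eq_splitsum => a l b _.
rewrite (bigD1 l) //= [X in _ + X]big1 ?addr0 => [|p pl]; last first.
  by rewrite big1 // => q _; rewrite eq_sym (negPf pl) scaler0.
under eq_bigr => q _ do rewrite eqxx -splitsumZ.
rewrite -splitsum_sum splitsum_map; apply: eq_splitsum => c k d _.
rewrite (bigD1 k) //= eqxx big1 ?addr0 // => q qk.
by rewrite eq_sym (negPf qk) scaler0.
Qed.

(** Besides the sign of [theta_rev], reversal exchanges the ends of each chord, and [omega] is skew:
    hence the additional minus sign. *)
Lemma phi_rev C t : uniq t ->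
  phi (map C (rev t)) = - phi (map C t) *~ (-1) ^+ size t.
Proof.
move=> ut; rewrite !phi_arcs exchange_big mulNrz mulrz_suml -sumrN.
apply: eq_bigr => q _; rewrite mulrz_suml -sumrN; apply: eq_bigr => p _.
rewrite (hermC omega) /= expr1 mulN1r scaleNr; congr (- _).
have F_rev (a z : seq I) : thetaI C (rev a) (rev z) =
    thetaI C a z *~ (-1) ^+ (size a + size z).
  by rewrite /thetaI !map_rev theta_rev !size_map.
rewrite scalerMzr; congr (_ *: _).
have [/and3P[pt qt pq]|out] := boolP [&& p \in t, q \in t & p != q].
  exact: arcs_rev.
rewrite !arcs_out ?rev_uniq ?mem_rev ?mul0rz //.
by rewrite andbCA eq_sym.
Qed.
End Skeleton.
End Phi.

Lemma pmap_uniq_inj (A B : eqType) (h : A -> option B) (s : seq A) l l' d :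
  uniq (pmap h s) -> l \in s -> l' \in s -> h l = Some d -> h l' = Some d ->
  l = l'.
Proof.
elim: s => //= k s IH us; rewrite !inE => ls l's hl hl'.
have mem_pmap_s m : m \in s -> h m = Some d -> d \in pmap h s.
  by move=> ms hm; rewrite mem_pmap -hm map_f.
case/orP: ls => [/eqP lk|ls]; case/orP: l's => [/eqP lk'|l's].
- by rewrite lk lk'.
- by move: us; rewrite -lk hl /= (mem_pmap_s _ l's hl').
- by move: us; rewrite -lk' hl' /= (mem_pmap_s _ ls hl).
by apply: IH => //; move: us; case: (h k) => //= ? /andP[].
Qed.

Lemma mem_bsubst (L : choiceType) (l z : L) B A :
  z \in leaves (bsubst l B A) -> z \in leaves A \/ z \in leaves B.
Proof.
elim: A => [k|A1 IH1 A2 IH2] /=; first by case: eqP; [right|left].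
rewrite !mem_cat => /orP[/IH1|/IH2] [-> | ->]; rewrite ?orbT; by [left|right].
Qed.

Lemma bsubst_mem (L : choiceType) (l z : L) B A :
  l \in leaves A -> z \in leaves B -> z \in leaves (bsubst l B A).
Proof.
move=> lA zB; elim: A lA => [k|A1 IH1 A2 IH2] /=.
  by rewrite inE => /eqP->; rewrite eqxx.
by rewrite !mem_cat => /orP[/IH1->|/IH2->]; rewrite ?orbT.
Qed.

(** * Compatibility of Phi with the relations *)

Section PhiRelations.
Variables (H : vectType rat) (omega : {skew_symmetric H}) (n : nat).
Implicit Types (T : utree (vertex H)) (A B D : btree (vertex H)).
Notation phi_tree := (phi_tree omega n).
Notation phi := (phi omega n).

Lemma one_dot_graph_skel T : is_hairy_graph 1 n T ->
  exists (m : nat) (S : utree 'I_m) (x y : 'I_m) (i : nat) (c : 'I_m -> H),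
    [/\ perm_eq (uleaves S) (enum 'I_m), x != y & T = umap (one_dot x y i c) S].
Proof.
case/and5P=> _ _ uT flipT /eqP sT; pose m := size (uleaves T).
pose c0 (p : 'I_m) := nth (inl 0) (uleaves T) p.
have [|S Sl Sc] := @uskel _ _ c0 (enum 'I_m) T.
  apply: (@eq_from_nth _ (inl 0)); rewrite size_map size_enum_ord // => p pm.
  rewrite (nth_map (Ordinal pm)) ?size_enum_ord //.
  by rewrite /c0 nth_enum_ord.
have Tc : uleaves T = map c0 (enum 'I_m) by rewrite -Sl -uleaves_umap Sc.
have dotsE : dot_ends T =
    pmap (fun l => if c0 l is inr d then Some d else None) (enum 'I_m).
  by rewrite /dot_ends Tc; elim: (enum _) => //= l s ->.
have [i iT] : exists i, forall d, d \in dot_ends T = (d.1 == i).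
  move: uT flipT sT; case: (dot_ends T) => [|[i b] [|e []]] //=.
  rewrite !inE => /andP[ne _] /and3P[/orP[] /eqP[E]].
    by move: E; case: (b).
  move=> _ _ _; exists i => -[j b']; rewrite !inE -E !xpair_eqE /=.
  by case: eqP => //= _; case: b {ne E}; case: b'.
have src_tgt b : exists l, c0 l = inr (i, b).
  have : (i, b) \in dot_ends T by rewrite iT.
  by rewrite mem_dot_ends Tc => /mapP[l _ ->]; exists l.
have [x xE] := src_tgt false; have [y yE] := src_tgt true.
have c0_inj l l' d : c0 l = inr d -> c0 l' = inr d -> l = l'.
  move=> lE l'E; move: uT; rewrite dotsE => /pmap_uniq_inj.
  by apply; rewrite ?mem_enum ?lE ?l'E.
exists m, S, x, y, i, (fun l => hair_of (c0 l)); split.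
- by rewrite Sl.
- by apply/eqP => xy; move: xE; rewrite xy yE.
rewrite -Sc; apply: eq_umap => l; rewrite /one_dot.
have [->|lx] := eqVneq l x; first exact: xE.
have [->|ly] := eqVneq l y; first exact: yE.
case lE: (c0 l) => [//|[j b]].
have : (j, b) \in dot_ends T.
  by rewrite mem_dot_ends Tc -lE map_f ?mem_enum.
rewrite iT => /eqP /= ji; rewrite ji in lE.
case: b lE => lE; first by rewrite (c0_inj _ _ _ lE yE) eqxx in ly.
by rewrite (c0_inj _ _ _ lE xE) eqxx in lx.
Qed.

Lemma phi_tree_rename f T : is_hairy_graph 1 n T ->
  phi_tree (umap (rename_dot f) T) = phi_tree T.
Proof.
case/one_dot_graph_skel=> m [S [x [y [i [c [SP xy ->]]]]]].
have uS : uniq (uleaves S) by rewrite (perm_uniq SP) enum_uniq.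
rewrite umap_comp (eq_umap (g := one_dot x y (f i) c)) ?phi_tree_one_dot // => l.
by rewrite /= /one_dot; case: eqP => //; case: eqP.
Qed.

(** Reversing the path gives (-1)^k and [phi_rev] gives -(-1)^k for the same k, which leaves -1. *)
Lemma phi_tree_reverse i T : is_hairy_graph 1 n T -> (i, false) \in dot_ends T ->
  phi_tree (umap (reverse_dot i) T) = - phi_tree T.
Proof.
move=> TP; have [m [S [x [y [j [c [SP xy TE]]]]]]] := one_dot_graph_skel TP.
have uS : uniq (uleaves S) by rewrite (perm_uniq SP) enum_uniq.
have mem_pmap_s l : l \in uleaves S by rewrite (perm_mem SP) mem_enum.
rewrite mem_dot_ends TE uleaves_umap => /mapP[l _].
rewrite {1}/one_dot; case: eqP => [_ [ij]|_]; last by case: eqP.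
rewrite umap_comp (eq_umap (g := one_dot y x j c)) => [|k]; last first.
  rewrite /= /one_dot; have [->|kx] := eqVneq k x.
    by rewrite (negPf xy) /= ij eqxx.
  by case: eqP; rewrite //= ij eqxx.
rewrite !phi_tree_one_dot // 1?eq_sym // (path_sum_rev _ uS xy) //.
set k := lie_degree S.
have sgn (z : omega_space H 2 n) : z *~ (-1) ^+ k = if odd k then - z else z.
  by rewrite -signr_odd; case: odd; rewrite ?mulrNz.
rewrite (@eq_path_sum _ _ x y _ (fun t => - (if odd k then - phi (map c t)
    else phi (map c t)))) ?path_sumN => [|t tS].
  by rewrite sgn; case: odd; rewrite ?path_sumN ?opprK.
have ut : uniq t.
  have : uniq (x :: rcons t y) by rewrite (perm_uniq tS).
  by rewrite cons_uniq rcons_uniq => /and3P[].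
have -> : k = size t.
  have := perm_size tS; rewrite /= size_rcons /uleaves size_cat !size_leaves.
  by rewrite addSn addnS => -[].
by rewrite phi_rev // mulNrz -signr_odd; case: odd; rewrite ?mulrNz.
Qed.

(** The circle carries the expansion of [D]. If [D] is a bracket, rotation invariance of [phi] kills
    the commutator; a single hair admits no chord. *)
Lemma phi_tree_adjacent i D : is_hairy_graph 1 n (Node (dot_src i) (dot_tgt i), D) ->
  phi_tree (Node (dot_src i) (dot_tgt i), D) = 0.
Proof.
case/and5P=> _ _ _ _ /eqP; rewrite /dot_ends /uleaves /= => -[sD].
have nD d : inr d \notin leaves D.
  apply/negP => dD; move/size0nil: sD; set s := pmap _ _ => s0.
  have : d \in s by rewrite mem_pmap; apply/mapP; exists (inr d).
  by rewrite s0.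
rewrite phi_tree_rotate phi_tree_root => [|j]; last first.
  by rewrite /= inE negb_or (nD (j, false)) andbT; apply/eqP.
rewrite /= eqxx psum_notin ?nD // sub0r -[RHS]oppr0; congr (- _).
case: (D) => [l|A B] /=.
  exact: phi_single.
rewrite -[RHS](wsum0 _ A); apply: eq_wsum => a.
rewrite -[RHS](wsum0 _ B); apply: eq_wsum => b.
by rewrite !cats0 !map_cat phi_rot subrr.
Qed.

(** Both sides carry one minus sign, and the words [v a] and [a v] left over agree under
    rotation. *)
Lemma phi_tree_slide i v D
    (D' := bsubst (inr (i, true)) (Node (dot_tgt i) (hair v)) D) :
  is_hairy_graph 1 n (Node (hair v) (dot_src i), D) ->
  phi_tree (Node (hair v) (dot_src i), D) = phi_tree (dot_src i, D').
Proof.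
case/and5P=> _ _ _ flipT /eqP.
move: flipT; rewrite /dot_ends /uleaves /=; set dots := pmap _ _ => /andP[iD _] [sD].
have {iD sD}dotsE : dots = [:: (i, true)].
  by case: dots iD sD => [|d []] //; rewrite !inE => /orP[/eqP|/eqP->].
have countD d : count_mem (inr d) (leaves D) = (d == (i, true)).
  transitivity (count_mem d dots); last by rewrite dotsE /= addn0 eq_sym.
  by rewrite /dots; elim: (leaves D) => //= -[w|e] s ->.
have nD j : inr (j, false) \notin leaves D.
  by apply/count_memPn; rewrite countD xpair_eqE andbF.
rewrite phi_tree_rotate phi_tree_swap phi_tree_rotate !phi_tree_root.
- rewrite psum_slide ?countD ?eqxx //= (eq_wsum _ (g := fun=> 0)) // wsum0 sub0r.
  congr (- _); apply: eq_psum => a.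
  by rewrite -cats1 map_cat -phi_rot.
- move=> j; apply/negP => /mem_bsubst[]; first by rewrite (negPf (nD j)).
  by rewrite !inE => /orP[] /eqP.
by move=> j; rewrite /= mem_cat inE (negPf (nD j)).
Qed.

Definition phi_graph (G : hairy_graph H 1 n) := phi_tree (hg_tree G).

Lemma phi_graph_rel x : graph_rel x -> fglin phi_graph x = 0.
Proof.
case=> {x}.
- by move=> G G' A B GE G'E; rewrite linearB !fglinE /phi_graph GE G'E phi_tree_swap subrr.
- by move=> G G' A B D GE G'E; rewrite linearB !fglinE /phi_graph GE G'E phi_tree_rotate subrr.
- move=> G G' f _ G'E; rewrite linearB !fglinE /phi_graph G'E.
  by rewrite phi_tree_rename ?subrr //; case: (G).
- by move=> G G' A B D GE G'E; rewrite linearD !fglinE /phi_graph GE G'E phi_tree_anti addNr.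
- move=> G G' G'' A B D E GE G'E G''E; rewrite !linearD !fglinE /phi_graph GE G'E G''E.
  exact/uwsum_IHX/cycsum_rot.
- move=> G G' G'' a u v B GE G'E G''E; rewrite linearB linearP !fglinE /phi_graph.
  by rewrite GE G'E G''E phi_tree_linear subrr.
move=> G G' i iG G'E; rewrite linearD !fglinE /phi_graph G'E.
by rewrite phi_tree_reverse ?subrr //; case: (G).
Qed.

Definition phi_graph_space : {linear graph_space H 1 n -> omega_space H 2 n} :=
  llift phi_graph_rel.

Lemma phi_graph_class (G : hairy_graph H 1 n) :
  phi_graph_space (graph_class G) = phi_tree (hg_tree G).
Proof. by rewrite /phi_graph_space /graph_class lliftE fglinE. Qed.

Lemma phi_omega_rel x : omega_rel x -> phi_graph_space x = 0.
Proof.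
case=> {x}.
- move=> G i b D GE; rewrite phi_graph_class; have := valP G; rewrite /= GE.
  case: b {GE} => TP; last exact: phi_tree_adjacent.
  rewrite phi_tree_anti phi_tree_adjacent ?oppr0 //.
  rewrite (@is_hairy_graph_perm _ _ _ _ (Node (dot_tgt i) (dot_src i), D)) //.
  by apply/permP => k; rewrite /uleaves /= addnCA.
- move=> G G' i v D GE G'E; rewrite linearB !phi_graph_class G'E; have := valP G.
  by rewrite /= GE => /phi_tree_slide ->; rewrite subrr.
(* No instance of (C3) exists here: grafting would leave at least three distinct dotted ends,
   whereas a graph with one dotted edge has two. *)
move=> G1 G2 G3 i j k T ijk sT G1E _ _; exfalso.
have := valP G1; case/and5P=> _ _ _ /allP flipT /eqP sG.
have memG d : inr d \in leaves (Node (dot_src j) (dot_src k) : btree (vertex H)) ->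
    d \in dot_ends (hg_tree G1).
  move=> dN; rewrite mem_dot_ends G1E /uleaves mem_cat.
  have : inr (i, true) \in uleaves T by rewrite -mem_dot_ends sT ?mem_head.
  by rewrite mem_cat => /orP[] iT; rewrite !(bsubst_mem iT dN) ?orbT.
have jG : (j, false) \in dot_ends (hg_tree G1) by rewrite memG ?mem_head.
have kG : (k, false) \in dot_ends (hg_tree G1) by rewrite memG // !inE eqxx orbT.
have jk : j != k by move: ijk; rewrite /= !inE => /and3P[].
have u3 : uniq [:: (j, false); (k, false); (j, true)].
  by rewrite /= !inE !xpair_eqE (negPf jk) !andbF.
have /(uniq_leq_size u3) : {subset [:: (j, false); (k, false); (j, true)]
    <= dot_ends (hg_tree G1)}.
  by move=> d; rewrite !inE => /or3P[] /eqP-> //; apply: (flipT _ jG).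
by rewrite sG.
Qed.

Definition phi_omega : {linear omega_space H 1 n -> omega_space H 2 n} :=
  llift phi_omega_rel.
End PhiRelations.

(** * Sums over pairs of leaves *)

Section PairSums.
Variables (V : zmodType) (m : nat).
Notation I := 'I_m.
Implicit Types (e : I * I) (f : I * I -> V).

Definition flip e := (e.2, e.1).

Lemma flipK : involutive flip.
Proof. by case. Qed.

Lemma sum_flip f : \sum_e f (flip e) = \sum_e f e.
Proof. by rewrite [RHS](reindex_inj (inv_inj flipK)). Qed.

Lemma sum_increasing f : (forall e, f (flip e) = f e) -> (forall x, f (x, x) = 0) ->
  \sum_e f e = (\sum_(e : I * I | (e.1 < e.2)%N) f e) *+ 2.
Proof.
move=> f_flip f0; rewrite (bigID (fun e : I * I => (e.1 < e.2)%N)) /= mulr2n; congr (_ + _).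
rewrite (bigID (fun e : I * I => (e.2 < e.1)%N)) /= [X in _ + X]big1 ?addr0.
  rewrite (reindex_inj (inv_inj flipK)) /=; apply: eq_big => [[x y]|e _] //=.
  by rewrite andbC; case: ltngtP.
by case=> x y /= xy; rewrite -(f0 x); congr (f (_, _)); apply/val_inj => /=; lia.
Qed.

Lemma sum_matchings1 (f : {set I * I} -> V) :
  \sum_(D in matchings m 1) f D = \sum_(e : I * I | (e.1 < e.2)%N) f [set e].
Proof.
transitivity (\sum_(D in matchings m 1) \sum_(e in D) f [set e]).
  apply: eq_bigr => D /matchingsP[/eqP/cards1P[e ->] _ _].
  by rewrite big_set1.
rewrite (exchange_big_dep (fun e : I * I => (e.1 < e.2)%N)) /=; last first.
  by move=> D e /matchingsP[_ Dlt _] /Dlt.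
apply: eq_bigr => e elt; rewrite (big_pred1 [set e]) // => D /=.
apply/andP/eqP => [[/matchingsP[/eqP/cards1P[e' ->] _ _]]|->].
  by rewrite inE => /eqP->.
rewrite set11; split=> //; apply/matchingsP; split; rewrite ?cards1 //.
  by move=> e'; rewrite inE => /eqP->.
move=> e1 e2 b b'; rewrite !inE => /eqP-> /eqP-> ee; split=> //.
by case: b b' ee => -[] //= ee; rewrite ee ltnn in elt.
Qed.

(** The factor 2 counts the two orders in which the pairs of a matching can be listed. *)
Lemma sum_matchings2 (f : {set I * I} -> V) :
  (\sum_(D in matchings m 2) f D) *+ 2 =
  \sum_(e : I * I | (e.1 < e.2)%N) \sum_(e' : I * I | (e'.1 < e'.2)%N)
    if uniq [:: e.1; e.2; e'.1; e'.2] then f [set e; e'] else 0.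
Proof.
rewrite -sumrMnl.
transitivity (\sum_(D in matchings m 2) \sum_(e in D) \sum_(e' in D :\ e) f D).
  apply: eq_bigr => D /matchingsP[D2 _ _]; rewrite -D2 -sumr_const.
  apply: eq_bigr => e eD; rewrite sumr_const.
  by have := cardsD1 e D; rewrite D2 eD add1n => -[<-].
rewrite (exchange_big_dep (fun e : I * I => (e.1 < e.2)%N)) /=; last first.
  by move=> D e /matchingsP[_ Dlt _] /Dlt.
apply: eq_bigr => e elt.
rewrite (exchange_big_dep (fun e : I * I => (e.1 < e.2)%N)) /=; last first.
  by move=> D e' /andP[/matchingsP[_ Dlt _] _] /setD1P[_ /Dlt].
apply: eq_bigr => e' e'lt.
have DE D : [&& D \in matchings m 2, e \in D & e' \in D :\ e] =
    uniq [:: e.1; e.2; e'.1; e'.2] && (D == [set e; e']).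
  apply/idP/idP.
    case/and3P=> /matchingsP[D2 Dlt D_inj] eD /setD1P[ne e'D].
    apply/andP; split.
      have neq b b' : pair_end e b != pair_end e' b'.
        by apply/eqP => /D_inj-/(_ eD e'D)[E]; rewrite E eqxx in ne.
      have lt_neq (x y : I) : (x < y)%N -> x != y by apply: contraTneq => ->; rewrite ltnn.
      rewrite /= !inE !negb_or (lt_neq _ _ elt) (lt_neq _ _ e'lt).
      by rewrite (neq false false) (neq false true) (neq true false) (neq true true).
    rewrite eq_sym eqEcard D2 cards2 eq_sym ne andbT.
    by apply/subsetP => z; rewrite !inE => /orP[] /eqP->.
  case/andP=> U /eqP->.
  have [n1 n2 n3 n4] :
      [/\ e.1 != e'.1, e.1 != e'.2, e.2 != e'.1 & e.2 != e'.2].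
    by move: U; rewrite /= !inE !negb_or => /and3P[/and3P[_ ? ?] /andP[? ?] _].
  have ne : e' != e by apply: contraNneq n1 => ->.
  rewrite set21 in_setD1 ne set22 !andbT; apply/matchingsP; split.
  - by rewrite cards2 eq_sym ne.
  - by move=> z; rewrite !inE => /orP[] /eqP->.
  have H1 (g : I * I) b b' : (g.1 < g.2)%N -> pair_end g b = pair_end g b' -> b = b'.
    by case: b b' => -[] //= glt E; rewrite E ltnn in glt.
  have H2 b b' : pair_end e b <> pair_end e' b'.
    by case: b b' => -[] /=; apply/eqP.
  move=> z z' b b'; rewrite !inE => /orP[] /eqP-> /orP[] /eqP->.
  - by move/H1-> .
  - by move/H2.
  - by move/esym/H2.
  by move/H1->.
under eq_bigl => D do rewrite -andbA DE.
rewrite -[X in if X then _ else _]/(uniq [:: e.1; e.2; e'.1; e'.2]).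
by case: (uniq _); [rewrite (big_pred1 [set e; e']) | rewrite big_pred0].
Qed.
End PairSums.

(** Summed with the skew weights, each of the four terms on the left of the hypothesis gives the
    same total: a flip compensates its sign, and [e] and [e'] can be exchanged. *)
Lemma sum_flip_identity (V : lmodType rat) (m : nat) (w : 'I_m * 'I_m -> rat)
    (K Q : 'I_m * 'I_m -> 'I_m * 'I_m -> V) :
  (forall e, w (flip e) = - w e) ->
  (forall e e', K e e' - K e (flip e') + (K e' e - K e' (flip e)) = Q e e' *+ 3) ->
  (\sum_e \sum_e' (w e * w e') *: K e e') *+ 4 =
  (\sum_e \sum_e' (w e * w e') *: Q e e') *+ 3.
Proof.
move=> w_flip KQ; set KK := \sum_e \sum_e' _ *: K e e'.
pose RR := \sum_e \sum_e' (w e * w e') *: K e (flip e').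
have RRE : RR = - KK.
  rewrite -sumrN; apply: eq_bigr => e _; rewrite -sum_flip -sumrN.
  by apply: eq_bigr => e' _; rewrite flipK w_flip mulrN scaleNr.
have KKs : \sum_e \sum_e' (w e' * w e) *: K e' e = KK by exact: exchange_big.
have RRs : \sum_e \sum_e' (w e' * w e) *: K e' (flip e) = RR by exact: exchange_big.
have -> : KK *+ 4 = KK - RR + (KK - RR) by rewrite RRE opprK -!mulr2n -mulrnA.
rewrite -{2}KKs -{2}RRs -!sumrB -big_split -sumrMnl.
apply: eq_bigr => e _; rewrite -!sumrB -big_split -sumrMnl; apply: eq_bigr => e' _.
by rewrite /= [w e' * _]mulrC -!scalerBr -scalerDr KQ scalerMnr.
Qed.

Lemma uniq_word_avoids (L : eqType) (s t k l : L) u1 a u2 :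
  uniq (s :: rcons (u1 ++ k :: a ++ l :: u2) t) ->
  {in u1 ++ a ++ u2, forall z, z \notin [:: s; t; k; l]}.
Proof.
have P : perm_eq (s :: rcons (u1 ++ k :: a ++ l :: u2) t)
    ([:: s; t; k; l] ++ (u1 ++ a ++ u2)).
  by apply/permP => f; do 3! rewrite /= -?cats1 ?count_cat; lia.
by rewrite (perm_uniq P) cat_uniq => /and3P[_ /hasPn].
Qed.

(** * Comparison of the two traces on a tree labelled by positions *)

Section Skeleton.
Variables (H : vectType rat) (omega : {skew_symmetric H}) (n m : nat).
Variables (S : utree 'I_m) (c : 'I_m -> H).
Hypotheses (Sp : perm_eq (uleaves S) (enum 'I_m)) (Sn : lie_degree S = n).
Hypothesis n0 : (0 < n)%N.

Notation I := 'I_m.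
Implicit Types (x y p q : I) (e : I * I) (T : utree I) (a b z : seq I).
Notation F := (thetaI n c).
Notation W := (omega_space H 2 n).
Notation hairs := (@map _ (vertex H) inl).

Lemma skeleton_uniq : uniq (uleaves S).
Proof. by rewrite (perm_uniq Sp) enum_uniq. Qed.

Lemma mem_skeleton x : x \in uleaves S.
Proof. by rewrite (perm_mem Sp) mem_enum. Qed.

Definition two_dots_at x y p q (l : I) : vertex H :=
  if l == x then inr (0%N, false) else if l == y then inr (0%N, true)
  else if l == p then inr (1%N, false) else if l == q then inr (1%N, true)
  else inl (c l).

Definition two_dots_class x y p q T : W :=
  omega_class 2 n (umap (two_dots_at x y p q) T).

Lemma thetaI_slides : slides F.
Proof. by move=> v w z; rewrite /thetaI /= !map_rcons /= theta_slides. Qed.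

Lemma thetaI_tripod a z : F a z + F z a + comb_sum z (fun l r => F r (a ++ l)) = 0.
Proof.
rewrite -[RHS](theta_tripod n (map c a) (map c z)) comb_sum_map.
by congr (_ + _); apply: eq_comb_sum => l r; rewrite /thetaI map_cat.
Qed.

Lemma thetaI_rev a z : F (rev a) (rev z) = F a z *~ (-1) ^+ (size a + size z).
Proof. by rewrite /thetaI !map_rev theta_rev !size_map. Qed.

Lemma theta_chord i j (u a b : seq H) : i != j ->
  omega_class 2 n (dot_src i, comb (hairs u ++ inr (j, false) :: hairs a
    ++ inr (j, true) :: hairs b) (dot_tgt i)) = theta n a (b ++ u).
Proof.
move=> ij; rewrite omega_class_cut_cat; last first.
  apply/negP; rewrite inE mem_cat inE !dot_notin_hairs /= orbF => /orP[/eqP[]|/eqP[E]] //.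
  by rewrite E eqxx in ij.
by rewrite -(theta_names n a _ ij) /theta_word map_cat cat_cons -catA.
Qed.

Lemma theta_chord_rev i j (u a b : seq H) : i != j ->
  omega_class 2 n (dot_src i, comb (hairs u ++ inr (j, true) :: hairs a
    ++ inr (j, false) :: hairs b) (dot_tgt i)) = - theta n a (b ++ u).
Proof.
move=> ij; rewrite -(theta_chord _ _ _ ij) -(@omega_class_reverse_dot _ _ _ j).
  rewrite /umap /= bmap_comb !map_cat /= !map_cat /= (negPf ij) eqxx -!map_comp.
  by rewrite !(@eq_map _ _ _ inl).
by rewrite mem_dot_ends /uleaves /= leaves_comb !(mem_cat, inE) eqxx !orbT.
Qed.

Lemma two_dots_identity x y p q : uniq [:: x; y; p; q] ->
  path_sum x y (arcsB F p q) S + path_sum p q (arcsB F x y) S =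
  two_dots_class x y p q S *+ 3.
Proof.
move=> U; pose d := two_dots_at x y p q.
have mapd t : {in t, forall l, l \notin [:: x; y; p; q]} ->
    map d t = hairs (map c t).
  move=> tP; rewrite -map_comp; apply/eq_in_map => l /tP.
  rewrite !inE !negb_or /d /two_dots_at => /and4P[lx ly lp lq].
  by rewrite (negPf lx) (negPf ly) (negPf lp) (negPf lq).
have map3 (s : seq I) u1 a u2 : {in u1 ++ a ++ u2, forall l, l \notin s} ->
    s =i [:: x; y; p; q] -> [/\ map d u1 = hairs (map c u1),
    map d a = hairs (map c a) & map d u2 = hairs (map c u2)].
  move=> av sE; split; apply: mapd => l lt; rewrite -sE; apply: av;
    by rewrite !mem_cat lt ?orbT.
have [dx dy dp dq] : [/\ d x = inr (0%N, false), d y = inr (0%N, true),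
    d p = inr (1%N, false) & d q = inr (1%N, true)].
  move: U; rewrite /d /two_dots_at /= !inE !negb_or.
  case/and4P=> /and3P[xy xp xq] /andP[yp yq] pq _.
  rewrite !eqxx ![y == _]eq_sym ![p == _]eq_sym ![q == _]eq_sym.
  by rewrite (negPf xy) (negPf xp) (negPf xq) (negPf yp) (negPf yq) (negPf pq).
apply: (arcs_identity thetaI_slides thetaI_tripod thetaI_rev) => //.
- by move=> A B; apply: omega_class_swap.
- by move=> A B D; apply: omega_class_rotate.
- move=> l; apply: (@class_lie_function _ _ (two_dots_class x y p q)).
  + by move=> A B; apply: omega_class_swap.
  + by move=> A B D; apply: omega_class_rotate.
  + by move=> A B D; apply: omega_class_anti.
  by move=> A B D E; apply: omega_class_IHX.
- move=> u1 a u2 /uniq_word_avoids/map3[// | E1 Ea E2].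
  rewrite /two_dots_class /umap /= -/d bmap_comb /= dx dy !map_cat /= map_cat /= dp dq.
  by rewrite E1 Ea E2 theta_chord // /thetaI map_cat.
- move=> u1 a u2 /uniq_word_avoids/map3[|E1 Ea E2].
    by move=> l; rewrite !inE; do !case: eqP.
  rewrite /two_dots_class /umap /= -/d bmap_comb /= dx dy !map_cat /= map_cat /= dp dq.
  by rewrite E1 Ea E2 theta_chord_rev // /thetaI map_cat.
- move=> u1 a u2 /uniq_word_avoids/map3[|E1 Ea E2].
    by move=> l; rewrite !inE; do !case: eqP.
  rewrite /two_dots_class /umap /= -/d bmap_comb /= dp dq !map_cat /= map_cat /= dx dy.
  by rewrite E1 Ea E2 theta_chord // /thetaI map_cat.
move=> u1 a u2 /uniq_word_avoids/map3[|E1 Ea E2].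
  by move=> l; rewrite !inE; do !case: eqP.
rewrite /two_dots_class /umap /= -/d bmap_comb /= dp dq !map_cat /= map_cat /= dx dy.
rewrite E1 Ea E2 /thetaI map_cat -(theta_chord (i := 1) (j := 0)) //.
rewrite -(@omega_class_reverse_dot _ _ _ 1) ?mem_dot_ends //.
rewrite /umap /= bmap_comb !map_cat /= !map_cat /= -!map_comp.
- by [].
- exact: skeleton_uniq.
by move=> l _; apply: mem_skeleton.
Qed.

Definition weight2 e := omega (c e.1) (c e.2).

Lemma weight2_flip e : weight2 (flip e) = - weight2 e.
Proof. by rewrite /weight2 (hermC omega) /= expr1 mulN1r. Qed.

Lemma weight2_diag x : weight2 (x, x) = 0.
Proof.
by apply/eqP; rewrite -Num.Theory.eqNr -weight2_flip.
Qed.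

Lemma phi_trace1 :
  phi_omega omega n (lproj (@omega_rel H 1 n) (skel_trace omega 1 n S c)) =
  \sum_(e : I * I | (e.1 < e.2)%N)
    weight2 e *: path_sum e.1 e.2 (fun t => phi omega n (map c t)) S.
Proof.
rewrite /phi_omega lliftE /skel_trace linear_sum sum_matchings1.
apply: eq_bigr => e elt; rewrite linearZ /= /weight big_set1; congr (_ *: _).
have eM : [set e] \in matchings m 1.
  apply/matchingsP; split; rewrite ?cards1 //.
    by move=> e'; rewrite inE => /eqP->.
  move=> e1 e2 b b'; rewrite !inE => /eqP-> /eqP-> ee; split=> //.
  by case: b b' ee => -[] //= ee; rewrite ee ltnn in elt.
have SE : umap (dotify [set e] id (fun e => val e.1) c) S =
    umap (one_dot e.1 e.2 (val e.1) c) S.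
  apply: eq_umap => l; rewrite /one_dot.
  have [[e1 [b [/set1P-> -> ->]]]|[none ->]] :=
    dotify_spec [set e] id (fun e => val e.1) c l.
    case: b => /=; rewrite eqxx //.
    by case: eqP => // e12; rewrite e12 ltnn in elt.
  have nl (b : bool) : (l == pair_end e b) = false.
    by rewrite eq_sym; apply/negbTE/none; rewrite set11.
  by rewrite (nl false) (nl true).
have TP := dot_skel_wf n0 c Sp Sn eM; rewrite /dot_skel SE in TP.
rewrite SE raw_class_valid; apply: (etrans (phi_graph_class _ _)).
rewrite phi_tree_one_dot ?skeleton_uniq //.
by apply: contraTneq elt => ->; rewrite ltnn.
Qed.

(** The value 0 when ends coincide matches [chord_sum_out], so that sums may run over all ordered
    pairs of pairs. *)
Definition trace2_class e e' : W :=
  if uniq [:: e.1; e.2; e'.1; e'.2] then two_dots_class e.1 e.2 e'.1 e'.2 S else 0.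

Lemma trace2 :
  lproj (@omega_rel H 2 n) (skel_trace omega 2 n S c) *+ 2 =
  \sum_(e : I * I | (e.1 < e.2)%N) \sum_(e' : I * I | (e'.1 < e'.2)%N)
    (weight2 e * weight2 e') *: trace2_class e e'.
Proof.
rewrite /skel_trace linear_sum sum_matchings2.
apply: eq_bigr => e elt; apply: eq_bigr => e' e'lt; rewrite /trace2_class.
case: ifP => U; last by rewrite scaler0.
rewrite linearZ /=.
have [n1 n2 n3 n4] :
    [/\ e.1 != e'.1, e.1 != e'.2, e.2 != e'.1 & e.2 != e'.2].
  by move: U; rewrite /= !inE !negb_or => /and3P[/and3P[_ ? ?] /andP[? ?] _].
have ne : e != e' by apply: contraNneq n1 => ->.
congr (_ *: _).
  by rewrite /weight big_setU1 ?inE //= big_set1.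
(* The trace names a dotted edge by the position of its source; these names are changed to 0 and
   1. *)
pose f k := if k == val e.1 then 0%N else 1%N.
have f1 : f (val e.1) = 0%N by rewrite /f eqxx.
have f2 : f (val e'.1) = 1%N.
  by rewrite /f; case: eqP => // /val_inj E; rewrite E eqxx in n1.
pose d := dotify [set e; e'] id (fun e => val e.1) c.
have nlt (g : I * I) : (g.1 < g.2)%N -> (g.2 == g.1) = false.
  by move=> glt; apply/eqP => E; rewrite E ltnn in glt.
rewrite -[LHS]/(omega_class 2 n (umap d S)) -(@omega_class_rename_dot _ _ _ f).
  rewrite umap_comp; congr omega_class; apply: eq_umap => l; rewrite /= /two_dots_at /d.
  have [[e1 [b [/set2P eE -> ->]]]|[none ->]] :=
    dotify_spec [set e; e'] id (fun e => val e.1) c l.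
    case: eE => ->; rewrite /= ?f1 ?f2; case: b => /=; rewrite ?eqxx ?nlt //.
      by rewrite ![e'.2 == _]eq_sym (negPf n2) (negPf n4).
    by rewrite ![e'.1 == _]eq_sym (negPf n1) (negPf n3).
  have nl (g : I * I) (b : bool) : g \in [set e; e'] -> (l == pair_end g b) = false.
    by move=> gD; rewrite eq_sym; apply/negbTE/none.
  by rewrite (nl e false) ?(nl e true) ?(nl e' false) ?(nl e' true) ?set21 ?set22.
have namesE k : k \in unzip1 (dot_ends (umap d S)) -> k = val e.1 \/ k = val e'.1.
  case/mapP=> z; rewrite mem_dot_ends uleaves_umap => /mapP[l _ zE] ->.
  move: zE; rewrite /d; have [[g [b [/set2P[]-> _ ->]]]|[_ ->]] :=
    dotify_spec [set e; e'] id (fun e => val e.1) c l; move=> // -[->]; by [left|right].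
by move=> k l /namesE[]-> /namesE[]->; rewrite ?f1 ?f2.
Qed.

Lemma uniq_flipl e e' : uniq [:: e.2; e.1; e'.1; e'.2] = uniq [:: e.1; e.2; e'.1; e'.2].
Proof. exact/perm_uniq/permEl/(perm_catCA [:: e.2] [:: e.1]). Qed.

Lemma uniq_swap e e' : uniq [:: e'.1; e'.2; e.1; e.2] = uniq [:: e.1; e.2; e'.1; e'.2].
Proof. exact: (uniq_catC [:: e'.1; e'.2]). Qed.

Lemma uniq_flipr e e' : uniq [:: e.1; e.2; e'.2; e'.1] = uniq [:: e.1; e.2; e'.1; e'.2].
Proof.
by rewrite (uniq_catC [:: e.1; e.2] [:: e'.2; e'.1]) [LHS](uniq_flipl e' e) uniq_swap.
Qed.

Lemma trace2_class_flipl e e' : trace2_class (flip e) e' = - trace2_class e e'.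
Proof.
rewrite /trace2_class uniq_flipl; case: ifP => U; last by rewrite oppr0.
have ne : e.1 != e.2 by move: U; rewrite /= !inE !negb_or => /and3P[/and3P[]].
rewrite /two_dots_class -(@omega_class_reverse_dot _ _ _ 0).
  congr omega_class; rewrite umap_comp; apply: eq_umap => l.
  rewrite /= /two_dots_at; have [->|lx] := eqVneq l e.1.
    by rewrite (negPf ne).
  case: eqP => // _; case: eqP => // _; by case: eqP.
rewrite mem_dot_ends uleaves_umap; apply/mapP; exists e.1; first exact: mem_skeleton.
by rewrite /two_dots_at eqxx.
Qed.

Lemma trace2_class_flipr e e' : trace2_class e (flip e') = - trace2_class e e'.
Proof.
rewrite /trace2_class uniq_flipr; case: ifP => U; last by rewrite oppr0.
have [ne n1 n2] : [/\ e'.1 != e'.2, e.1 != e'.1 & e.2 != e'.1].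
  by move: U; rewrite /= !inE !negb_or => /and4P[/and3P[_ ? _] /andP[? _] ? _].
rewrite /two_dots_class -(@omega_class_reverse_dot _ _ _ 1).
  congr omega_class; rewrite umap_comp; apply: eq_umap => l.
  rewrite /= /two_dots_at; case: eqP => // _; case: eqP => // _.
  have [->|lx] := eqVneq l e'.1; first by rewrite (negPf ne).
  by case: eqP.
rewrite mem_dot_ends uleaves_umap; apply/mapP; exists e'.1; first exact: mem_skeleton.
by rewrite /two_dots_at ![e'.1 == _]eq_sym (negPf n1) (negPf n2) eqxx.
Qed.

(** The unweighted contribution to Phi after the first trace in which [e] is the dotted edge of the
    trace and [e'] the chord. *)
Definition chord_sum e e' : W := path_sum e.1 e.2 (arcs e'.1 e'.2 F) S.

Lemma chord_sum_out e e' : ~~ uniq [:: e.1; e.2; e'.1; e'.2] -> chord_sum e e' = 0.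
Proof.
move=> U; rewrite -[RHS](@path_sum0 _ W _ e.1 e.2 S); apply: eq_path_sum => w wS.
have uw : uniq (e.1 :: rcons w e.2) by rewrite (perm_uniq wS) skeleton_uniq.
have uw' : uniq w by move: uw; rewrite cons_uniq rcons_uniq => /and3P[].
apply: arcs_out => //; apply: contra U => /and3P[pw qw pq].
move: uw; rewrite cons_uniq rcons_uniq mem_rcons inE negb_or.
case/and3P=> /andP[xy xw] yw _; rewrite /= !inE !negb_or xy pq /= !andbT.
have ne (l k : I) : l \notin w -> k \in w -> l != k.
  by move=> zw; apply: contraTneq => <-.
by rewrite !ne.
Qed.

(** The signs from reversing the path and from reversing the circle are both (-1)^n and cancel. *)
Lemma chord_sum_flip e e' : chord_sum (flip e) e' = chord_sum e (flip e').
Proof.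
have [ee|ne] := eqVneq e.1 e.2.
  by rewrite !chord_sum_out //= ee !inE eqxx.
rewrite /chord_sum (path_sum_rev _ skeleton_uniq ne) ?mem_skeleton //.
have sgn (z : W) : z *~ (-1) ^+ n = if odd n then - z else z.
  by rewrite -signr_odd; case: odd; rewrite ?mulrNz.
rewrite (@eq_path_sum _ _ e.1 e.2 _ (fun w => if odd n then - arcs e'.2 e'.1 F w
    else arcs e'.2 e'.1 F w)).
  by rewrite Sn sgn; case: odd; rewrite ?path_sumN ?opprK.
move=> w wS; have uw : uniq w.
  have : uniq (e.1 :: rcons w e.2) by rewrite (perm_uniq wS) skeleton_uniq.
  by rewrite cons_uniq rcons_uniq => /and3P[].
have nE : n = size w.
  have := perm_size wS; rewrite /= size_rcons /uleaves size_cat !size_leaves.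
  by rewrite addSn addnS => -[->]; rewrite -Sn.
have [/and3P[pw qw pq]|out] := boolP [&& e'.1 \in w, e'.2 \in w & e'.1 != e'.2].
  by rewrite (arcs_rev thetaI_rev) // nE -signr_odd; case: odd; rewrite ?mulrNz.
have out' : ~~ [&& e'.2 \in w, e'.1 \in w & e'.2 != e'.1] by rewrite andbCA eq_sym.
by rewrite !arcs_out ?rev_uniq ?mem_rev // oppr0 if_same.
Qed.

Lemma chord_sum_trace2 e e' :
  chord_sum e e' - chord_sum e (flip e') + (chord_sum e' e - chord_sum e' (flip e)) =
  trace2_class e e' *+ 3.
Proof.
rewrite /trace2_class; case: ifP => U; last first.
  have U' : uniq [:: e'.1; e'.2; e.1; e.2] = false by rewrite uniq_swap.
  have -> : chord_sum e e' = 0 by apply: chord_sum_out; rewrite U.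
  have -> : chord_sum e (flip e') = 0 by apply: chord_sum_out; rewrite uniq_flipr U.
  have -> : chord_sum e' e = 0 by apply: chord_sum_out; rewrite U'.
  have -> : chord_sum e' (flip e) = 0 by apply: chord_sum_out; rewrite uniq_flipr U'.
  by rewrite subr0 addr0 mul0rn.
have arcsBE (g h : I * I) : chord_sum g h - chord_sum g (flip h) =
    path_sum g.1 g.2 (arcsB F h.1 h.2) S.
  rewrite addrC -scaleN1r -path_sum_linear; apply: eq_path_sum => w _.
  by rewrite scaleN1r addrC.
by rewrite !arcsBE two_dots_identity.
Qed.

Lemma phi_trace_skel :
  phi_omega omega n (lproj (@omega_rel H 1 n) (skel_trace omega 1 n S c)) =
  3 *: lproj (@omega_rel H 2 n) (skel_trace omega 2 n S c).
Proof.
pose Tr2 := lproj (@omega_rel H 2 n) (skel_trace omega 2 n S c).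
pose KK := \sum_e \sum_e' (weight2 e * weight2 e') *: chord_sum e e'.
pose VV := \sum_e \sum_e' (weight2 e * weight2 e') *: trace2_class e e'.
(* The weighted summand does not change when [e] is flipped, so the sum over increasing pairs is
   half of the sum over all pairs. *)
have PhiK : phi_omega omega n (lproj (@omega_rel H 1 n) (skel_trace omega 1 n S c)) *+ 2
    = KK.
  rewrite phi_trace1.
  pose f e := weight2 e *: \sum_e' weight2 e' *: chord_sum e e'.
  have fE e : weight2 e *: path_sum e.1 e.2 (fun t => phi omega n (map c t)) S = f e.
    congr (_ *: _); rewrite -path_sum_sum; apply: eq_path_sum => w _.
    by rewrite phi_arcs pair_bigA.
  under eq_bigr => e _ do rewrite fE.
  rewrite -sum_increasing.
  - by apply: eq_bigr => e _; rewrite /f scaler_sumr; apply: eq_bigr => e' _; rewrite scalerA.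
  - move=> e; rewrite /f weight2_flip scaleNr -scalerN -sumrN; congr (_ *: _).
    rewrite -sum_flip; apply: eq_bigr => e' _.
    by rewrite chord_sum_flip flipK weight2_flip scaleNr opprK.
  by move=> x; rewrite /f weight2_diag scale0r.
(* 8 is the number of ways to order the two dotted edges of a matching and to direct each of
   them. *)
have VV8 : VV = Tr2 *+ 8.
  rewrite -[8%N]/(2 * 2 * 2)%N !mulrnA trace2 -sumrMnl -sum_increasing.
  - apply: eq_bigr => e _; rewrite -sum_increasing //.
    + move=> e'; rewrite trace2_class_flipr weight2_flip mulrN scalerN scaleNr.
      by rewrite opprK.
    by move=> x; rewrite weight2_diag mulr0 scale0r.
  - move=> e; congr (_ *+ _); apply: eq_bigr => e' _.
    by rewrite trace2_class_flipl weight2_flip mulNr scalerN scaleNr opprK.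
  move=> x; rewrite big1 ?mul0rn // => e' _.
  by rewrite weight2_diag mul0r scale0r.
have KK4 : KK *+ 4 = VV *+ 3.
  by apply: sum_flip_identity => [e|e e']; [exact: weight2_flip | exact: chord_sum_trace2].
(* Twice the left side is [KK], and [KK *+ 4 = VV *+ 3] is 24 times the second trace; 8 is cancelled
   over the rationals. *)
apply: (@scalerI _ _ 8); first by [].
rewrite scalerA mulrC -scalerA !scaler_nat -/Tr2 -VV8 -KK4 -PhiK -mulrnA.
by [].
Qed.
End Skeleton.

Lemma freeg_linear_eq (K : nzRingType) (X : choiceType) (V : lmodType K)
    (f g : {linear {freeg X / K} -> V}) :
  (forall x, f << x >> = g << x >>) -> f =1 g.
Proof.
move=> fg D; rewrite -[D]freeg_sumE !linear_sum; apply: eq_bigr => x _ /=.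
have -> : << coeff x D *g x >> = coeff x D *: << x >> :> {freeg X / K}.
  by apply/eqP/freeg_eqP => y; rewrite coeffZ !coeffU mul1r.
by rewrite !linearZ /= fg.
Qed.

Lemma phi_trace (H : vectType rat) (omega : {skew_symmetric H}) (n : nat) y :
  phi_omega omega n (lproj (@omega_rel H 1 n) (trace omega 1 n y)) =
  3 *: lproj (@omega_rel H 2 n) (trace omega 2 n y).
Proof.
have [D <-] := lproj_surj y.
pose f : {linear _ -> _} := phi_omega omega n \o lproj (@omega_rel H 1 n) \o
  trace omega 1 n \o lproj (@graph_rel H 0 n).
pose g : {linear _ -> _} := 3 \*: (lproj (@omega_rel H 2 n) \o
  trace omega 2 n \o lproj (@graph_rel H 0 n)).
apply: (@freeg_linear_eq _ _ _ f g) => G.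
have traceE r : trace omega r n (lproj (@graph_rel H 0 n) << G >>) = trace_graph omega r G.
  by rewrite /trace lliftE fglinE.
rewrite -[LHS]/(phi_omega omega n (lproj _ (trace omega 1 n (lproj _ << G >>)))).
rewrite -[RHS]/(3 *: lproj _ (trace omega 2 n (lproj _ << G >>))) !traceE.
have [m [S [c [Sp Sn n0 GE]]]] := graph0_skel G.
rewrite !(trace_skel _ _ Sp GE).
exact: phi_trace_skel.
Qed.

Theorem proposition1p5 (g : nat) (H : vectType rat)
    (omega : {skew_symmetric H}) (dimH : \dim {:H} = g.*2)
    (omega_nondeg : nondegenerate omega) :
  exists Phi : {linear Omega H 1 -> Omega H 2},
    forall x : hairy_lie H, Phi (traceC omega 1 x) = 3 *: traceC omega 2 x.
Proof.
exists (dsum_map (fun n => phi_omega omega n.+1)) => x.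
by apply: dsumP => n; apply: phi_trace.
Qed.
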